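(* Let $G$ be a planar graph without chordal $4$-cycles and without chordal $6$-cycles, and let $k$ be an integer with $k\geq\max\{7,\Delta(G)\}$. Then $G$ is equitably $k$-choosable.
   Context: Graphs are finite and simple; $\Delta(G)$ denotes the maximum degree of $G$. A cycle $C$ of length $k$ in $G$ is called a chordal $k$-cycle if there exists an edge $xy\in E(G)\setminus E(C)$ with $x,y\in V(C)$. A list assignment $L$ for $G$ assigns to each vertex $v\in V(G)$ a set $L(v)$ of acceptable colors; it is $k$-uniform if $|L(v)|=k$ for all $v\in V(G)$. An $L$-coloring of $G$ is a proper vertex coloring in which the color of each vertex $v$ belongs to $L(v)$. $G$ is equitably $k$-choosable if, for every $k$-uniform list assignment $L$, $G$ has an $L$-coloring in which each color appears on at most $\lceil |V(G)|/k\rceil$ vertices. *)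

(* Defs.v *)
From HB Require Import structures.
From mathcomp Require Import all_boot all_order all_algebra.
From mathcomp Require Import finmap.
From mathcomp Require Import all_classical all_reals all_analysis.

Set Implicit Arguments.
Unset Strict Implicit.
Unset Printing Implicit Defensive.

Import Order.TTheory GRing.Theory Num.Theory.
Import numFieldNormedType.Exports.

(* A finite simple graph is a symmetric irreflexive relation e on a finType V. *)

Section Graphs.
Local Open Scope set_scope.
Local Open Scope nat_scope.
Variables (V : finType) (e : rel V).

Definition simple_graph : Prop := symmetric e /\ irreflexive e.

Definition edge (x y : V) : {set V} := [set x; y]%SET.

Definition edges : {set {set V}} :=
  [set E : {set V} | [exists x, exists y, e x y && (E == edge x y)]]%SET.

Definition max_degree : nat := \max_(x : V) #|[set y | e x y]%SET|.

(* A cycle is listed as a duplicate-free sequence c of length at least 3 whose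
   cyclically consecutive vertices are adjacent. *)
Definition cycle_edges (c : seq V) : {set {set V}} :=
  [set E : {set V} | [exists x in c, E == edge x (next c x)]]%SET.

Definition chordal_cycle (k : nat) (c : seq V) : Prop :=
  [/\ 2 < size c, size c = k, ucycle e c &
      exists x y, [/\ x \in c, y \in c & edge x y \in edges :\: cycle_edges c]].

Definition ceil_div (m d : nat) : nat := (m + d.-1) %/ d.

Lemma ceil_div_leP (m d n : nat) : 0 < d -> (ceil_div m d <= n) = (m <= n * d).
Proof.
case: d => // d _.
by rewrite /ceil_div /= -ltnS ltn_divLR // mulSn addSn ltnS addnC leq_add2l.
Qed.

Definition list_coloring (K : choiceType) (L : V -> {fset K}) (f : V -> K) :
    Prop :=
  (forall v, f v \in L v) /\ (forall x y, e x y -> f x != f y).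

Definition equitably_choosable (k : nat) : Prop :=
  forall (K : choiceType) (L : V -> {fset K}),
    (forall v, #|` L v| = k) ->
    exists f : V -> K, list_coloring L f /\
      forall a : K, #|[set v | f v == a]%SET| <= ceil_div #|V| k.

End Graphs.

Section Planarity.
Local Open Scope classical_set_scope.
Local Open Scope ring_scope.
Variable R : realType.

Definition simple_arc (A : set (R * R)) (a b : R * R) : Prop :=
  exists g : R -> R * R,
    [/\ {within `[0, 1], continuous g}, {in `[0, 1] &, injective g},
        g 0 = a, g 1 = b & A = g @` `[0, 1]].

(* A drawing puts the vertices at p and the edge E along the arc A E. *)
Definition plane_drawing (V : finType) (e : rel V)
    (p : V -> R * R) (A : {set V} -> set (R * R)) : Prop :=
  [/\ injective p,
      forall x y, e x y -> simple_arc (A (edge x y)) (p x) (p y),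
      forall E z, E \in edges e -> A E (p z) -> z \in E &
      forall E F, E \in edges e -> F \in edges e -> E != F ->
        A E `&` A F `<=` [set p z | z in [set` (E :&: F)%SET]]].

Definition planar (V : finType) (e : rel V) : Prop :=
  exists (p : V -> R * R) (A : {set V} -> set (R * R)), plane_drawing e p A.

End Planarity.

(* Main.v *)
Require Import Defs.
From mathcomp Require Import all_boot all_order all_algebra.
From mathcomp Require Import finmap zify.
From mathcomp Require boolp.
Set Implicit Arguments.
Unset Strict Implicit.
Unset Printing Implicit Defensive.

(** Planarity and the missing chordal cycles enter only through a count of
    edges: every subgraph induced on n >= 2 vertices has at most 2n - 3 edges.
    This is [sparse], stated with degree sums, and the proof has two halves of
    different nature.

    Sparse graphs of maximum degree at most k, k >= 7, are equitably
    k-choosable.  Colour by induction, removing k vertices at a time.  If the k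
    removed vertices can be ordered so that the i-th one has at most k - i
    neighbours among the vertices that stay, a colouring of the rest extends to
    them with k different colours ([choosable_extend]).  Such a set grows out of
    a small [core] ([core_good]), because in a sparse graph one can always add a
    vertex with at most three neighbours outside.  If there is no core at all,
    the surroundings of every vertex of degree at most three are so rich in
    vertices of large degree that a discharging argument pushes the average
    degree up to essentially 4, against sparsity: a vertex of degree d > 4
    distributes its excess d - 4 among neighbours of degree at most three
    ([conserve]), and these are brought up to 4 ([recv3], [recv2]); the
    contradiction is [irreducible_not_sparse].

    Planar graphs without chordal 4-cycles and 6-cycles are sparse.  A vertex of
    degree at most two can be deleted and a cut vertex splits the graph, so by
    induction ([dual_sparse]) only graphs of minimum degree three without cut
    vertices remain.  There, Euler's inequality ([euler_bound]) and a
    discharging between the faces ([face_charge]) give at most 2n - 4 edges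
    ([core_density]): faces of length at least five are long enough to pay for
    the triangles and quadrilaterals, which the missing chordal cycles keep
    apart.

    No topology of the plane is used beyond compactness.  All that the face
    argument needs is a [dual] in the sense of MacLane: each edge has two sides,
    every even edge set is a cut of the dual, and the boundary of every face is
    even.  A drawing provides one as follows.  On a fine enough square grid the
    nodes near a vertex form a blob, the nodes near an arc join two blobs, and
    nodes near two arcs lie in a blob; so the graph is a minor of the grid
    ([blobs_dual]).  For the grid itself the duality is an explicit computation
    ([potential]), and it passes to minors by merging the cells on the two sides
    of deleted edges ([minor_dual]). *)

(** * Extending a list colouring over k vertices *)

Section Graph.
Variables (V : finType) (e : rel V).

Definition nbr (x : V) : {set V} := [set y | e x y].
Definition out (S : {set V}) (x : V) : nat := #|nbr x :\: S|.

(** Ordering [S] by decreasing [out], this says that the i-th vertex (counted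
    from 1) has at most k - i neighbours outside [S], without mentioning an
    order; the vertices without outer neighbours may come in any order, as
    there are only k vertices in all. *)
Definition good_set (k : nat) (S : {set V}) : Prop :=
  #|S| = k /\ forall x, x \in S -> 0 < out S x ->
    #|[set y in S | out S x <= out S y]| + out S x <= k.

(** The sum of degrees is twice the number of edges, so this is the bound
    2n - 3 on the number of edges of an induced subgraph. *)
Definition sparse : Prop :=
  forall U : {set V}, 1 < #|U| -> \sum_(x in U) #|nbr x :&: U| + 6 <= 4 * #|U|.

Section Greedy.
Variables (K : choiceType) (L : V -> {fset K}) (k : nat).
Hypothesis sym_e : symmetric e.
Hypothesis irr_e : irreflexive e.
Hypothesis cardL : forall v, #|` L v| = k.

Lemma avoid_color (v : V) (s : seq K) :
  size s < k -> exists2 c, c \in L v & c \notin s.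
Proof.
move=> lt_s; have [/hasP [c cL cs]|/hasPn all_s] :=
  boolP (has (fun c => c \notin s) (enum_fset (L v))); first by exists c.
have sub : {subset enum_fset (L v) <= s} by move=> c /all_s /negPn.
have := uniq_leq_size (fset_uniq (L v)) sub.
have -> : size (enum_fset (L v)) = k by rewrite -(cardL v) cardfE cardE.
by rewrite leqNgt lt_s.
Qed.

(** The list is coloured from its end: the head comes last and must avoid the
    colours of its neighbours in [T] and all the colours used on the tail. *)
Fixpoint greedy_order (T : {set V}) (s : seq V) : bool :=
  if s is x :: s' then (#|nbr x :&: T| + size s' < k) && greedy_order T s'
  else true.

(** The new colours are made pairwise distinct on [s]; that is what keeps the
    colour classes balanced in [choosable_extend]. *)
Lemma greedy_extend (T : {set V}) (f : V -> K) (s : seq V) :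
  uniq s -> {in s, forall x, x \notin T} -> greedy_order T s ->
  {in T, forall x, f x \in L x} ->
  {in T &, forall x y, e x y -> f x != f y} ->
  exists g : V -> K,
    [/\ {in T, g =1 f}, {in [predU T & s], forall x, g x \in L x},
        {in [predU T & s] &, forall x y, e x y -> g x != g y} &
        {in s &, injective g}].
Proof.
elim: s => [|x s IH] /=.
  move=> _ _ _ fL fe; exists f; split=> //.
  - by move=> x; rewrite inE /= orbF => /fL.
  - by move=> x y; rewrite !inE /= !orbF; apply: fe.
case/andP=> xs us nT /andP [szx go] fL fe.
have nTs : {in s, forall y, y \notin T}.
  by move=> y ys; apply: nT; rewrite inE ys orbT.
have nxT : x \notin T by apply: nT; rewrite inE eqxx.
have [g [gf gL ge gi]] := IH us nTs go fL fe.
pose forb := [seq g y | y <- enum (nbr x :&: T)] ++ [seq g y | y <- s].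
have [|c cL cn] := @avoid_color x forb.
  by rewrite size_cat !size_map -cardE.
pose h y := if y == x then c else g y.
have cT y : e x y -> y \in T -> c != g y.
  move=> exy yT; apply: contraNneq cn => ->; rewrite mem_cat map_f //.
  by rewrite mem_enum inE inE exy yT.
have cs y : y \in s -> c != g y.
  by move=> ys; apply: contraNneq cn => ->; rewrite mem_cat (map_f g ys) orbT.
have cTs y : e x y -> y \in [predU T & s] -> c != g y.
  by move=> exy; rewrite inE => /orP [/(cT _ exy)|/cs].
have inx y : y \in [predU T & x :: s] -> y != x -> y \in [predU T & s].
  by rewrite !inE => /or3P [->|/eqP -> /eqP//|->]; rewrite ?orbT.
exists h; split.
- move=> y yT; rewrite /h; case: eqP yT nxT => [->|_] yT; first by rewrite yT.
  by move=> _; apply: gf.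
- move=> y yTs; rewrite /h; case: (eqVneq y x) => [->//|yx].
  by apply: gL; apply: inx.
- move=> y z yTs zTs eyz; rewrite /h.
  case: (eqVneq y x) => [yx|yx]; case: (eqVneq z x) => [zx|zx].
  + by move: eyz; rewrite yx zx irr_e.
  + by apply: cTs; [rewrite -yx | apply: inx].
  + by rewrite eq_sym; apply: cTs; [rewrite -zx sym_e | apply: inx].
  + by apply: ge => //; apply: inx.
- move=> y z; rewrite !inE /h.
  case: (eqVneq y x) => [->|yx] /= ys; case: (eqVneq z x) => [->|zx] //= zs.
  + by move/eqP; rewrite (negPf (cs _ zs)).
  + by move/esym/eqP; rewrite (negPf (cs _ ys)).
  + exact: gi.
Qed.

Lemma mem_greedy_order (T : {set V}) (s : seq V) :
  (forall s1 x s2, s = s1 ++ x :: s2 -> #|nbr x :&: T| + size s2 < k) ->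
  greedy_order T s.
Proof.
elim: s => //= x s IH H; apply/andP; split; first exact: (H [::]).
by apply: IH => s1 y s2 def_s; apply: (H (x :: s1)); rewrite def_s.
Qed.

Lemma good_set_order (S : {set V}) : good_set k S ->
  exists s : seq V, [/\ uniq s, s =i S & greedy_order (~: S) s].
Proof.
case=> cS hS; pose r := relpre (out S) leq.
have tr : transitive r by move=> x y z; apply: leq_trans.
have so : sorted r (sort r (enum S)).
  by apply: sort_sorted => x y; apply: leq_total.
exists (sort r (enum S)); split; first by rewrite sort_uniq enum_uniq.
  by move=> x; rewrite mem_sort mem_enum.
apply: mem_greedy_order => s1 x s2 def_s.
have us : uniq (s1 ++ x :: s2) by rewrite -def_s sort_uniq enum_uniq.
have mem_s y : (y \in S) = (y \in s1 ++ x :: s2).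
  by rewrite -def_s mem_sort mem_enum.
have xS : x \in S by rewrite mem_s mem_cat inE eqxx orbT.
have -> : #|nbr x :&: ~: S| = out S x by rewrite /out setDE.
move: us; rewrite cat_uniq => /and3P [_ _ us2].
have sz2 : size (x :: s2) <= #|[set y in S | out S x <= out S y]|.
  rewrite -(card_uniqP us2); apply: subset_leq_card; apply/subsetP => y ys.
  rewrite inE mem_s mem_cat ys orbT /=.
  move: so; rewrite def_s sorted_cat_cons //= => /andP [_ pth].
  move: ys; rewrite inE => /predU1P [->//|ys].
  by have /allP /(_ _ ys) := order_path_min tr pth.
have sz : size (x :: s2) <= #|S|.
  apply: leq_trans sz2 _; apply: subset_leq_card; apply/subsetP => y.
  by rewrite inE => /andP [].
have [o0|/(hS _ xS)] := posnP (out S x); first by rewrite o0 -cS.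
by move: sz2 => /=; lia.
Qed.
End Greedy.

Lemma ceil_divD (m d : nat) : 0 < d -> ceil_div (m + d) d = (ceil_div m d).+1.
Proof. by case: d => // d _; rewrite /ceil_div addnAC divnDr // divnn addn1. Qed.

(** Removing k vertices lowers the bound on the size of a colour class by
    exactly one, and each colour is used at most once on [S]. *)
Lemma choosable_extend (k : nat) (S : {set V}) :
  symmetric e -> irreflexive e -> 0 < k -> good_set k S ->
  equitably_choosable (relpre (val : {x | x \in ~: S} -> V) e) k ->
  equitably_choosable e k.
Proof.
move=> sym_e irr_e k0 gS IH K L cL.
have [f' [[f'L f'e] f'c]] := IH K (L \o val) (fun v => cL (val v)).
have [v0 v0S] : exists v, v \in S.
  by apply/set0Pn; rewrite -card_gt0; case: gS => ->.
have [c0 _ _] := @avoid_color K L k cL v0 [::] k0.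
pose f x := if insub x is Some u then f' u else c0.
have fE (u : {x | x \in ~: S}) : f (val u) = f' u by rewrite /f valK.
have [s [us sS go]] := good_set_order gS.
have sT : {in s, forall x, x \notin ~: S} by move=> x; rewrite sS inE negbK.
have [||g [gf gL ge gi]] := greedy_extend sym_e irr_e cL us sT go (f := f).
- by move=> x xS; rewrite -[x]/(val (Sub x xS : {x | x \in ~: S})) fE; apply: f'L.
- move=> x y xS yS; rewrite -[x]/(val (Sub x xS : {x | x \in ~: S})).
  rewrite -[y]/(val (Sub y yS : {x | x \in ~: S})) !fE; exact: f'e.
have all_in x : x \in [predU ~: S & s] by rewrite !inE /= sS; case: (x \in S).
exists g; split; first by split=> *; [apply: gL | apply: ge].
move=> a.
have -> : #|V| = #|{: {x | x \in ~: S}}| + k.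
  by rewrite card_sig; case: gS => <- _; rewrite -(cardsC S) addnC.
rewrite ceil_divD // -addn1.
rewrite -(cardsID (~: S) [set v | g v == a]); apply: leq_add.
  apply: leq_trans (f'c a); rewrite -(card_imset _ val_inj).
  apply: subset_leq_card; apply/subsetP => x; rewrite !inE => /andP [gx xS].
  have xS' : x \in ~: S by rewrite inE.
  apply/imsetP; exists (Sub x xS') => //; rewrite inE -fE SubK.
  by rewrite -gf ?inE.
rewrite leqNgt; apply/negP => /card_gt1P [x [y [xA yA xy]]].
have inS z : z \in [set v | g v == a] :\: ~: S -> z \in s /\ g z = a.
  by rewrite !inE negbK sS => /andP [-> /eqP].
have [xs gx] := inS x xA; have [ys gy] := inS y yA.
by case/eqP: xy; apply: gi => //; rewrite gx gy.
Qed.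

(** * Cores *)

Section Core.
Variable k : nat.

Lemma out_leq (A B : {set V}) x : A \subset B -> out B x <= out A x.
Proof. by move=> sAB; apply: subset_leq_card; apply: setDS. Qed.

(** The average degree in a sparse induced subgraph is below 4. *)
Lemma sparse_low (U : {set V}) : sparse -> U != set0 ->
  exists2 x, x \in U & #|nbr x :&: U| <= 3.
Proof.
move=> spe U0; apply/exists_inP; apply: contraT; rewrite negb_exists_in.
move/forall_inP => H.
have [U1|U2] := leqP #|U| 1.
  have [x xU] := set0Pn _ U0.
  have := H x xU; apply: contraNT => _.
  by apply: leq_trans (leq_trans U1 _) => //; apply: subset_leq_card; apply: subsetIr.
have := spe U U2.
have : \sum_(x in U) 4 <= \sum_(x in U) #|nbr x :&: U|.
  by apply: leq_sum => x xU; have := H x xU; rewrite -ltnNge.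
rewrite sum_nat_const; lia.
Qed.

(** A seed for a good set.  After [C] has been filled up to k vertices by vertices
    with at most three outer neighbours, only [x1], [x2], [x3] can have more than
    three, and [z0], [z1], [z2] come last in the ordering, making room for the
    vertices with one, two and three outer neighbours. *)
Definition core (C : {set V}) : Prop :=
  [/\ #|C| <= k,
      exists z0 z1 z2,
        [/\ uniq [:: z0; z1; z2], {subset [:: z0; z1; z2] <= C},
            out C z0 = 0, out C z1 <= 1 & out C z2 <= 2] &
      exists x1 x2 x3, forall x, x \in C ->
        [\/ out C x <= 3, x = x1 /\ out C x + 1 <= k,
            x = x2 /\ out C x + 2 <= k | x = x3 /\ out C x + 3 <= k]].

(** Add repeatedly a vertex of degree at most three in the subgraph left
    outside. *)
Lemma fill (C : {set V}) (n : nat) : sparse -> #|C| <= n -> n <= #|V| ->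
  exists S : {set V}, [/\ #|S| = n, C \subset S & {in S :\: C, forall x, out S x <= 3}].
Proof.
move=> spe; elim: n => [|n IH] Cn nV.
  exists C; split=> //; first by apply/eqP; rewrite eqn_leq Cn.
  by move=> x; rewrite setDv inE.
have [Ceq|Cn'] := eqVneq #|C| n.+1.
  by exists C; split=> // x; rewrite setDv inE.
have [|S [cS sCS hS]] := IH _ (ltnW nV); first by lia.
have [|x xS dx] := @sparse_low (~: S) spe.
  by rewrite -card_gt0; move: (cardsC S); lia.
exists (x |: S); split; first by rewrite cardsU1 -in_setC xS cS.
  exact: subset_trans sCS (subsetU1 _ _).
move=> y; rewrite !inE => /andP [yC /predU1P [->|yS]].
  by apply: leq_trans dx; apply: subset_leq_card; rewrite -setDE setDS // subsetU1.
by apply: leq_trans (out_leq _ (subsetU1 x S)) (hS _ _); rewrite inE yC.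
Qed.

(** The vertices with at least d outer neighbours number at most k - d: for
    d <= 3 since z0, ..., z(d-1) are not among them, for d >= 4 since only
    [x1], [x2], [x3] can be. *)
Lemma core_good (C : {set V}) : sparse -> k <= #|V| -> core C ->
  exists S, good_set k S.
Proof.
move=> spe kV [Ck [z0 [z1 [z2 [uz zC o0 o1 o2]]]] [x1 [x2 [x3 hx]]]].
have [S [cS sCS hS]] := fill spe Ck kV.
exists S; split=> // x xS ox; set A := [set y in S | _].
have zS z : z \in [:: z0; z1; z2] -> z \in S by move=> /zC; apply: (subsetP sCS).
have [o3|o4] := leqP (out S x) 3.
  have cA (B : {set V}) : B \subset S -> [disjoint B & A] -> #|A| + #|B| <= k.
    move=> sBS dBA; rewrite -cS -(cardsID B S) addnC (setIidPr sBS) leq_add2l.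
    apply: subset_leq_card; rewrite subsetD; apply/andP; split.
      by apply/subsetP => y; rewrite inE => /andP [].
    by rewrite disjoint_sym.
  have zA z : out C z < out S x -> z \notin A.
    move=> oz; rewrite inE negb_and -ltnNge (leq_ltn_trans _ oz) ?orbT //.
    exact: out_leq.
  have dA (s : seq V) : {subset s <= [:: z0; z1; z2]} -> uniq s ->
     {in s, forall z, out C z < out S x} -> #|A| + size s <= k.
    move=> ss us hs; rewrite -(card_uniqP us) -[X in _ + X]cardsE; apply: cA.
      by apply/subsetP => y; rewrite inE => /ss /zS.
    by rewrite disjoint_subset; apply/subsetP => y; rewrite !inE => /hs /zA; rewrite !inE.
  move: uz => /= /and3P [uz1 uz2 _].
  case: (out S x) ox o3 dA => [|[|[|[|n]]]] // _ _ dA.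
  - apply: (dA [:: z0]) => // z; rewrite !inE => /eqP -> //; first by rewrite eqxx.
    by rewrite o0.
  - apply: (dA [:: z0; z1]) => /=.
    + by move=> z; rewrite !inE => /orP [] ->; rewrite ?orbT.
    + by move: uz1; rewrite !inE negb_or => /andP [-> _].
    + by move=> z; rewrite !inE => /orP [] /eqP ->; rewrite ?o0.
  - apply: (dA [:: z0; z1; z2]) => //=.
    + by rewrite uz1 uz2.
    + by move=> z; rewrite !inE => /or3P [] /eqP ->; rewrite ?o0 //; apply: leq_trans o1 _.
have big y : y \in A -> [\/ y = x1 /\ out S x + 1 <= k,
    y = x2 /\ out S x + 2 <= k | y = x3 /\ out S x + 3 <= k].
  rewrite inE => /andP [yS oy].
  have yC : y \in C.
    by apply: contraLR (leq_trans o4 oy) => yC; rewrite -leqNgt hS // inE yC.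
  have oC := leq_trans oy (out_leq y sCS).
  case: (hx y yC) => [|[yx h]|[yx h]|[yx h]]; first by lia.
  - by constructor 1; split=> //; lia.
  - by constructor 2; split=> //; lia.
  - by constructor 3; split=> //; lia.
have card_le (s : seq V) : {subset A <= s} -> #|A| <= size s.
  by move=> sA; apply: leq_trans (card_size s); apply: subset_leq_card; apply/subsetP.
have xA : x \in A by rewrite inE xS leqnn.
have k1 : out S x + 1 <= k by case: (big x xA); lia.
have [k3|] := leqP (out S x + 3) k.
  apply: leq_trans (_ : 3 + out S x <= k); last by lia.
  rewrite leq_add2r; apply: (card_le [:: x1; x2; x3]) => y /big.
  by case=> [] [-> _]; rewrite !inE eqxx ?orbT.
move=> k3; have [k2|k2] := leqP (out S x + 2) k.
  apply: leq_trans (_ : 2 + out S x <= k); last by lia.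
  rewrite leq_add2r; apply: (card_le [:: x1; x2]) => y /big.
  by case=> [] [-> h]; rewrite !inE ?eqxx ?orbT //; lia.
apply: leq_trans (_ : 1 + out S x <= k); last by lia.
rewrite leq_add2r; apply: (card_le [:: x1]) => y /big.
by case=> [] [-> h]; rewrite !inE ?eqxx ?orbT //; lia.
Qed.
End Core.
End Graph.

Lemma sparse_sub (V : finType) (e : rel V) (P : pred V) : sparse e ->
  sparse (relpre (val : {x | P x} -> V) e).
Proof.
move=> spe U U1.
have := spe (val @: U); rewrite card_imset; last exact: val_inj.
move/(_ U1); rewrite big_imset /=; last by move=> x y _ _; apply: val_inj.
apply: leq_trans; rewrite leq_add2r; apply: leq_sum => x xU.
rewrite -(card_imset _ val_inj); apply: subset_leq_card; apply/subsetP => y.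
case/imsetP => z; rewrite !inE => /andP [exz zU] ->.
by have /= -> := exz; rewrite imset_f.
Qed.

(** Below k vertices, colours can be chosen pairwise different; otherwise a core
    provides k vertices to remove.  Both hypotheses on the graph pass to induced
    subgraphs. *)
Theorem sparse_choosable (k : nat) :
  0 < k ->
  (forall (V : finType) (e : rel V), symmetric e -> irreflexive e ->
     (forall x, #|nbr e x| <= k) -> sparse e -> k <= #|V| ->
     exists C, core e k C) ->
  forall (V : finType) (e : rel V), symmetric e -> irreflexive e ->
  (forall x, #|nbr e x| <= k) -> sparse e -> equitably_choosable e k.
Proof.
move=> k0 cores V e.
have [n] := ubnP #|V|; elim: n => // n IH in V e * => leV se ie de spe.
have [kV|Vk] := leqP k #|V|; last first.
  move=> K L cL.
  have [v0 _|V0] := pickP (fun _ : V => true); last first.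
    exists (fun v => False_rect K (Bool.diff_true_false (V0 v))).
    by split=> [|a]; [split=> v | rewrite eq_card0 // => v]; have := V0 v.
  have [c0 _ _] := @avoid_color V K L k cL v0 [::] k0.
  have [|||||g [_ gL ge gi]] :=
    @greedy_extend V e K L k se ie cL set0 (fun=> c0) (enum V).
  - exact: enum_uniq.
  - by move=> x _; rewrite inE.
  - apply: mem_greedy_order => s1 x s2 def_s; rewrite setI0 cards0 add0n.
    apply: leq_trans Vk; rewrite cardE def_s size_cat /=; lia.
  - by move=> x; rewrite inE.
  - by move=> x y; rewrite inE.
  have all_in x : x \in [predU set0 & enum V] by rewrite !inE /= mem_enum.
  exists g; split; first by split=> *; [apply: gL | apply: ge].
  move=> a; apply: leq_trans (_ : 1 <= _).
    rewrite leqNgt; apply/negP => /card_gt1P [x [y [xA yA xy]]].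
    case/eqP: xy; apply: gi; rewrite ?mem_enum //.
    by move: xA yA; rewrite !inE => /eqP -> /eqP ->.
  rewrite ltnNge ceil_div_leP // mul0n -ltnNge; apply/card_gt0P; by exists v0.
have [C cC] := cores V e se ie de spe kV.
have [S gS] := core_good spe kV cC.
apply: (choosable_extend se ie k0 gS); apply: IH.
- have -> : #|{: {x | x \in ~: S}}| = #|~: S| by rewrite card_sig; apply: eq_card.
  by move: (cardsC S) leV; case: gS => -> _; lia.
- by move=> x y; apply: se.
- by move=> x; apply: ie.
- move=> x; apply: leq_trans (de (val x)).
  rewrite -(card_imset _ val_inj); apply: subset_leq_card; apply/subsetP => y.
  by case/imsetP => z; rewrite !inE => ezx ->.
- exact: sparse_sub.
Qed.

(** * Small sets in a graph without cores *)

Section SmallSets.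
Variables (V : finType) (e : rel V) (k : nat).
Hypothesis sym_e : symmetric e.
Hypothesis irr_e : irreflexive e.

Local Notation d x := #|nbr e x|.
Local Notation outl s x := (out e [set y in s] x).

(** Neighbourhoods of low vertices are handled as explicit lists, possibly with
    repetitions, that contain all neighbours: one list then serves for all the
    degrees up to its length. *)
Definition covers (x : V) (s : seq V) : Prop := {subset nbr e x <= s}.

Lemma edge_neq x y : e x y -> x != y.
Proof. by apply: contraTneq => ->; rewrite irr_e. Qed.

Lemma deg_neq x y : d x != d y -> x != y.
Proof. by apply: contraNneq => ->. Qed.

Lemma out_covers (s t : seq V) x :
  covers x t -> outl s x <= count (fun y => y \notin s) t.
Proof.
move=> cov; rewrite -size_filter.
apply: leq_trans (card_size _); apply: subset_leq_card; apply/subsetP => y.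
by rewrite 2!inE mem_filter => /andP [-> /cov].
Qed.

Lemma out_deg (s t : seq V) x :
  uniq t -> {subset t <= s} -> all (e x) t -> outl s x + size t <= d x.
Proof.
move=> ut ts /allP et; rewrite -(card_uniqP ut) -(cardsID [set y in s] (nbr e x)).
rewrite addnC leq_add2r; apply: subset_leq_card; apply/subsetP => y yt.
by rewrite !inE ts ?et.
Qed.

Lemma out_adj (s : seq V) x y n :
  d x <= n.+1 -> e x y -> y \in s -> outl s x <= n.
Proof.
move=> dx exy ys; have : outl s x + 1 <= d x.
  by apply: (@out_deg s [:: y]) => //= [z|]; rewrite ?exy // inE => /eqP ->.
lia.
Qed.

Lemma out_le_deg (S : {set V}) x : out e S x <= d x.
Proof. exact: subset_leq_card (subsetDl _ _). Qed.

(** The list is padded with repetitions when the degree is smaller than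
    announced. *)
Lemma extend_covers (t : seq V) x n : uniq t -> all (e x) t -> t != [::] ->
  d x <= size t + n ->
  exists t', [/\ size t' = n, all (e x) t' & covers x (t ++ t')].
Proof.
case: t => // y t ut /allP et _ dx.
pose r := [seq z <- enum (nbr e x) | z \notin y :: t].
have er z : z \in r -> e x z.
  by rewrite mem_filter mem_enum => /andP [_]; rewrite inE.
have sr : size r <= n.
  have : uniq (r ++ (y :: t)).
    rewrite cat_uniq ut filter_uniq ?enum_uniq // andbT.
    by apply/hasPn => z zt; rewrite mem_filter zt.
  move/card_uniqP; rewrite size_cat => c.
  have : #|r ++ y :: t| <= d x.
    apply: subset_leq_card; apply/subsetP => z; rewrite mem_cat.
    by case/orP => [/er|/et]; rewrite inE.
  by rewrite c => H; have := leq_trans H dx; rewrite addnC leq_add2l.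
exists (r ++ nseq (n - size r) y); split.
- by rewrite size_cat size_nseq subnKC.
- rewrite all_cat all_nseq et ?inE ?eqxx // orbT andbT.
  by apply/allP => z /er.
- move=> z zx; rewrite !mem_cat; have [//|zt] := boolP (z \in y :: t).
  by rewrite mem_filter zt mem_enum zx orbT.
Qed.

Lemma extend1 (t : seq V) x : uniq t -> all (e x) t -> t != [::] ->
  d x <= (size t).+1 -> exists2 y, e x y & covers x (rcons t y).
Proof.
move=> ut et nt; rewrite -addn1 => /(extend_covers ut et nt).
case=> t' []; case: t' => [|y []] //= _.
by rewrite andbT cats1; exists y.
Qed.

Lemma extend2 (t : seq V) x : uniq t -> all (e x) t -> t != [::] ->
  d x <= (size t).+2 ->
  exists y z, [/\ e x y, e x z & covers x (t ++ [:: y; z])].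
Proof.
move=> ut et nt; rewrite -addn2 => /(extend_covers ut et nt).
case=> t' []; case: t' => [|y [|z []]] //= _ /and3P [exy exz _] cov.
by exists y, z.
Qed.

Lemma extend3 (t : seq V) x : uniq t -> all (e x) t -> t != [::] ->
  d x <= (size t).+3 ->
  exists y z w, [/\ e x y, e x z, e x w & covers x (t ++ [:: y; z; w])].
Proof.
move=> ut et nt; rewrite -addn3 => /(extend_covers ut et nt).
case=> t' []; case: t' => [|y [|z [|w []]]] //= _ /and4P [exy exz exw _] cov.
by exists y, z, w.
Qed.

Hypothesis k7 : 6 < k.
Hypothesis dk : forall x, d x <= k.
Hypothesis irred : forall C, ~ core e k C.

Lemma no_bigs (s : seq V) (z0 z1 z2 : V) :
  size s <= 7 ->
  z0 != z1 -> z0 != z2 -> z1 != z2 -> {subset [:: z0; z1; z2] <= s} ->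
  outl s z0 <= 0 -> outl s z1 <= 1 -> outl s z2 <= 2 ->
  {in s, forall x, outl s x <= 3} -> False.
Proof.
move=> sz n01 n02 n12 zs o0 o1 o2 Hs; apply: (irred (C := [set y in s])); split.
- by rewrite cardsE; apply: leq_trans (card_size _) _; apply: leq_trans sz _.
- exists z0, z1, z2; split=> //; first by rewrite /= !inE negb_or n01 n02 n12.
    by move=> z /zs; rewrite inE.
  by apply/eqP; rewrite -leqn0.
- by exists z0, z0, z0 => x; rewrite inE => /Hs; constructor 1.
Qed.

(** The tool behind all the configurations below.  Only [A], [b], [c] may have
    more than three outer neighbours, and [b] and [c] have at least one neighbour
    inside, hence at most k - 1 outside.  If one of them had at most k - 2, or if
    they were equal, [s] would be a core; so both have full degree k and exactly
    one neighbour in [s]. *)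
Lemma two_bigs (s : seq V) (z0 z1 z2 A b c vb vc : V) :
  size s <= 7 ->
  z0 != z1 -> z0 != z2 -> z1 != z2 -> {subset [:: z0; z1; z2] <= s} ->
  outl s z0 <= 0 -> outl s z1 <= 1 -> outl s z2 <= 2 ->
  e b vb -> vb \in s -> e c vc -> vc \in s ->
  (forall x, x \in s -> [\/ outl s x <= 3, x = A /\ outl s A + 3 <= k,
      x = b | x = c]) ->
  [/\ b != c, d b = k, d c = k,
     {in s, forall y, e b y -> y = vb} & {in s, forall y, e c y -> y = vc}].
Proof.
move=> sz n01 n02 n12 zs o0 o1 o2 eb vbs ec vcs Hs.
have no_core x1 x2 : (forall x, x \in s -> [\/ outl s x <= 3,
    x = A /\ outl s A + 3 <= k, x = x1 /\ outl s x + 1 <= k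
    | x = x2 /\ outl s x + 2 <= k]) -> False.
  move=> H; apply: (irred (C := [set y in s])); split.
  - by rewrite cardsE; apply: leq_trans (card_size _) _; apply: leq_trans sz _.
  - exists z0, z1, z2; split=> //; first by rewrite /= !inE negb_or n01 n02 n12.
      by move=> z /zs; rewrite inE.
    by apply/eqP; rewrite -leqn0.
  - exists x1, x2, A => x; rewrite inE => /H [h|[-> h]|[-> h]|[-> h]].
    + by constructor 1.
    + by constructor 4.
    + by constructor 2.
    + by constructor 3.
have one x vx : e x vx -> vx \in s -> outl s x + 1 <= k.
  move=> ex vxs; apply: leq_trans (dk x).
  by apply: (@out_deg s [:: vx]) => //= [y|]; rewrite ?ex // inE => /eqP ->.
have neq : b != c.
  apply/eqP => bc; apply: (no_core b b) => x /Hs [h|h|h|h].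
  - by constructor 1.
  - by constructor 2.
  - by constructor 3; rewrite h; split=> //; apply: one eb vbs.
  - by constructor 3; rewrite h -bc; split=> //; apply: one eb vbs.
have eb2 : k < outl s b + 2.
  rewrite ltnNge; apply/negP => h2; apply: (no_core c b) => x /Hs [h|h|h|h].
  - by constructor 1.
  - by constructor 2.
  - by constructor 4; rewrite h.
  - by constructor 3; rewrite h; split=> //; apply: one ec vcs.
have ec2 : k < outl s c + 2.
  rewrite ltnNge; apply/negP => h2; apply: (no_core b c) => x /Hs [h|h|h|h].
  - by constructor 1.
  - by constructor 2.
  - by constructor 3; rewrite h; split=> //; apply: one eb vbs.
  - by constructor 4; rewrite h.
have full x vx : e x vx -> vx \in s -> k < outl s x + 2 ->
    d x = k /\ {in s, forall y, e x y -> y = vx}.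
  move=> ex vxs h2; split.
    apply/eqP; rewrite eqn_leq dk /=; apply: leq_trans (_ : outl s x + 1 <= _).
      by lia.
    by apply: (@out_deg s [:: vx]) => //= [y|]; rewrite ?ex // inE => /eqP ->.
  move=> y ys ey; apply/eqP; apply: contraLR h2 => nyv; rewrite -leqNgt.
  apply: leq_trans (dk x); apply: (@out_deg s [:: y; vx]) => /=.
  - by rewrite inE nyv.
  - by move=> z; rewrite !inE => /orP [] /eqP ->.
  - by rewrite ey ex.
have [dbk ub] := full _ _ eb vbs eb2; have [dck uc] := full _ _ ec vcs ec2.
by split.
Qed.

(** With room for one more vertex, any vertex of degree at most 4 adjacent to
    [b] could be added: it would become the second inner neighbour of [b] and
    have itself at most three outer ones. *)
Lemma two_bigs_excl (s : seq V) (z0 z1 z2 A b c vb vc : V) :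
  size s <= 6 ->
  z0 != z1 -> z0 != z2 -> z1 != z2 -> {subset [:: z0; z1; z2] <= s} ->
  outl s z0 <= 0 -> outl s z1 <= 1 -> outl s z2 <= 2 ->
  b \in s -> c \in s ->
  e b vb -> vb \in s -> e c vc -> vc \in s ->
  (forall x, x \in s -> [\/ outl s x <= 3, x = A /\ outl s A + 3 <= k,
      x = b | x = c]) ->
  [/\ b != c, d b = k, d c = k,
     forall y, d y <= 4 -> e b y -> y = vb &
     forall y, d y <= 4 -> e c y -> y = vc].
Proof.
move=> sz n01 n02 n12 zs o0 o1 o2 bs cs eb vbs ec vcs Hs.
have [bc dbk dck _ _] := two_bigs (leqW sz) n01 n02 n12 zs o0 o1 o2 eb vbs ec vcs Hs.
have sub y : {subset s <= y :: s} by move=> x xs; rewrite inE xs orbT.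
have mono y x : outl (y :: s) x <= outl s x.
  by apply: out_leq; apply/subsetP => z; rewrite !inE => ->; rewrite orbT.
have ext y w : d y <= 4 -> e w y -> w \in s ->
    [/\ b != c, d b = k, d c = k,
     {in y :: s, forall x, e b x -> x = vb} & {in y :: s, forall x, e c x -> x = vc}].
  move=> dy ewy ws; apply: (@two_bigs (y :: s) z0 z1 z2 A) => //.
  - by move=> z /zs /sub; apply.
  - exact: leq_trans (mono _ _) o0.
  - exact: leq_trans (mono _ _) o1.
  - exact: leq_trans (mono _ _) o2.
  - exact: sub.
  - exact: sub.
  - move=> x; rewrite inE => /predU1P [->|/Hs [h|[-> h]|h|h]].
    + by constructor 1; apply: (out_adj dy); [rewrite sym_e; exact: ewy | exact: sub].
    + by constructor 1; apply: leq_trans h.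
    + by constructor 2; split=> //; apply: leq_trans h; rewrite leq_add2r.
    + by constructor 3.
    + by constructor 4.
split=> // y dy ey.
- have [_ _ _ H _] := ext y b dy ey bs.
  by apply: H => //; rewrite inE eqxx.
- have [_ _ _ _ H] := ext y c dy ey cs.
  by apply: H => //; rewrite inE eqxx.
Qed.

End SmallSets.

(** * Configurations around vertices of degree at most three *)

(** In each configuration [v] is a vertex of degree at most three whose whole
    neighbourhood is put in the set, so that it plays the role of z0.  The roles
    of z1 and z2 go to vertices of degree at most three or four most of whose
    neighbours are included, and one vertex of degree at least five is
    harmless as soon as it has three neighbours inside.  What remains are two vertices
    [b], [c] of unknown degree, about which [two_bigs] either gives information
    or is contradicted: by equality of [b] and [c], or by a second neighbour in
    the set.  The names record how many neighbours of [v] have degree at least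
    five (big) or at most three (low); a free vertex is a further neighbour of
    degree at most four of a neighbour of [v]. *)
Section Configurations.
Set Default Proof Using "All".
Variables (V : finType) (e : rel V) (k : nat).
Hypothesis sym_e : symmetric e.
Hypothesis irr_e : irreflexive e.
Hypothesis k7 : 6 < k.

Local Notation d x := #|nbr e x|.
Local Notation outl s x := (out e [set y in s] x).

Hypothesis dk : forall x, d x <= k.
Hypothesis irred : forall C, ~ core e k C.
Local Notation two_bigs := (two_bigs k7 dk irred).
Local Notation two_bigs_excl := (two_bigs_excl sym_e k7 dk irred).
Local Notation covers := (covers e).
Local Notation out_deg s t x := (@out_deg V e s t x).
Local Notation out_adj s x y := (@out_adj V e s x y).
Local Notation deg_neq x y := (@deg_neq V e x y).
Local Notation edge_neq := (edge_neq irr_e).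

Local Notation low u := (d u <= 3).

Ltac nat_arith :=
  repeat match goal with
  | H : is_true (_ != _) |- _ => clear H
  | H : is_true (uniq _) |- _ => clear H
  | H : is_true (e _ _) |- _ => clear H
  | H : covers _ _ |- _ => clear H
  | H : forall x : _, _ |- _ => clear H
  end; lia.
Ltac mem_list := by rewrite !inE !eqxx ?orbT.
Ltac use_edge := first [assumption | rewrite sym_e; assumption].
Ltac differ := first
  [ assumption | rewrite eq_sym; assumption
  | by apply: edge_neq; use_edge | by apply: (deg_neq _ _); nat_arith ].
Ltac zap_bools :=
  repeat match goal with |- context [nat_of_bool ?b] =>
    generalize (leq_b1 b); move: (nat_of_bool b) => ? ? end; nat_arith.
(* Bounds the outer neighbours of a vertex by its listed neighbourhood or by its
   degree and one neighbour inside; [config] settles with it the side conditions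
   of a configuration, treating the vertices of the set one by one. *)
Ltac out_bound := match goal with
  | |- is_true (out _ _ _ <= _) => assumption
  | H : covers ?x _ |- is_true (out _ _ ?x <= _) =>
      apply: leq_trans (out_covers _ H) _; rewrite /= !inE !eqxx /= ?orbT /=; zap_bools
  | H : is_true (e ?x ?y) |- is_true (out _ _ ?x <= _) =>
      apply: (out_adj _ _ _ _ _ H); [nat_arith | mem_list]
  | H : is_true (e ?y ?x) |- is_true (out _ _ ?x <= _) =>
      apply: (out_adj _ x y _ _ _); [nat_arith | rewrite sym_e; exact: H | mem_list]
  | |- _ => nat_arith
  end.
Ltac vertex_ok := first
  [ constructor 3; reflexivity | constructor 4; reflexivity
  | constructor 1; out_bound | constructor 2; split; [reflexivity | nat_arith] ].
Ltac config := match goal with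
  | |- is_true (_ != _) => differ
  | |- {subset _ <= _} => move=> ?; rewrite !inE => /or3P [] /eqP ->; rewrite !eqxx ?orbT //
  | |- {subset _ <= _} => move=> ?; rewrite !inE => /orP [] /eqP ->; rewrite !eqxx ?orbT //
  | |- is_true (_ \in _) => mem_list
  | |- is_true (size _ <= _) => done
  | |- is_true (out _ _ _ <= _) => out_bound
  | |- is_true (e _ _) => use_edge
  | |- forall x, _ =>
      move=> ?; rewrite !inE;
      repeat (case/predU1P => [->|]); [.. | move/eqP => ->]; vertex_ok
  end.

(** A vertex of degree 5 with four low neighbours is the poorest donor; then the
    other two neighbours of [v] are of degree k and give 25 each. *)
Lemma three_bigs v A B D w w' w'' :
  covers v [:: A; B; D] -> e v A -> e v B -> e v D -> low v ->
  d A = 5 -> 4 < d B -> 4 < d D -> A != B -> A != D ->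
  e A w -> e A w' -> e A w'' -> low w -> low w' -> low w'' ->
  uniq [:: v; w; w'; w''] -> d B = k /\ d D = k.
Proof.
move=> cv vA vB vD lv dA dB dD AB AD Aw Aw' Aw'' lw lw' lw'' u.
have vw : v != w by move: u; rewrite /= !inE !negb_or -!andbA => /and3P [].
have oA : outl [:: v; A; B; D; w; w'; w''] A + 4 <= d A.
  apply: (out_deg _ [:: v; w; w'; w''] _ u); last by rewrite /= Aw Aw' Aw'' sym_e vA.
  by move=> x; rewrite !inE => /or4P [] ->; rewrite ?orbT.
have [] := @two_bigs [:: v; A; B; D; w; w'; w''] v A w A B D v v; try config.
by [].
Qed.

(** Once [A] has three low neighbours [v], [w], [w'], all inside, the
    exceptional vertices are [B] and a second neighbour [w1] of [w]. *)
Lemma two_big_nbrs v A B c w w1 w2 w' :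
  covers v [:: A; B; c] -> e v A -> e v B -> e v c -> low v -> 4 < d A -> 4 < d B ->
  d c <= 4 -> e A w -> e A w' -> low w -> low w' ->
  v != w -> v != w' -> w != w' -> covers w [:: A; w1; w2] -> e w w1 ->
  d B = k /\ d w1 = k.
Proof.
move=> cv vA vB vc lv bA bB dc Aw Aw' lw lw' vw vw' ww' cw ww1.
have oA : outl [:: v; A; B; c; w; w1; w'] A + 3 <= d A.
  apply: (out_deg _ [:: v; w; w'] _).
  - by rewrite /= !inE negb_or vw vw' ww'.
  - by move=> x; rewrite !inE => /or3P [] ->; rewrite ?orbT.
  - by rewrite /= Aw Aw' sym_e vA.
have oA' := leq_trans oA (dk A).
by have [] := @two_bigs [:: v; A; B; c; w; w1; w'] v w w' A B w1 v w; try config.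
Qed.

(** Here [A] keeps its whole excess for [v]. *)
Lemma one_big_two_low v A b c b1 b2 :
  covers v [:: A; b; c] -> e v A -> e v b -> e v c -> low v -> 4 < d A ->
  low b -> low c -> b != c -> covers b [:: v; b1; b2] -> e b b1 ->
  forall y, d y <= 4 -> e A y -> y = v.
Proof.
move=> cv vA vb vc lv bA lb lc bc cb bb1.
by have [] := @two_bigs_excl [:: v; A; b; c; b1] v b c v A b1 v b; try config.
Qed.

Lemma one_big_one_low v A b c b1 b2 w :
  covers v [:: A; b; c] -> e v A -> e v b -> e v c -> low v -> 4 < d A ->
  low b -> d c <= 4 -> covers b [:: v; b1; b2] -> e b b1 ->
  e A w -> low w -> v != w -> w != b -> False.
Proof.
move=> cv vA vb vc lv bA lb lc cb bb1 Aw lw vw wb.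
have [] := @two_bigs [:: v; A; b; c; b1; w] v b w v A b1 v b; try config.
move=> _ _ _ H _.
by case/eqP: vw; rewrite (H w) // !inE eqxx ?orbT.
Qed.

(** The edge between [A] and [b] replaces the missing outer neighbour of [b] in
    the set and is at the same time a second inner neighbour of [A]. *)
Lemma one_big_low_triangle v A b c c1 c2 c3 :
  covers v [:: A; b; c] -> e v A -> e v b -> e v c -> low v -> 4 < d A ->
  low b -> d c <= 4 -> b != c -> covers c [:: v; c1; c2; c3] -> e c c1 ->
  e A b -> False.
Proof.
move=> cv vA vb vc lv bA lb dc bc cc cc1 Ab.
have vb' := edge_neq vb.
have ob : outl [:: v; A; b; c; c1] b + 2 <= d b.
  apply: (out_deg _ [:: v; A] _) => /=.
  - by rewrite inE andbT; differ.
  - by move=> x; rewrite !inE => /orP [] ->; rewrite ?orbT.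
  - by rewrite sym_e vb sym_e Ab.
have ob' : outl [:: v; A; b; c; c1] b <= 1 by nat_arith.
have [] := @two_bigs [:: v; A; b; c; c1] v b c v A c1 v c; try config.
move=> _ _ _ H _.
by case/eqP: vb'; rewrite (H b) // !inE eqxx ?orbT.
Qed.

Lemma one_big_three_lows v A b c w w1 w2 w' :
  covers v [:: A; b; c] -> e v A -> e v b -> e v c -> low v -> 4 < d A ->
  d b <= 4 -> d c <= 4 -> e A w -> e A w' -> low w -> low w' ->
  v != w -> v != w' -> w != w' -> covers w [:: A; w1; w2] -> e w w1 -> False.
Proof.
move=> cv vA vb vc lv bA db dc Aw Aw' lw lw' vw vw' ww' cw ww1.
have [] :=
  @two_bigs [:: v; A; b; c; w; w1; w'] v w w' v A w1 v w; try config.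
move=> _ _ _ H _.
by case/eqP: vw; rewrite (H w) // !inE eqxx ?orbT.
Qed.

(** A vertex [A] of degree 5 with two low neighbours has at most three outer
    neighbours and drops out of consideration, so that the neighbours of [c] are
    controlled instead; they will send charge to [v] through [c]. *)
Lemma one_big_deg5 v A b c w w1 w2 c1 c2 c3 :
  covers v [:: A; b; c] -> e v A -> e v b -> e v c -> low v -> d A = 5 ->
  d b <= 4 -> d c = 4 -> e A w -> low w -> v != w ->
  covers w [:: A; w1; w2] -> e w w1 -> covers c [:: v; c1; c2; c3] -> e c c1 ->
  d c1 = k.
Proof.
move=> cv vA vb vc lv dA db dc Aw lw vw cw ww1 cc cc1.
have oA : outl [:: v; A; b; c; w; w1; c1] A + 2 <= d A.
  apply: (out_deg _ [:: v; w] _) => /=.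
  - by rewrite inE andbT; differ.
  - by move=> x; rewrite !inE => /orP [] ->; rewrite ?orbT.
  - by rewrite Aw sym_e vA.
have oA' : outl [:: v; A; b; c; w; w1; c1] A <= 3 by nat_arith.
have [] := @two_bigs [:: v; A; b; c; w; w1; c1] v w c A w1 c1 w c; try config.
by [].
Qed.

(** The neighbours of [c] keep no charge for low vertices of their own. *)
Lemma one_big_no_low v A b c c1 c2 c3 y :
  covers v [:: A; b; c] -> e v A -> e v b -> e v c -> low v -> d A = 5 ->
  d b <= 4 -> d c = 4 -> covers c [:: v; c1; c2; c3] -> e c c1 -> e c c2 ->
  e c1 y -> low y -> v != y -> False.
Proof.
move=> cv vA vb vc lv dA db dc cc cc1 cc2 c1y ly vy.
have oA : outl [:: v; A; c; b; c1; c2; y] A + 1 <= d A.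
  apply: (out_deg _ [:: v] _) => //=.
  - by move=> x; rewrite !inE => ->.
  - by rewrite sym_e vA.
have oA' : outl [:: v; A; c; b; c1; c2; y] A + 3 <= k by nat_arith.
have [] :=
  @two_bigs [:: v; A; c; b; c1; c2; y] v c y A c1 c2 c c; try config.
move=> _ _ _ H _.
have yc : y != c by differ.
by case/eqP: yc; rewrite (H y) // !inE eqxx ?orbT.
Qed.

Lemma no_big_two_low v a b c a1 a2 :
  covers v [:: a; b; c] -> e v a -> e v b -> e v c -> low v ->
  low a -> low b -> d c <= 4 -> a != b -> covers a [:: v; a1; a2] -> e a a1 -> False.
Proof.
move=> cv va vb vc lv la lb dc ab ca aa1.
have [] :=
  @two_bigs [:: v; a; b; c; a1] v a b v a1 a1 a a; try config.
move=> H _ _ _ _.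
by rewrite eqxx in H.
Qed.

Lemma no_big_one_low v a b c a1 a2 b1 b2 b3 :
  covers v [:: a; b; c] -> e v a -> e v b -> e v c -> low v ->
  low a -> d b <= 4 -> d c <= 4 -> a != b -> covers a [:: v; a1; a2] -> e a a1 ->
  covers b [:: v; b1; b2; b3] -> e b b1 ->
  d b1 = k /\ (forall y, d y <= 4 -> e b1 y -> y = b).
Proof.
move=> cv va vb vc lv la db dc ab ca aa1 cb bb1.
by have [] := @two_bigs_excl [:: v; a; b; c; a1; b1] v a b v a1 b1 a b; try config.
Qed.

Lemma no_big_two_free v a b c f1 f2 a3 b1 b2 b3 :
  covers v [:: a; b; c] -> e v a -> e v b -> e v c -> low v ->
  d a <= 4 -> d b <= 4 -> d c <= 4 -> a != b ->
  covers a [:: v; f1; f2; a3] -> e a f1 -> e a f2 -> d f1 <= 4 -> d f2 <= 4 ->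
  covers b [:: v; b1; b2; b3] -> e b b1 -> False.
Proof.
move=> cv va vb vc lv da db dc ab ca af1 af2 df1 df2 cb bb1.
have [] :=
  @two_bigs [:: v; a; b; c; f1; f2; b1] v a b v b1 b1 b b; try config.
move=> H _ _ _ _.
by rewrite eqxx in H.
Qed.

Lemma no_big_no_low v a b c a1 a2 a3 w :
  covers v [:: a; b; c] -> e v a -> e v b -> e v c -> low v ->
  d a = 4 -> d b <= 4 -> d c <= 4 ->
  covers a [:: v; a1; a2; a3] -> e a a1 -> e a a2 -> e a1 w -> low w -> v != w ->
  False.
Proof.
move=> cv va vb vc lv da db dc ca aa1 aa2 a1w lw vw.
have [] :=
  @two_bigs [:: v; a; b; c; a1; a2; w] v a w v a1 a2 a a; try config.
move=> _ _ _ H _.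
have wa : w != a by differ.
by case/eqP: wa; rewrite (H w) // !inE eqxx ?orbT.
Qed.

Lemma no_big_one_free v a b c f1 a2 a3 b1 b2 b3 :
  covers v [:: a; b; c] -> e v a -> e v b -> e v c -> low v ->
  d a <= 4 -> d b <= 4 -> d c <= 4 -> a != b ->
  covers a [:: v; f1; a2; a3] -> e a f1 -> e a a2 -> d f1 <= 4 ->
  covers b [:: v; b1; b2; b3] -> e b b1 -> d a2 = k /\ d b1 = k.
Proof.
move=> cv va vb vc lv da db dc ab ca af1 aa2 df1 cb bb1.
by have [] := @two_bigs [:: v; a; b; c; f1; a2; b1] v a b v a2 b1 a b; try config.
Qed.

(** The remaining configurations are around vertices of degree at most two.  A
    further such vertex [w] has at most two outer neighbours whatever the set
    is, and so can play z2 at no cost. *)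
Lemma low2_common_nbr v u w a b : v != u -> v != w -> u != w ->
  d u <= 2 -> d w <= 2 -> covers v [:: a; b] -> e v a -> e v b -> e a u -> False.
Proof.
move=> vu vw uw du dw cv va vb au.
have ow := leq_trans (out_le_deg e [set y in [:: v; u; w; a; b]] w) dw.
have [] :=
  @two_bigs [:: v; u; w; a; b] v u w v a b v v; try config.
move=> _ _ _ H _.
by case/eqP: vu; rewrite (H u) // !inE eqxx ?orbT.
Qed.

Lemma low2_isolated v u w u1 u2 : v != u -> v != w -> u != w ->
  d v = 0 -> d w <= 2 -> d u <= 2 -> covers u [:: u1; u2] -> e u u1 -> False.
Proof.
move=> vu vw uw dv dw du cu uu1.
have ov := leq_trans (out_le_deg e [set y in [:: v; u; w; u1]] v) (eq_leq dv).
have ow := leq_trans (out_le_deg e [set y in [:: v; u; w; u1]] w) dw.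
have [] :=
  @two_bigs [:: v; u; w; u1] v u w v u1 u1 u u; try config.
move=> H _ _ _ _.
by rewrite eqxx in H.
Qed.

Lemma low1_exclusive v u w b c c' : v != u -> v != w -> u != w ->
  d w <= 2 -> covers v [:: b] -> e v b -> covers u [:: c; c'] -> e u c ->
  d b = k /\ forall y, d y <= 4 -> e b y -> y = v.
Proof.
move=> vu vw uw dw cv vb cu uc.
have ow := leq_trans (out_le_deg e [set y in [:: v; u; w; b; c]] w) dw.
by have [] := @two_bigs_excl [:: v; u; w; b; c] v u w v b c v u; try config.
Qed.

Lemma low2_one_big v u w a b c c' : v != u -> v != w -> u != w ->
  d w <= 2 -> covers v [:: a; b] -> e v a -> e v b -> d a <= 4 ->
  covers u [:: c; c'] -> e u c ->
  d b = k /\ forall y, d y <= 4 -> e b y -> y = v.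
Proof.
move=> vu vw uw dw cv va vb da cu uc.
have ow := leq_trans (out_le_deg e [set y in [:: v; u; w; a; b; c]] w) dw.
by have [] := @two_bigs_excl [:: v; u; w; a; b; c] v u w v b c v u; try config.
Qed.

Lemma low2_two_bigs v w v2 a b c c' : v != v2 -> v != w -> v2 != w ->
  d w <= 2 -> covers v [:: a; b] -> e v a -> e v b -> d a < k ->
  e a v2 -> low v2 -> covers v2 [:: a; c; c'] -> e v2 c ->
  d b = k /\ forall y, d y <= 4 -> e b y -> y = v.
Proof.
move=> vv2 vw v2w dw cv va vb da av2 lv2 cv2 v2c.
have ow := leq_trans (out_le_deg e [set y in [:: v; v2; w; a; b; c]] w) dw.
have oa : outl [:: v; v2; w; a; b; c] a + 2 <= d a.
  apply: (out_deg _ [:: v; v2] _) => /=.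
  - by rewrite inE andbT.
  - by move=> x; rewrite !inE => /orP [] ->; rewrite ?orbT.
  - by rewrite av2 sym_e va.
have oa' : outl [:: v; v2; w; a; b; c] a + 3 <= k by nat_arith.
by have [] := @two_bigs_excl [:: v; v2; w; a; b; c] v v2 w a b c v v2; try config.
Qed.

Lemma low2_two_full v v2 v3 a b c c' : v != v2 -> v != v3 -> v2 != v3 ->
  covers v [:: a; b] -> e v a -> e v b ->
  e a v2 -> e a v3 -> low v2 -> low v3 -> covers v2 [:: a; c; c'] -> e v2 c ->
  d b = k /\ forall y, d y <= 4 -> e b y -> y = v.
Proof.
move=> vv2 vv3 v23 cv va vb av2 av3 lv2 lv3 cv2 v2c.
have oa : outl [:: v; v2; v3; a; b; c] a + 3 <= d a.
  apply: (out_deg _ [:: v; v2; v3] _) => /=.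
  - by rewrite !inE negb_or vv2 vv3 v23.
  - by move=> x; rewrite !inE => /or3P [] ->; rewrite ?orbT.
  - by rewrite av2 av3 sym_e va.
have oa' := leq_trans oa (dk a).
by have [] := @two_bigs_excl [:: v; v2; v3; a; b; c] v v2 v3 a b c v v2; try config.
Qed.

End Configurations.
Unset Default Proof Using.

(** * Charges at vertices *)

Section Discharging.
Variables (V : finType) (e : rel V) (k : nat).
Hypothesis sym_e : symmetric e.
Hypothesis irr_e : irreflexive e.
Hypothesis k7 : 6 < k.

Local Notation d x := #|nbr e x|.
Local Notation low u := (d u <= 3).
Local Notation covers := (covers e).

Definition lows (x : V) : {set V} := [set u in nbr e x | d u <= 3].
Definition bigs (x : V) : {set V} := [set y in nbr e x | 4 < d y].
Local Notation m x := #|lows x|.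

(** What a vertex [A] of degree at least 5 gives to a low neighbour [u], in
    sixtieths of a unit of degree.  The excess of [A] is 60 (d - 4).  It
    allows 60 for each of at most d - 4 low neighbours, 30, 20 or 12 for each of
    two, three or up to five when d = 5, and 20 for each of d when d >= 6.  For
    d = k a share of 25, raised to 30 for at most one neighbour, is affordable
    since 30 + 25 (k - 1) <= 60 (k - 4) exactly when k >= 7.  The share 30 is for a vertex whose charge
    comes from two neighbours only. *)
Definition charge (A u : V) : nat :=
  if m A == 1 then 60 * (d A - 4)
  else if m A <= d A - 4 then 60
  else if d A == 5 then
    (if m A == 2 then 30 else if m A == 3 then 20 else 12)
  else if d A < k then 20
  else if (d u == 3) && (#|bigs u| == 2) then 30 else 25.
Definition give (A u : V) : nat :=
  if (4 < d A) && (u \in lows A) then charge A u else 0.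

(** A vertex of degree at least 5 without low neighbours sends a share of
    its excess to each neighbour, since low vertices may be at distance two; the
    neighbours of degree 4 pass it on in equal shares by [forward]. *)
Definition relay (A : V) : nat :=
  if (4 < d A) && (m A == 0) then (if d A < 7 then 12 else 25) else 0.
Definition forward (x u : V) : nat :=
  if (d x == 4) && (u \in lows x) then \sum_(A in nbr e x) relay A %/ m x else 0.
Definition recv (u : V) : nat := \sum_A give A u + \sum_x forward x u.

Lemma pick_nbr (t : seq V) x : size t < d x -> exists2 y, e x y & y \notin t.
Proof.
move=> lt; have /subsetPn [y] : ~~ (nbr e x \subset t).
  by apply/negP => /subset_leq_card /leq_trans /(_ (card_size t)); rewrite leqNgt lt.
by rewrite inE; exists y.
Qed.

Lemma pick_low (t : seq V) x : size t < m x ->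
  exists y, [/\ e x y, low y & y \notin t].
Proof.
move=> lt; have /subsetPn [y] : ~~ (lows x \subset t).
  by apply/negP => /subset_leq_card /leq_trans /(_ (card_size t)); rewrite leqNgt lt.
by rewrite !inE => /andP [xy ly] yt; exists y.
Qed.

Lemma nbr3 v : d v = 3 -> exists a b c,
  [/\ uniq [:: a; b; c], e v a, e v b, e v c & covers v [:: a; b; c]].
Proof.
move=> d3; have [|a va _] := @pick_nbr [::] v; first by rewrite d3.
have [|b vb ba] := @pick_nbr [:: a] v; first by rewrite d3.
have [|c vc cab] := @pick_nbr [:: a; b] v; first by rewrite d3.
have u : uniq [:: c; b; a].
  by move: ba cab; rewrite /= !inE !negb_or => -> /andP [-> ->].
have [||//||t' [/size0nil -> _ cv]] := @extend_covers V e [:: c; b; a] v 0.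
- exact: u.
- by rewrite /= va vb vc.
- by rewrite d3.
by exists c, b, a; split.
Qed.

Lemma give_full A v : 4 < d A -> v \in lows A -> m A <= d A - 4 -> 60 <= give A v.
Proof. by move=> bA vA mA; rewrite /give bA vA /= /charge mA; case: ifP; lia. Qed.

Lemma give_only A v : 4 < d A -> v \in lows A -> m A = 1 -> give A v = 60 * (d A - 4).
Proof. by move=> bA vA mA; rewrite /give bA vA /= /charge mA. Qed.

Lemma give_ge12 A v : 4 < d A -> v \in lows A -> 12 <= give A v.
Proof.
move=> bA vA; rewrite /give bA vA /= /charge.
by do ![case: ifP => //=]; lia.
Qed.

Lemma give_ge20 A v : 4 < d A -> v \in lows A -> (d A == 5) && (3 < m A) = false ->
  20 <= give A v.
Proof.
move=> bA vA H; rewrite /give bA vA /= /charge.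
have : 0 < m A by apply/card_gt0P; exists v.
by move: H; do ![case: ifP => //=]; lia.
Qed.

Lemma give_k A v : d A = k -> v \in lows A -> 25 <= give A v.
Proof.
move=> dA vA; have bA : 4 < d A by lia.
rewrite /give bA vA /= /charge dA ltnn.
by do ![case: ifP => //=]; lia.
Qed.

Lemma give_k2 A v : d A = k -> v \in lows A -> d v = 3 -> #|bigs v| = 2 ->
  30 <= give A v.
Proof.
move=> dA vA dv bv; have bA : 4 < d A by lia.
rewrite /give bA vA /= /charge dA dv bv ltnn /=.
by do ![case: ifP => //=]; lia.
Qed.

Lemma give_5_2 A v : d A = 5 -> v \in lows A -> m A = 2 -> 30 <= give A v.
Proof. by move=> dA vA mA; rewrite /give dA vA /= /charge dA mA. Qed.

Lemma forward_ge x v (T : {set V}) c : d x = 4 -> v \in lows x ->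
  T \subset nbr e x -> {in T, forall A, c <= relay A %/ m x} ->
  c * #|T| <= forward x v.
Proof.
move=> dx vx sT cT; rewrite /forward dx vx /= mulnC.
rewrite -[X in X <= _]sum_nat_const (bigID [in T] [in nbr e x]) /=.
apply: leq_trans (leq_addr _ _).
rewrite [X in _ <= X](eq_bigl [in T]) => [|A].
  by apply: leq_sum => A /cT.
by apply/andP/idP => [[]//|AT]; split=> //; apply: (subsetP sT).
Qed.

(** Givers and forwarders can be accounted for separately, each from a list of
    distinct vertices. *)
Lemma recv_ge (t t' : seq V) v : uniq t -> uniq t' ->
  \sum_(A <- t) give A v + \sum_(x <- t') forward x v <= recv v.
Proof.
have le (f : V -> nat) s : uniq s -> \sum_(x <- s) f x <= \sum_x f x.
  by move=> us; rewrite (big_uniq _ us) /= [X in _ <= X](bigID [in s]) /= leq_addr.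
by move=> ut ut'; apply: leq_add; apply: le.
Qed.

Section Conserve.
Hypothesis dk : forall x, d x <= k.
(* Proved from irreducibility as [type2_unique]: at most one low neighbour of a
   vertex of degree k claims the share 30. *)
Hypothesis two_bigs_unique : forall A, d A = k -> 2 < m A ->
  {in lows A &, forall u u', d u = 3 -> #|bigs u| = 2 -> d u' = 3 ->
     #|bigs u'| = 2 -> u = u'}.

Lemma charge_total A : 4 < d A -> \sum_(u in lows A) charge A u <= 60 * (d A - 4).
Proof.
move=> bA; have mdA : m A <= d A.
  by apply: subset_leq_card; apply/subsetP => y; rewrite inE => /andP [].
have cst c : {in lows A, forall u, charge A u <= c} -> m A * c <= 60 * (d A - 4) ->
    \sum_(u in lows A) charge A u <= 60 * (d A - 4).
  move=> H; apply: leq_trans; rewrite -sum_nat_const; exact: leq_sum.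
have [m1|m1] := eqVneq (m A) 1.
  by apply: (cst (60 * (d A - 4))) => [u _|]; rewrite /charge m1 ?eqxx // mul1n.
have [m2|m2] := leqP (m A) (d A - 4).
  by apply: (cst 60) => [u _|]; [rewrite /charge (negPf m1) m2 | lia].
have [d5|d5] := eqVneq (d A) 5.
  have [m3|m3] := leqP (m A) 2.
    apply: (cst 30) => [u _|]; last by lia.
    by rewrite /charge (negPf m1) (leqNgt (m A)) m2 /= d5 eqxx; do ![case: ifP => //].
  have [m4|m4] := leqP (m A) 3.
    apply: (cst 20) => [u _|]; last by lia.
    rewrite /charge (negPf m1) (leqNgt (m A)) m2 /= d5 eqxx.
    by do ![case: ifP => //]; lia.
  apply: (cst 12) => [u _|]; last by lia.
  rewrite /charge (negPf m1) (leqNgt (m A)) m2 /= d5 eqxx.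
  by do ![case: ifP => //]; lia.
have [dlt|dge] := ltnP (d A) k.
  apply: (cst 20) => [u _|]; last by lia.
  by rewrite /charge (negPf m1) (leqNgt (m A)) m2 /= (negPf d5) dlt.
have dA : d A = k by apply/eqP; rewrite eqn_leq dk.
have chE u : charge A u = 25 + 5 * ((d u == 3) && (#|bigs u| == 2)).
  rewrite /charge (negPf m1) (leqNgt (m A)) m2 /= (negPf d5) ltnNge dge /=.
  by case: ifP.
rewrite (eq_bigr _ (fun u _ => chE u)) big_split /= sum_nat_const -big_distrr /=.
have le1 : \sum_(u in lows A) ((d u == 3) && (#|bigs u| == 2) : nat) <= 1.
  rewrite -big_mkcondr /= sum1_card leqNgt; apply/negP => /card_gt1P [u [u' []]].
  rewrite -!topredE /= !inE -!andbA => /and4P [Au lu du bu] /and4P [Au' lu' du' bu'] /eqP [].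
  apply: (two_bigs_unique dA); rewrite ?inE ?Au ?Au' //; try exact/eqP.
  lia.
lia.
Qed.

Lemma give_total A : \sum_u give A u + d A * relay A <= (4 < d A) * (60 * (d A - 4)).
Proof.
rewrite /give /relay; have [bA|sA] := ltnP 4 (d A); last first.
  by rewrite big1 //= muln0.
rewrite /= mul1n -big_mkcond /=.
have [m0|m0] := eqVneq (m A) 0.
  rewrite big_pred0 => [|u]; last by rewrite (cards0_eq m0) inE.
  by case: ifP; lia.
by rewrite muln0 addn0; apply: charge_total.
Qed.

(** The rounded-down shares of a forwarder add up to at most what it got, so
    everything received comes out of the excess of some vertex. *)
Lemma conserve : \sum_u recv u <= \sum_A (4 < d A) * (60 * (d A - 4)).
Proof.
rewrite /recv big_split /= exchange_big /= [X in _ + X]exchange_big /=.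
apply: leq_trans (_ : \sum_A (\sum_u give A u + d A * relay A) <= _); last first.
  by apply: leq_sum => A _; apply: give_total.
rewrite big_split leq_add2l.
apply: leq_trans (_ : \sum_x \sum_(A in nbr e x) relay A <= _).
  apply: leq_sum => x _; rewrite /forward; case: (d x == 4) => /=; last first.
    by rewrite big1.
  rewrite -big_mkcond /= sum_nat_const big_distrr /=.
  by apply: leq_sum => A _; rewrite mulnC leq_divM.
rewrite (exchange_big_dep predT) //=; apply: leq_sum => A _.
rewrite sum_nat_const leq_mul2r; apply/orP; right; apply: eq_leq.
apply: eq_card => x; rewrite [RHS]inE sym_e. rewrite unfold_in.
by rewrite -[LHS]/(A \in nbr e x) inE.
Qed.
End Conserve.
End Discharging.

(** * What low vertices receive *)

Section Receive.
Set Default Proof Using "All".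
Variables (V : finType) (e : rel V) (k : nat).
Hypothesis sym_e : symmetric e.
Hypothesis irr_e : irreflexive e.
Hypothesis k7 : 6 < k.

Local Notation d x := #|nbr e x|.
Local Notation low u := (d u <= 3).
Local Notation covers := (covers e).
Local Notation lows := (lows e).
Local Notation bigs := (bigs e).
Local Notation m x := #|lows x|.
Local Notation give := (give e k).
Local Notation relay := (relay e).
Local Notation forward := (forward e).
Local Notation recv := (recv e k).

Hypothesis dk : forall x, d x <= k.
Hypothesis irred : forall C, ~ core e k C.

Ltac arith :=
  repeat match goal with
  | H : is_true (_ != _) |- _ => clear H
  | H : is_true (uniq _) |- _ => clear H
  | H : is_true (e _ _) |- _ => clear H
  | H : is_true (_ \in _) |- _ => clear H
  | H : covers _ _ |- _ => clear H
  | H : forall x : _, _ |- _ => clear H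
  end; lia.

Lemma mem_lows A u : (u \in lows A) = e A u && low u.
Proof. by rewrite !inE. Qed.

Lemma lows_only A v : e v A -> low v -> (forall y, low y -> e A y -> y = v) -> m A = 1.
Proof.
move=> vA lv H; apply/eqP/cards1P; exists v; apply/setP => y.
rewrite mem_lows inE; apply/andP/eqP => [[Ay ly]|->]; first exact: H.
by rewrite sym_e vA.
Qed.

(** Three shares of 20 suffice; a smaller share 12 forces two shares of 25. *)
Lemma recv_type3 v A B D :
  uniq [:: A; B; D] -> covers v [:: A; B; D] -> e v A -> e v B -> e v D -> low v ->
  4 < d A -> 4 < d B -> 4 < d D -> 60 <= give A v + give B v + give D v.
Proof.
have lo X : e v X -> low v -> v \in lows X by rewrite mem_lows sym_e => -> ->.
have wlog A' B' D' : uniq [:: A'; B'; D'] -> covers v [:: A'; B'; D'] ->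
    e v A' -> e v B' -> e v D' -> low v -> 4 < d B' -> 4 < d D' ->
    (d A' == 5) && (3 < m A') -> 60 <= give A' v + give B' v + give D' v.
  rewrite /= !inE negb_or -andbA => /and4P [AB AD _ _] cv vA vB vD lv bB bD /andP [/eqP dA mA].
  have [w [Aw lw]] := @pick_low _ e [:: v] A' (ltnW (ltnW mA)).
  rewrite inE eq_sym => vw.
  have [w' [Aw' lw']] := @pick_low _ e [:: v; w] A' (ltnW mA).
  rewrite !inE negb_or ![w' == _]eq_sym => /andP [vw' ww'].
  have [w'' [Aw'' lw'']] := @pick_low _ e [:: v; w; w'] A' mA.
  rewrite !inE !negb_or ![w'' == _]eq_sym => /and3P [vw'' ww'' w'w''].
  have u4 : uniq [:: v; w; w'; w''].
    by rewrite /= !inE !negb_or vw vw' vw'' ww' ww'' w'w''.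
  have [dB dD] := three_bigs sym_e irr_e k7 dk irred cv vA vB vD lv dA bB bD AB AD
    Aw Aw' Aw'' lw lw' lw'' u4.
  have := give_k k7 dB (lo _ vB lv); have := give_k k7 dD (lo _ vD lv).
  have bA : 4 < d A' by rewrite dA.
  have := give_ge12 k7 bA (lo _ vA lv); arith.
move=> u cv vA vB vD lv bA bB bD.
have [hA|hA] := boolP ((d A == 5) && (3 < m A)); first exact: wlog.
have [hB|hB] := boolP ((d B == 5) && (3 < m B)).
  have : 60 <= give B v + give A v + give D v.
    apply: wlog => //; last by move=> y /cv; rewrite !inE orbCA.
    by move: u; rewrite /= !inE !negb_or [B == A]eq_sym -!andbA => /and4P [-> -> -> _].
  arith.
have [hD|hD] := boolP ((d D == 5) && (3 < m D)).
  have : 60 <= give D v + give A v + give B v.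
    apply: wlog => //; last by move=> y /cv; rewrite !inE orbA orbC.
    by move: u; rewrite /= !inE !negb_or [D == A]eq_sym [D == B]eq_sym -!andbA => /and4P [-> -> -> _].
  arith.
have := give_ge20 k7 bA (lo _ vA lv) (negPf hA).
have := give_ge20 k7 bB (lo _ vB lv) (negPf hB).
have := give_ge20 k7 bD (lo _ vD lv) (negPf hD); arith.
Qed.

(** Three low neighbours of [A] force full degree on the other big neighbour of
    [v] and on the second neighbours through the low neighbours of [A]. *)
Lemma type2_full v A B c : A != B ->
  covers v [:: A; B; c] -> e v A -> e v B -> e v c -> low v -> 4 < d A -> 4 < d B ->
  d c <= 4 -> 2 < m A ->
  d B = k /\ forall w x, e A w -> low w -> w != v -> e w x -> x != A -> d x = k.
Proof.
move=> AB cv vA vB vc lv bA bB dc mA.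
have H w w1 w2 : e A w -> low w -> w != v -> covers w [:: A; w1; w2] -> e w w1 ->
    d B = k /\ d w1 = k.
  move=> Aw lw wv cw ww1.
  have [w' [Aw' lw']] := @pick_low _ e [:: v; w] A mA.
  rewrite !inE negb_or ![w' == _]eq_sym => /andP [vw' ww'].
  rewrite eq_sym in wv.
  exact: (two_big_nbrs sym_e irr_e k7 dk irred cv vA vB vc lv bA bB dc Aw Aw' lw lw'
    wv vw' ww' cw ww1).
split.
  have [w [Aw lw]] := @pick_low _ e [:: v] A (ltnW mA).
  rewrite inE => wv.
  have [||||w1 [w2 [ww1 ww2 cw]]] := @extend2 V e [:: A] w => //.
    by rewrite /= sym_e Aw.
  by have [] := H w w1 w2 Aw lw wv cw ww1.
move=> w x Aw lw wv wx xA.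
have [||||w2 ww2 cw] := @extend1 V e [:: A; x] w => //.
- by rewrite /= inE eq_sym xA.
- by rewrite /= sym_e Aw wx.
by have [] := H w x w2 Aw lw wv cw wx.
Qed.

(** Two shares of 30: both donors have degree k, or both have degree 5 and two
    low neighbours, unless one of them can afford 60. *)
Lemma recv_type2 v A B c : uniq [:: A; B; c] ->
  covers v [:: A; B; c] -> e v A -> e v B -> e v c -> d v = 3 -> 4 < d A -> 4 < d B ->
  d c <= 4 -> 60 <= give A v + give B v.
Proof.
move=> u cv vA vB vc dv bA bB dc; have lv : low v by rewrite dv.
have AB : A != B by move: u; rewrite /= !inE negb_or -!andbA => /and3P [].
have q2 : #|bigs v| = 2.
  transitivity #|[set A; B]|.
    apply: eq_card => y; rewrite !inE; apply/andP/orP.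
      case=> vy dy; have := cv y; rewrite !inE => /(_ vy) /or3P [->|->|/eqP yc]; auto.
      by move: dy; rewrite yc ltnNge dc.
    by case=> /eqP ->.
  by rewrite cards2 AB.
have lA : v \in lows A by rewrite mem_lows sym_e vA.
have lB : v \in lows B by rewrite mem_lows sym_e vB.
have [mA|mA] := leqP (m A) (d A - 4).
  by apply: leq_trans (give_full k7 bA lA mA) _; apply: leq_addr.
have [mB|mB] := leqP (m B) (d B - 4).
  by apply: leq_trans (give_full k7 bB lB mB) _; apply: leq_addl.
have fA : 2 < m A -> d B = k.
  by move=> mA3; have [] := type2_full AB cv vA vB vc lv bA bB dc mA3.
have fB : 2 < m B -> d A = k.
  move=> mB3; have BA : B != A by rewrite eq_sym.
  have cv' : covers v [:: B; A; c] by move=> y /cv; rewrite !inE orbCA.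
  by have [] := type2_full BA cv' vB vA vc lv bB bA dc mB3.
have [m3|m2] := ltnP 2 (m A).
  have dB := fA m3; have dA : d A = k by apply: fB; arith.
  have := give_k2 k7 dA lA dv q2; have := give_k2 k7 dB lB dv q2; arith.
have dA : d A = 5 by arith.
have mA2 : m A = 2 by arith.
have [m3|m2'] := ltnP 2 (m B).
  by have := fB m3; arith.
have dB : d B = 5 by arith.
have mB2 : m B = 2 by arith.
have := give_5_2 k dA lA mA2; have := give_5_2 k dB lB mB2; arith.
Qed.

Lemma type2_decomp v A : d v = 3 -> #|bigs v| = 2 -> e v A -> 4 < d A ->
  exists B c, [/\ A != B, covers v [:: A; B; c], e v B, e v c & 4 < d B /\ d c <= 4].
Proof.
move=> dv q2 vA bA.
have /cards1P [B defB] : #|bigs v :\ A| == 1.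
  by have := cardsD1 A (bigs v); rewrite q2 inE inE vA bA /=; arith.
have : B \in bigs v :\ A by rewrite defB inE.
rewrite !inE => /and3P [BA vB bB].
have [|c vc cn] := @pick_nbr _ e [:: A; B] v; first by rewrite dv.
have [||||t' [/size0nil -> _ cv]] := @extend_covers V e [:: A; B; c] v 0.
- move: cn; rewrite /= !inE !negb_or eq_sym [c == B]eq_sym => /andP [-> ->].
  by rewrite eq_sym BA.
- by rewrite /= vA vB vc.
- by [].
- by rewrite dv.
exists B, c; split=> //; first by rewrite eq_sym.
split=> //; rewrite leqNgt; apply/negP => bc.
have : c \in bigs v :\ A.
  by rewrite !inE vc bc !andbT; move: cn; rewrite !inE negb_or => /andP [].
by rewrite defB inE => /eqP cB; move: cn; rewrite cB !inE eqxx orbT.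
Qed.

(** For two such neighbours of [A], [type2_full] applied to the first would give
    degree k to the neighbour of degree at most 4 of the second. *)
Lemma type2_unique A : d A = k -> 2 < m A ->
  {in lows A &, forall u u', d u = 3 -> #|bigs u| = 2 -> d u' = 3 ->
     #|bigs u'| = 2 -> u = u'}.
Proof.
move=> dA mA u u'; rewrite !mem_lows => /andP [Au lu] /andP [Au' lu'] du qu du' qu'.
apply/eqP; apply: contraT => uu'.
have bA : 4 < d A by arith.
have uA : e u A by rewrite sym_e.
have u'A : e u' A by rewrite sym_e.
have [B [c [AB cv uB uc [bB dc]]]] := type2_decomp du qu uA bA.
have [B' [c' [AB' cv' uB' uc' [bB' dc']]]] := type2_decomp du' qu' u'A bA.
have [_ /(_ u' c' Au' lu')] := type2_full AB cv uA uB uc lu bA bB dc mA.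
rewrite eq_sym uu' => /(_ isT uc') H; suff : d c' = k by arith.
by apply: H; apply: contraTneq dc' => ->; rewrite -ltnNge.
Qed.

(** A forwarder of degree 4 adjacent to [v] has three other neighbours. *)
Lemma forward_relays v x c : d x = 4 -> e v x -> low v ->
  (forall y, e x y -> y != v -> c <= relay y %/ m x) -> c * 3 <= forward x v.
Proof.
move=> dx vx lv H.
have -> : 3 = #|nbr e x :\ v|.
  by have := cardsD1 v (nbr e x); rewrite inE sym_e vx dx /=; arith.
apply: forward_ge => //; first by rewrite mem_lows sym_e vx lv.
  exact: subD1set.
by move=> y; rewrite !inE => /andP [yv xy]; apply: H.
Qed.

Lemma relay_k y : d y = k -> m y = 0 -> relay y = 25.
Proof.
move=> dy my; rewrite /relay my dy eqxx andbT.
have -> : 4 < k by arith.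
by rewrite (ltnNge k) k7.
Qed.

Lemma relay_big y : 4 < d y -> m y = 0 -> 12 <= relay y.
Proof. by move=> dy my; rewrite /relay my dy eqxx; case: ifP. Qed.

Lemma no_lows y : (forall w, e y w -> low w -> False) -> m y = 0.
Proof.
move=> H; apply/eqP; rewrite cards_eq0; apply/eqP/setP => w.
by rewrite mem_lows inE; apply/negP => /andP [/H].
Qed.

Lemma cov3 v x : e v x -> low x -> exists x1 x2, covers x [:: v; x1; x2] /\ e x x1.
Proof.
move=> vx lx; have [||||x1 [x2 [? ? ?]]] := @extend2 V e [:: v] x => //.
  by rewrite /= sym_e vx.
by exists x1, x2.
Qed.

Lemma cov4 v x : e v x -> d x <= 4 ->
  exists x1 x2 x3, covers x [:: v; x1; x2; x3] /\ e x x1.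
Proof.
move=> vx lx; have [||||x1 [x2 [x3 [? ? ? ?]]]] := @extend3 V e [:: v] x => //.
  by rewrite /= sym_e vx.
by exists x1, x2, x3.
Qed.

(** Either the only big neighbour gives 60, or it is of degree 5 and gives 30;
    in the latter case the other three neighbours of [c] are of degree k without
    low neighbours, and [c] forwards 25 from each of them to [v] alone. *)
Lemma recv_type1 v A b c : uniq [:: A; b; c] ->
  covers v [:: A; b; c] -> e v A -> e v b -> e v c -> d v = 3 -> 4 < d A ->
  d b <= 4 -> d c <= 4 -> 60 <= give A v + forward c v.
Proof.
move=> u cv vA vb vc dv bA db dc; have lv : low v by rewrite dv.
have bc : b != c by move: u; rewrite /= !inE negb_or -!andbA => /and4P [].
have lA : v \in lows A by rewrite mem_lows sym_e vA.
have only : (forall y, low y -> e A y -> y = v) -> 60 <= give A v + forward c v.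
  move=> H; have m1 := lows_only vA lv H.
  have := give_full k7 bA lA; rewrite m1 => H60.
  by apply: leq_trans (H60 _) (leq_addr _ _); arith.
have [lb|nlb] := leqP (d b) 3; have [lc|nlc] := leqP (d c) 3.
- have [b1 [b2 [cb bb1]]] := cov3 vb lb.
  apply: only => y ly; apply: (one_big_two_low sym_e irr_e k7 dk irred cv _ _ _ _ _ _ _ _ cb bb1) => //; arith.
- have [b1 [b2 [cb bb1]]] := cov3 vb lb.
  have [c1 [c2 [c3 [cc cc1]]]] := cov4 vc dc.
  apply: only => y ly Ay; apply/eqP; apply: contraT => yv.
  have [yb|yb] := eqVneq y b.
    rewrite yb in Ay.
    by case: (one_big_low_triangle sym_e irr_e k7 dk irred cv vA vb vc lv bA lb dc bc cc cc1 Ay).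
  rewrite eq_sym in yv.
  by case: (one_big_one_low sym_e irr_e k7 dk irred cv vA vb vc lv bA lb dc cb bb1 Ay ly yv yb).
- have [c1 [c2 [cc cc1]]] := cov3 vc lc.
  have [b1 [b2 [b3 [cb bb1]]]] := cov4 vb db.
  have cv' : covers v [:: A; c; b] by move=> y /cv; rewrite !inE [(y == b) || _]orbC.
  have cb' : c != b by rewrite eq_sym.
  apply: only => y ly Ay; apply/eqP; apply: contraT => yv.
  have [yc|yc] := eqVneq y c.
    rewrite yc in Ay.
    by case: (one_big_low_triangle sym_e irr_e k7 dk irred cv' vA vc vb lv bA lc db cb' cb bb1 Ay).
  rewrite eq_sym in yv.
  by case: (one_big_one_low sym_e irr_e k7 dk irred cv' vA vc vb lv bA lc db cc cc1 Ay ly yv yc).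
have dc4 : d c = 4 by arith.
have [m3|m2] := ltnP 2 (m A).
  have [w [Aw lw]] := @pick_low _ e [:: v] A (ltnW m3).
  rewrite inE eq_sym => vw.
  have [w' [Aw' lw']] := @pick_low _ e [:: v; w] A m3.
  rewrite !inE negb_or ![w' == _]eq_sym => /andP [vw' ww'].
  have [||||w1 [w2 [ww1 ww2 cw]]] := @extend2 V e [:: A] w => //.
    by rewrite /= sym_e Aw.
  by case: (one_big_three_lows sym_e irr_e k7 dk irred cv vA vb vc lv bA db dc Aw Aw' lw lw' vw vw' ww' cw ww1).
have [mA|mA] := leqP (m A) (d A - 4).
  by apply: leq_trans (give_full k7 bA lA mA) _; apply: leq_addr.
have dA : d A = 5 by arith.
have mA2 : m A = 2 by arith.
have g30 := give_5_2 k dA lA mA2.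
have [w [Aw lw]] := @pick_low _ e [:: v] A (eq_leq (esym mA2)).
rewrite inE eq_sym => vw.
have [||||w1 [w2 [ww1 ww2 cw]]] := @extend2 V e [:: A] w => //.
  by rewrite /= sym_e Aw.
have allk c1 : e c c1 -> c1 != v -> d c1 = k.
  move=> cc1 c1v.
  have [||||c2 [c3 [cc2 cc3 cc]]] := @extend2 V e [:: v; c1] c => //.
  - by rewrite /= inE eq_sym c1v.
  - by rewrite /= sym_e vc cc1.
  exact: (one_big_deg5 sym_e irr_e k7 dk irred cv vA vb vc lv dA db dc4 Aw lw vw cw ww1 cc cc1).
have nolow c1 : e c c1 -> c1 != v -> m c1 = 0.
  move=> cc1 c1v; apply: no_lows => y c1y ly.
  have [||||c2 [c3 [cc2 cc3 cc]]] := @extend2 V e [:: v; c1] c => //.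
  - by rewrite /= inE eq_sym c1v.
  - by rewrite /= sym_e vc cc1.
  have vy : v != y.
    apply/eqP => vy; have vc1 : e v c1 by rewrite vy sym_e.
    have := allk c1 cc1 c1v; have := cv c1; rewrite !inE => /(_ vc1).
    by case/or3P => /eqP ->; arith.
  exact: (one_big_no_low sym_e irr_e k7 dk irred cv vA vb vc lv dA db dc4 cc cc1 cc2 c1y ly vy).
have mc : m c = 1.
  apply: (lows_only vc lv) => y ly cy; apply/eqP; apply: contraT => yv.
  by have := allk y cy yv; arith.
have : 25 * 3 <= forward c v.
  apply: forward_relays => // y cy yv.
  by rewrite mc divn1 relay_k //; [apply: allk | apply: nolow].
arith.
Qed.

(** With one low neighbour [a], the neighbour [b] is of degree 4 and forwards 25
    from each of three vertices of degree k to [v] alone. *)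
Lemma recv_type0_low v a b c :
  uniq [:: a; b; c] -> covers v [:: a; b; c] -> e v a -> e v b -> e v c -> low v ->
  low a -> d b <= 4 -> d c <= 4 -> 60 <= forward b v + forward c v.
Proof.
move=> u cv va vb vc lv la db dc.
have [ab ac bc] : [/\ a != b, a != c & b != c].
  by move: u; rewrite /= !inE negb_or -!andbA => /and4P [].
have [a1 [a2 [ca aa1]]] := cov3 va la.
have [lb|nlb] := leqP (d b) 3.
  by case: (no_big_two_low sym_e irr_e k7 dk irred cv va vb vc lv la lb dc ab ca aa1).
have db4 : d b = 4 by arith.
have excl b1 : e b b1 -> b1 != v -> d b1 = k /\ (forall y, d y <= 4 -> e b1 y -> y = b).
  move=> bb1 b1v.
  have [||||b2 [b3 [bb2 bb3 cb]]] := @extend2 V e [:: v; b1] b => //.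
  - by rewrite /= inE eq_sym b1v.
  - by rewrite /= sym_e vb bb1.
  exact: (no_big_one_low sym_e irr_e k7 dk irred cv va vb vc lv la db dc ab ca aa1 cb bb1).
have mb : m b = 1.
  apply: (lows_only vb lv) => y ly bY; apply/eqP; apply: contraT => yv.
  by have [dy _] := excl y bY yv; arith.
have : 25 * 3 <= forward b v.
  apply: forward_relays => // y bY yv; have [dy H] := excl y bY yv.
  rewrite mb divn1 relay_k //; apply: no_lows => w yw lw.
  have wb := H w (leqW lw) yw; rewrite wb in lw; arith.
arith.
Qed.

(** Without low neighbours, three neighbours of degree 4 forward.  If none of them has a free neighbour
    each forwards three times 12 to [v] alone; if some has one, all relaying
    vertices have degree k, and each forwarder gets 25 from at least two of them
    and shares it between at most two low neighbours, which makes 24. *)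
Lemma recv_type0 v a b c :
  uniq [:: a; b; c] -> covers v [:: a; b; c] -> e v a -> e v b -> e v c -> low v ->
  d a <= 4 -> d b <= 4 -> d c <= 4 ->
  60 <= forward a v + forward b v + forward c v.
Proof.
move=> u cv va vb vc lv da db dc.
have [ab ac bc] : [/\ a != b, a != c & b != c].
  by move: u; rewrite /= !inE negb_or -!andbA => /and4P [].
have [la|nla] := leqP (d a) 3.
  by have := recv_type0_low u cv va vb vc lv la db dc; arith.
have ba : b != a by rewrite eq_sym.
have ca : c != a by rewrite eq_sym.
have cb : c != b by rewrite eq_sym.
have cvb : covers v [:: b; a; c] by move=> y /cv; rewrite !inE orbCA.
have cvc : covers v [:: c; a; b] by move=> y /cv; rewrite !inE orbA orbC.
have [lb|nlb] := leqP (d b) 3.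
  have ub : uniq [:: b; a; c] by rewrite /= !inE negb_or ba bc ac.
  by have := recv_type0_low ub cvb vb va vc lv lb da dc; arith.
have [lc|nlc] := leqP (d c) 3.
  have uc : uniq [:: c; a; b] by rewrite /= !inE negb_or ca cb ab.
  by have := recv_type0_low uc cvc vc va vb lv lc da db; arith.
have da4 : d a = 4 by arith.
have db4 : d b = 4 by arith.
have dc4 : d c = 4 by arith.
have one x y z : x != y -> covers v [:: x; y; z] -> e v x -> e v y -> e v z ->
    d x = 4 -> d y = 4 -> d z = 4 ->
    (forall f1 f2, e x f1 -> e x f2 -> f1 != v -> f2 != v -> d f1 <= 4 -> d f2 <= 4 ->
       f1 = f2) /\ (forall x1, e x x1 -> 4 < d x1 -> m x1 = 0).
  move=> xy cv' vx vy vz dx dy dz.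
  have [dx' dy' dz'] : [/\ d x <= 4, d y <= 4 & d z <= 4] by split; arith.
  split=> [f1 f2 xf1 xf2 f1v f2v df1 df2|x1 xx1 bx1].
    apply/eqP; apply: contraT => f12.
    have [||||a3 xa3 cx] := @extend1 V e [:: v; f1; f2] x => //.
    - by rewrite /= !inE negb_or ![v == _]eq_sym f1v f2v f12.
    - by rewrite /= sym_e vx xf1 xf2.
    have [b1 [b2 [b3 [cy yb1]]]] := cov4 vy dy'.
    by case: (no_big_two_free sym_e irr_e k7 dk irred cv' vx vy vz lv dx' dy' dz' xy
      cx xf1 xf2 df1 df2 cy yb1).
  apply: no_lows => w x1w lw.
  have x1v : x1 != v by apply: contraTneq bx1 => ->; arith.
  have [||||a2 [a3 [xa2 xa3 cx]]] := @extend2 V e [:: v; x1] x => //.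
  - by rewrite /= inE eq_sym x1v.
  - by rewrite /= sym_e vx xx1.
  have vw : v != w.
    apply/eqP => vw; have vx1 : e v x1 by rewrite vw sym_e.
    have := cv' x1; rewrite !inE => /(_ vx1) /or3P [] /eqP x1E; rewrite x1E in bx1; arith.
  exact: (no_big_no_low sym_e irr_e k7 dk irred cv' vx vy vz lv dx dy' dz' cx xx1 xa2 x1w lw vw).
have two x y z f : x != y -> covers v [:: x; y; z] -> e v x -> e v y -> e v z ->
    d x = 4 -> d y = 4 -> d z = 4 -> e x f -> f != v -> d f <= 4 ->
    (forall a2, e x a2 -> a2 != v -> a2 != f -> d a2 = k) /\
    (forall b1, e y b1 -> b1 != v -> d b1 = k).
  move=> xy cv' vx vy vz dx dy dz xf fv df.
  have [dx' dy' dz'] : [/\ d x <= 4, d y <= 4 & d z <= 4] by split; arith.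
  have H a2 b1 : e x a2 -> a2 != v -> a2 != f -> e y b1 -> b1 != v ->
      d a2 = k /\ d b1 = k.
    move=> xa2 a2v a2f yb1 b1v.
    have [||||a3 xa3 cx] := @extend1 V e [:: v; f; a2] x => //.
    - by rewrite /= !inE negb_or ![v == _]eq_sym fv a2v eq_sym a2f.
    - by rewrite /= sym_e vx xf xa2.
    have [||||b2 [b3 [yb2 yb3 cy]]] := @extend2 V e [:: v; b1] y => //.
    - by rewrite /= inE eq_sym b1v.
    - by rewrite /= sym_e vy yb1.
    exact: (no_big_one_free sym_e irr_e k7 dk irred cv' vx vy vz lv dx' dy' dz' xy
      cx xf xa2 df cy yb1).
  split=> [a2 xa2 a2v a2f|b1 yb1 b1v].
    have [|b1 yb1] := @pick_nbr _ e [:: v] y; first by rewrite dy.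
    by rewrite inE => b1v; have [] := H a2 b1 xa2 a2v a2f yb1 b1v.
  have [|a2 xa2] := @pick_nbr _ e [:: v; f] x; first by rewrite dx.
  rewrite !inE negb_or => /andP [a2v a2f].
  by have [] := H a2 b1 xa2 a2v a2f yb1 b1v.
(* A free second neighbour makes all the relaying second neighbours have degree
   k, which compensates for the third relay that is lost with it. *)
pose free x f := [&& e x f, f != v & d f <= 4].
have free_fwd x : d x = 4 -> e v x ->
    (forall f1 f2, e x f1 -> e x f2 -> f1 != v -> f2 != v -> d f1 <= 4 -> d f2 <= 4 ->
       f1 = f2) ->
    (forall x1, e x x1 -> 4 < d x1 -> m x1 = 0) ->
    (forall x1, e x x1 -> 4 < d x1 -> d x1 = k) -> 24 <= forward x v.
  move=> dx vx f1 m0 xk.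
  have mx : m x <= 2.
    rewrite leqNgt; apply/negP => m3.
    have [f [xf lf]] := @pick_low _ e [:: v] x (ltnW m3); rewrite inE => fv.
    have [g [xg lg]] := @pick_low _ e [:: v; f] x m3.
    rewrite !inE negb_or => /andP [gv /eqP []].
    by apply: f1 => //; arith.
  pose T := [set y in nbr e x | 4 < d y].
  have cT : 2 <= #|T|.
    have : #|(nbr e x :\ v) :\: T| <= 1.
      rewrite leqNgt; apply/negP => /card_gt1P [f [g [fT gT]]].
      move: fT gT; rewrite !inE !negb_and -!leqNgt.
      case/and3P => H1 fv xf; case/and3P => H2 gv xg /eqP [].
      rewrite xf in H1; rewrite xg in H2; exact: f1.
    have := cardsD1 v (nbr e x); rewrite inE sym_e vx dx.
    have := cardsID T (nbr e x :\ v).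
    have : #|(nbr e x :\ v) :&: T| <= #|T| by apply: subset_leq_card; apply: subsetIr.
    rewrite [true + _]/=; arith.
  have : 12 * #|T| <= forward x v.
    apply: forward_ge => //; first by rewrite mem_lows sym_e vx lv.
      by apply/subsetP => y; rewrite inE => /andP [].
    move=> y; rewrite !inE => /andP [xy by_].
    rewrite (relay_k (xk y xy by_) (m0 y xy by_)).
    have : 0 < m x by apply/card_gt0P; exists v; rewrite mem_lows sym_e vx lv.
    by case: (m x) mx => [|[|[|?]]].
  arith.
have nofree_fwd x : d x = 4 -> e v x -> (forall f, ~~ free x f) ->
    (forall x1, e x x1 -> 4 < d x1 -> m x1 = 0) -> 36 <= forward x v.
  move=> dx vx nf m0.
  have big y : e x y -> y != v -> 4 < d y.
    by move=> xy yv; have := nf y; rewrite /free xy yv /= -ltnNge.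
  have mx : m x = 1.
    apply: (lows_only vx lv) => y ly xy; apply/eqP; apply: contraT => yv.
    by have := big y xy yv; arith.
  apply: (@forward_relays _ _ 12) => // y xy yv.
  rewrite mx divn1; apply: relay_big; [exact: big | apply: m0 => //; exact: big].
have [oa1 oa2] := one a b c ab cv va vb vc da4 db4 dc4.
have [ob1 ob2] := one b a c ba cvb vb va vc db4 da4 dc4.
have [oc1 oc2] := one c a b ca cvc vc va vb dc4 da4 db4.
have some x y z : x != y -> x != z -> y != z ->
   covers v [:: x; y; z] -> covers v [:: x; z; y] -> e v x -> e v y -> e v z ->
    d x = 4 -> d y = 4 -> d z = 4 -> (exists f, free x f) ->
    [/\ (forall x1, e x x1 -> 4 < d x1 -> d x1 = k),
        (forall x1, e y x1 -> 4 < d x1 -> d x1 = k) &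
        (forall x1, e z x1 -> 4 < d x1 -> d x1 = k)].
  move=> xy xz yz cv1 cv2 vx vy vz dx dy dz [f /and3P [xf fv df]].
  have [H1 H2] := two x y z f xy cv1 vx vy vz dx dy dz xf fv df.
  have [_ H3] := two x z y f xz cv2 vx vz vy dx dz dy xf fv df.
  have nv x1 : 4 < d x1 -> x1 != v by apply: contraTneq => ->; arith.
  split=> x1 ex1 dx1; [apply: H1 => //|apply: H2 => //|apply: H3 => //]; try exact: nv.
  by apply: contraTneq dx1 => ->; arith.
have fin : [/\ (forall x1, e a x1 -> 4 < d x1 -> d x1 = k),
        (forall x1, e b x1 -> 4 < d x1 -> d x1 = k) &
        (forall x1, e c x1 -> 4 < d x1 -> d x1 = k)] ->
    60 <= forward a v + forward b v + forward c v.
  case=> ka kb kc; have := free_fwd a da4 va oa1 oa2 ka.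
  have := free_fwd b db4 vb ob1 ob2 kb; have := free_fwd c dc4 vc oc1 oc2 kc; arith.
have cv2 : covers v [:: a; c; b] by move=> y /cv; rewrite !inE [(y == b) || _]orbC.
have cvb2 : covers v [:: b; c; a] by move=> y /cvb; rewrite !inE [(y == a) || _]orbC.
have cvc2 : covers v [:: c; b; a] by move=> y /cvc; rewrite !inE [(y == a) || _]orbC.
have [/existsP fa|] := boolP [exists f, free a f].
  by apply: fin; apply: some.
rewrite negb_exists => /forallP na.
have [/existsP fb|] := boolP [exists f, free b f].
  by apply: fin; have [] := some b a c ba bc ac cvb cvb2 vb va vc db4 da4 dc4 fb.
rewrite negb_exists => /forallP nb.
have [/existsP fc|] := boolP [exists f, free c f].
  by apply: fin; have [] := some c a b ca cb ab cvc cvc2 vc va vb dc4 da4 db4 fc.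
rewrite negb_exists => /forallP nc.
have := nofree_fwd a da4 va na oa2; have := nofree_fwd b db4 vb nb ob2.
have := nofree_fwd c dc4 vc nc oc2; arith.
Qed.

(** Case distinction on the number of neighbours of degree at least five. *)
Lemma recv3 v : d v = 3 -> 60 <= recv v.
Proof.
move=> dv; have lv : low v by rewrite dv.
have [a [b [c [u va vb vc cv]]]] := nbr3 dv.
have [ab ac bc] : [/\ a != b, a != c & b != c].
  by move: u; rewrite /= !inE negb_or -!andbA => /and4P [].
have R := @recv_ge V e k [:: a; b; c] [:: a; b; c] v u u.
rewrite !big_cons !big_nil !addn0 in R.
have [uacb ubac ubca] : [/\ uniq [:: a; c; b], uniq [:: b; a; c] & uniq [:: b; c; a]].
  rewrite /= !inE !negb_or ![c == _]eq_sym [b == a]eq_sym.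
  by rewrite ab ac bc.
have [ucab ucba] : uniq [:: c; a; b] /\ uniq [:: c; b; a].
  rewrite /= !inE !negb_or ![c == _]eq_sym [b == a]eq_sym.
  by rewrite ab ac bc.
have C t : {subset [:: a; b; c] <= t} -> covers v t by move=> s y /cv /s.
have [Cacb Cbac Cbca] : [/\ covers v [:: a; c; b], covers v [:: b; a; c] & covers v [:: b; c; a]].
  by split; apply: C => y; rewrite !inE => /or3P [] ->; rewrite ?orbT.
have [Ccab Ccba] : covers v [:: c; a; b] /\ covers v [:: c; b; a].
  by split; apply: C => y; rewrite !inE => /or3P [] ->; rewrite ?orbT.
have [sa|ba] := leqP (d a) 4; have [sb|bb] := leqP (d b) 4; have [sc|bc'] := leqP (d c) 4.
- by have := recv_type0 u cv va vb vc lv sa sb sc; arith.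
- by have := recv_type1 ucab Ccab vc va vb dv bc' sa sb; arith.
- by have := recv_type1 ubac Cbac vb va vc dv bb sa sc; arith.
- by have := recv_type2 ubca Cbca vb vc va dv bb bc' sa; arith.
- by have := recv_type1 u cv va vb vc dv ba sb sc; arith.
- by have := recv_type2 uacb Cacb va vc vb dv ba bc' sb; arith.
- by have := recv_type2 u cv va vb vc dv ba bb sc; arith.
- by have := recv_type3 u cv va vb vc lv ba bb bc'; arith.
Qed.

Section ManyLow2.
Hypothesis third : forall x y, exists w, [/\ w != x, w != y & d w <= 2].

Lemma no_isolated v : d v <> 0.
Proof.
move=> dv; have [u [uv _ du]] := third v v.
have [w [wv wu dw]] := third v u.
rewrite eq_sym in uv; rewrite eq_sym in wv; rewrite eq_sym in wu.
have [u0|u0] := posnP (d u).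
  have o S x n : d x <= n -> out e S x <= n by apply: leq_trans (out_le_deg _ _ _).
  apply: (@no_bigs V e k k7 irred [:: v; u; w] v u w) => //.
  - by apply: o; rewrite dv.
  - by apply: o; rewrite u0.
  - exact: o.
  - by move=> x; rewrite !inE => /or3P [] /eqP ->; apply: o; arith.
have [u1 uu1 _] := @pick_nbr V e [::] u u0.
have [||||u2 uu2 cu] := @extend1 V e [:: u1] u => //; first by rewrite /= uu1.
exact: (low2_isolated sym_e irr_e k7 dk irred uv wv wu dv dw du cu uu1).
Qed.

Lemma exclusive_gives v b : e v b -> low v -> d b = k ->
  (forall y, d y <= 4 -> e b y -> y = v) -> 180 <= give b v.
Proof.
move=> vb lv dbk ex; have bb : 4 < d b by arith.
rewrite (give_only k bb) ?mem_lows ?[e b v]sym_e ?vb ?lv //; first by arith.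
by apply: (lows_only vb lv) => y ly by_; apply: ex => //; arith.
Qed.

(** A vertex of degree one or two has a neighbour of degree k with no other
    low neighbour, which gives it 60 (k - 4) >= 180, or two neighbours that
    give 60 each. *)
Lemma recv2 v : d v <= 2 -> 60 * (4 - d v) <= recv v.
Proof.
move=> dv; have lv : low v by arith.
have [u [uv _ du]] := third v v.
have [w [wv wu dw]] := third v u.
rewrite eq_sym in uv; rewrite eq_sym in wv; rewrite eq_sym in wu.
have u0 : 0 < d u by have := @no_isolated u; case: (d u).
have [c uc _] := @pick_nbr V e [::] u u0.
have [||||c' uc' cu] := @extend1 V e [:: c] u => //; first by rewrite /= uc.
have R (t : seq V) : uniq t -> \sum_(x <- t) give x v <= recv v.
  by move=> ut; have := @recv_ge V e k t [::] v ut isT; rewrite big_nil addn0.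
case d1 : (d v) => [|[|[|n]]]; [by case: (@no_isolated v)| | |by move: dv; rewrite d1].
  have [|b vb _] := @pick_nbr V e [::] v; first by rewrite d1.
  have [||||t' [/size0nil -> _ cv]] := @extend_covers V e [:: b] v 0 => //.
  - by rewrite /= vb.
  - by rewrite d1.
  have [dbk ex] := low1_exclusive sym_e irr_e k7 dk irred uv wv wu dw cv vb cu uc.
  have := exclusive_gives vb lv dbk ex.
  by have := R [:: b] isT; rewrite big_seq1; arith.
have [|a va _] := @pick_nbr V e [::] v; first by rewrite d1.
have [|b vb] := @pick_nbr V e [:: a] v; first by rewrite d1.
rewrite inE => ba.
have [||||t' [/size0nil -> _ cv]] := @extend_covers V e [:: a; b] v 0 => //.
- by rewrite /= inE eq_sym ba.
- by rewrite /= va vb.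
have cv' : covers v [:: b; a] by move=> y /cv; rewrite !inE orbC.
have uab : uniq [:: a; b] by rewrite /= inE eq_sym ba.
have Rab := R [:: a; b] uab; rewrite !big_cons big_nil addn0 in Rab.
have [da|ba'] := leqP (d a) 4.
  have [dbk ex] := low2_one_big sym_e irr_e k7 dk irred uv wv wu dw cv va vb da cu uc.
  by have := exclusive_gives vb lv dbk ex; arith.
have [db|bb] := leqP (d b) 4.
  have [dbk ex] := low2_one_big sym_e irr_e k7 dk irred uv wv wu dw cv' vb va db cu uc.
  by have := exclusive_gives va lv dbk ex; arith.
have key x y : covers v [:: x; y] -> e v x -> e v y -> 4 < d x ->
    60 <= give x v \/ 180 <= give y v.
  move=> cv1 vx vy bx.
  have vlx : v \in lows x by rewrite mem_lows sym_e vx.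
  have [mx|mx] := leqP (m x) (d x - 4); first by left; apply: give_full.
  right; have m2 : 1 < m x by arith.
  have [v2 [xv2 lv2]] := @pick_low _ e [:: v] x m2.
  rewrite inE eq_sym => vv2.
  have d2 : 2 < d v2.
    rewrite ltnNge; apply/negP => d2; have [w' [w'v w'v2 dw']] := third v v2.
    rewrite eq_sym in w'v; rewrite eq_sym in w'v2.
    exact: (low2_common_nbr sym_e irr_e k7 dk irred vv2 w'v w'v2 d2 dw' cv1 vx vy xv2).
  have [||||c2 [c3 [vc2 vc3 cv2]]] := @extend2 V e [:: x] v2 => //.
    by rewrite /= sym_e xv2.
  have [dxk|dxk] := ltnP (d x) k.
    have [w' [w'v w'v2 dw']] := third v v2.
    rewrite eq_sym in w'v; rewrite eq_sym in w'v2.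
    have [dbk ex] := low2_two_bigs sym_e irr_e k7 dk irred vv2 w'v w'v2 dw' cv1 vx vy
      dxk xv2 lv2 cv2 vc2.
    exact: exclusive_gives.
  have m3 : 2 < m x by arith.
  have [v3 [xv3 lv3]] := @pick_low _ e [:: v; v2] x m3.
  rewrite !inE negb_or ![v3 == _]eq_sym => /andP [vv3 v23].
  have [dbk ex] := low2_two_full sym_e irr_e k7 dk irred vv2 vv3 v23 cv1 vx vy
    xv2 xv3 lv2 lv3 cv2 vc2.
  exact: exclusive_gives.
have [ka|ka] := key a b cv va vb ba'; last by arith.
have [kb|kb] := key b a cv' vb va bb; arith.
Qed.
End ManyLow2.

(** With three or more vertices of degree at most two, all vertices end up with
    charge at least 4.  With at most two of them, they are ignored: their
    removal costs at most 4 in the degree sum, while sparsity leaves a gap of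
    6. *)
Lemma irreducible_not_sparse : 6 < #|V| -> ~ sparse e.
Proof.
move=> V7 spe.
have cons := conserve sym_e k7 dk type2_unique.
pose U := [set x | 2 < d x].
have main (W : {set V}) : U \subset W ->
    (forall x, x \in W -> d x <= 2 -> 60 * (4 - d x) <= recv x) ->
    4 * #|W| <= \sum_(x in W) d x.
  move=> sUW H.
  have : \sum_(x in W) (240 + (4 < d x) * (60 * (d x - 4))) <=
      \sum_(x in W) (60 * d x + recv x).
    apply: leq_sum => x xW.
    have [l2|g2] := leqP (d x) 2.
      by have := H x xW l2; rewrite [4 < d x]ltnNge (leqW (leqW l2)); arith.
    have [l3|g3] := leqP (d x) 3.
      by have := @recv3 x; rewrite [4 < d x]ltnNge (leqW l3); arith.
    by case: ltnP; arith.
  rewrite [X in X <= _]big_split [X in _ <= X]big_split /= sum_nat_const.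
  have -> : \sum_(i in W) 60 * d i = 60 * \sum_(i in W) d i by rewrite big_distrr.
  have -> : \sum_(i in W) (4 < d i) * (60 * (d i - 4)) =
      \sum_A (4 < d A) * (60 * (d A - 4)).
    rewrite [RHS](bigID [in W]) /= [X in _ = _ + X]big1 ?addn0 // => x xW.
    have : x \notin U by apply: contra xW; apply: (subsetP sUW).
    by rewrite inE -leqNgt => dx; rewrite [4 < d x]ltnNge (leqW (leqW dx)).
  have : \sum_(i in W) recv i <= \sum_i recv i.
    by rewrite [X in _ <= X](bigID [in W]) /= leq_addr.
  arith.
have [many|few] := leqP 3 #|~: U|.
  have third x y : exists w, [/\ w != x, w != y & d w <= 2].
    have /subsetPn [w] : ~~ (~: U \subset [set x; y]).
      by apply/negP => /subset_leq_card; rewrite cards2; case: (x != y); arith.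
    by rewrite !inE negb_or -leqNgt => dw /andP [wx wy]; exists w.
  have := main [set: V] (subsetT _) (fun x _ dx => recv2 third dx).
  have := spe [set: V]; rewrite cardsT => /(_ (ltnW (ltnW (ltnW (ltnW (ltnW V7)))))).
  by under eq_bigr do rewrite setIT; arith.
have cU : 4 < #|U| by have := cardsC U; arith.
have : 4 * #|U| <= \sum_(x in U) d x.
  by apply: main => // x; rewrite inE => dx dx'; move: dx; rewrite ltnNge dx'.
have := spe U (ltnW (ltnW (ltnW cU))).
have -> : \sum_(x in U) d x =
    \sum_(x in U) #|nbr e x :&: U| + \sum_(x in U) #|nbr e x :\: U|.
  by rewrite -big_split /=; apply: eq_bigr => x _; rewrite cardsID.
have : \sum_(x in U) #|nbr e x :\: U| <= \sum_(y in ~: U) 2.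
  apply: leq_trans (_ : \sum_(y in ~: U) d y <= _); last first.
    by apply: leq_sum => y; rewrite !inE -leqNgt.
  under eq_bigr do rewrite -sum1_card.
  rewrite (exchange_big_dep [in ~: U]) /=; last by move=> x y _; rewrite !inE => /andP [].
  apply: leq_sum => y yU; rewrite sum1_card; apply: subset_leq_card.
  apply/subsetP => x; rewrite unfold_in inE => /andP [_].
  by rewrite !inE sym_e => /andP [].
rewrite sum_nat_const; arith.
Qed.

End Receive.
Unset Default Proof Using.

Theorem exists_core (V : finType) (e : rel V) (k : nat) :
  6 < k -> symmetric e -> irreflexive e -> (forall x, #|nbr e x| <= k) ->
  sparse e -> k <= #|V| -> exists C, core e k C.
Proof.
move=> k7 se ie dk spe kV; apply: boolp.contrapT => H.
apply: (irreducible_not_sparse se ie k7 dk _ (leq_trans k7 kV) spe) => C cC.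
by apply: H; exists C.
Qed.

(** * Even edge sets *)

Section CycleSpace.
Variable V : finType.
Implicit Types (x y v : V) (E : {set V}) (B z : {set {set V}}).

Definition odd_at B v : bool := odd #|[set E in B | v \in E]|.
Definition even_set B : Prop := forall v, odd_at B v = false.
Definition symdiff B z : {set {set V}} := [set E | (E \in B) (+) (E \in z)].

Lemma edgeC x y : edge x y = edge y x. Proof. exact: setUC. Qed.

Lemma in_edge x y v : (v \in edge x y) = (v == x) || (v == y).
Proof. by rewrite !inE. Qed.

Lemma edge_eq x y u v :
  (edge x y == edge u v) = (x == u) && (y == v) || (x == v) && (y == u).
Proof.
apply/eqP/orP => [E|[] /andP [/eqP -> /eqP ->] //]; last exact: edgeC.
have H w : (w == x) || (w == y) = (w == u) || (w == v) by rewrite -!in_edge E.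
have [xE yE] : (x == u) || (x == v) /\ (y == u) || (y == v).
  by rewrite -!H !eqxx orbT.
have [uE vE] : (u == x) || (u == y) /\ (v == x) || (v == y).
  by rewrite !H !eqxx orbT.
case/orP: xE => /eqP xE; subst x.
  left; rewrite eqxx /=; case/orP: vE => /eqP vE; subst v; last exact: eqxx.
  by case/orP: yE.
right; rewrite eqxx /=; case/orP: uE => /eqP uE; subst u; last exact: eqxx.
by case/orP: yE.
Qed.

Lemma in_symdiff B z E : (E \in symdiff B z) = (E \in B) (+) (E \in z).
Proof. by rewrite in_set. Qed.

Lemma odd_at_symdiff B z v : odd_at (symdiff B z) v = odd_at B v (+) odd_at z v.
Proof.
rewrite /odd_at; set A1 := [set E in B | _]; set A2 := [set E in z | _].
have -> : [set E in symdiff B z | v \in E] = (A1 :\: A2) :|: (A2 :\: A1).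
  by apply/setP => E; rewrite !inE; do 3![case: (_ \in _)].
rewrite cardsU (_ : _ :&: _ = set0) ?cards0 ?subn0; last first.
  by apply/setP => E; rewrite !inE; do 3![case: (_ \in _)].
rewrite -(cardsID A2 A1) -(cardsID A1 A2) setIC !oddD.
by case: (odd #|A2 :&: A1|); case: (odd _); case: (odd _).
Qed.

Lemma odd_at1 x y v : x != y -> odd_at [set edge x y] v = (v == x) (+) (v == y).
Proof.
move=> xy; rewrite /odd_at.
have -> : [set E in [set edge x y] | v \in E] =
    if v \in edge x y then [set edge x y] else set0.
  apply/setP => E; rewrite !inE; case: (eqVneq E (edge x y)) => [->|ne] /=.
    by rewrite in_edge; case: ifP; rewrite !inE ?eqxx.
  by case: ifP; rewrite !inE ?(negPf ne).
rewrite in_edge; case: (eqVneq v x) => [->|vx] /=.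
  by rewrite cards1 (negPf xy).
by case: (v == y); rewrite ?cards1 ?cards0.
Qed.

Lemma handshake B : {in B, forall E, #|E| = 2} ->
  \sum_v #|[set E in B | v \in E]| = 2 * #|B|.
Proof.
move=> B2; under eq_bigr do rewrite -sum1_card.
rewrite (exchange_big_dep [in B]) /=; last by move=> v E _; rewrite inE => /andP [].
rewrite mulnC -sum_nat_const; apply: eq_bigr => E EB; rewrite sum1_card -(B2 E EB).
apply: eq_card => v; rewrite unfold_in.
by rewrite -[LHS]/(E \in [set E0 in B | v \in E0]) inE EB.
Qed.

(** A single odd vertex is impossible, so parity may be checked at all vertices
    but one. *)
Lemma handshake_odd B u : {in B, forall E, #|E| = 2} ->
  (forall v, v != u -> odd_at B v = false) -> even_set B.
Proof.
move=> B2 H v; have [->|/H //] := eqVneq v u.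
have := handshake B2 => /(congr1 odd); rewrite mul2n odd_double (bigD1 u) //= oddD.
have -> : odd (\sum_(w | w != u) #|[set E in B | w \in E]|) = false.
  apply: (big_ind (fun n => odd n = false)) => [//|a b Ha Hb|w wu].
    by rewrite oddD Ha Hb.
  exact: H.
by rewrite addbF.
Qed.

End CycleSpace.

Section EdgeSets.
Variables (V : finType) (e : rel V).
Hypothesis sym_e : symmetric e.
Hypothesis irr_e : irreflexive e.
Implicit Types (x y v : V) (E : {set V}) (B z : {set {set V}}).

Lemma edgesP E : reflect (exists x y, e x y /\ E = edge x y) (E \in edges e).
Proof.
rewrite inE; apply: (iffP existsP) => [[x /existsP [y /andP [exy /eqP ->]]]|].
  by exists x, y.
by case=> x [y [exy ->]]; exists x; apply/existsP; exists y; rewrite exy eqxx.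
Qed.

Lemma mem_edges x y : (edge x y \in edges e) = e x y.
Proof.
apply/edgesP/idP => [[u [v [euv /eqP]]]|exy]; last by exists x, y.
by rewrite edge_eq => /orP [] /andP [/eqP -> /eqP ->] //; rewrite sym_e.
Qed.

Lemma adj_neq x y : e x y -> x != y.
Proof. by apply: contraTneq => ->; rewrite irr_e. Qed.

Lemma edges_at E y : E \in edges e -> y \in E -> exists2 x, e y x & E = edge y x.
Proof.
case/edgesP => [u [v [euv ->]]]; rewrite in_edge => /orP [] /eqP ->.
  by exists v.
by exists u; [rewrite sym_e | exact: edgeC].
Qed.

Lemma card_edge E : E \in edges e -> #|E| = 2.
Proof. by case/edgesP => [u [v [euv ->]]]; rewrite cards2 (adj_neq euv). Qed.

Lemma path_join x y : connect e x y -> exists2 z : {set {set V}}, z \subset edges e &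
  forall v, odd_at z v = (v == x) (+) (v == y).
Proof.
case/connectP => p; elim: p x => [|t p IH] x /=.
  move=> _ ->; exists set0; first exact: sub0set.
  by move=> v; rewrite addbb /odd_at (_ : [set _ in _ | _] = set0) ?cards0 //;
    apply/setP => E; rewrite !inE.
case/andP=> ext pt def_y; have [z sz hz] := IH t pt def_y.
exists (symdiff [set edge x t] z).
  apply/subsetP => E; rewrite inE in_set1.
  by case: eqP => [-> _|_ /= /(subsetP sz)//]; rewrite mem_edges.
move=> v; rewrite odd_at_symdiff odd_at1 ?adj_neq // hz.
by do 3![case: (v == _)].
Qed.

Lemma even_other B x y : B \subset edges e -> even_set B -> edge x y \in B ->
  exists z : V, [/\ e y z, z != x & edge y z \in B].
Proof.
move=> sB eB xyB; pose S := [set E in B | y \in E].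
have xyS : edge x y \in S by rewrite inE xyB in_edge eqxx orbT.
have := eB y; rewrite /odd_at -/S (cardsD1 (edge x y)) xyS /= => /negbFE.
case: (set_0Vmem (S :\ edge x y)) => [-> |[E]]; first by rewrite cards0.
rewrite !inE => /and3P [Exy EB yE] _.
have [z eyz defE] := edges_at (subsetP sB _ EB) yE.
exists z; split=> //; last by rewrite -defE.
by apply: contraNneq Exy => <-; rewrite defE edgeC.
Qed.

(** Cycles of length up to five are produced as closed walks, given by their
    sequence of vertices. *)
Definition walk_edges x (p : seq V) : seq {set V} := pairmap (@edge V) x p.

Lemma odd_walk x (p : seq V) v : path [rel a b | a != b] x p ->
  odd (count (fun E => v \in E) (walk_edges x p)) = (v == x) (+) (v == last x p).
Proof.
elim: p x => [|y p IH] x /=; first by rewrite addbb.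
case/andP=> xy /IH; rewrite oddD => ->; rewrite in_edge.
have -> : odd ((v == x) || (v == y)) = (v == x) (+) (v == y).
  by case: (eqVneq v x) => [->|_] /=; [rewrite (negPf xy) | case: (v == y)].
by do 3![case: (v == _)].
Qed.

Lemma walk_edges_sub x (p : seq V) E v : E \in walk_edges x p -> v \in E -> v \in x :: p.
Proof.
elim: p x => //= y p IH x; rewrite inE => /predU1P [->|/IH H].
  by rewrite in_edge !inE => /orP [] ->; rewrite ?orbT.
by move/H => vyp; rewrite inE vyp orbT.
Qed.

Lemma uniq_walk x (p : seq V) : uniq (x :: p) -> uniq (walk_edges x p).
Proof.
elim: p x => //= y p IH x /andP [xyp u]; rewrite IH // andbT.
apply: contra xyp => /walk_edges_sub; apply; by rewrite in_edge eqxx.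
Qed.

Lemma uniq_closed_walk x y (p : seq V) : uniq [:: x, y & p] -> p != [::] ->
  uniq (walk_edges x (y :: rcons p x)).
Proof.
move=> u np; have := uniq_walk u; rewrite -cats1 /walk_edges /= pairmap_cat /=.
rewrite cat_uniq mem_cat !inE negb_or => /andP [h ->] /=; rewrite orbF.
move: u; rewrite /= inE negb_or -andbA => /and4P [xy xp yp up].
rewrite h /= andbT; apply/andP; split.
  rewrite edge_eq [y == x]eq_sym (negPf xy) andbF eqxx /=.
  case: p np {h} yp xp up => // z p _; rewrite /= inE negb_or => /andP [yz yp] _ _.
  apply/negP => /eqP yl; have := mem_last z p.
  by rewrite -yl inE (negPf yz) (negPf yp).
apply/negP => /walk_edges_sub /(_ _) H; have := H x.
by rewrite in_edge eqxx orbT inE (negPf xy) (negPf xp) => /(_ isT).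
Qed.

Lemma even_remove B (t : seq {set V}) : even_set B -> uniq t -> {subset t <= B} ->
  (forall v, odd (count (fun E => v \in E) t) = false) ->
  even_set [set E in B | E \notin t] /\ #|[set E in B | E \notin t]| + size t = #|B|.
Proof.
move=> eB ut st ct; split.
  move=> v; rewrite -(ct v) -[LHS]addbF -(eB v) /odd_at -size_filter.
  rewrite -(card_uniqP (filter_uniq _ ut)).
  rewrite -(cardsID [set E in t] [set E in B | v \in E]) oddD.
  have -> : [set E in B | v \in E] :\: [set E in t] =
            [set E in [set E in B | E \notin t] | v \in E].
    by apply/setP => E; rewrite !inE; do 3![case: (_ \in _)].
  have -> : #|[set E in B | v \in E] :&: [set E in t]| = #|filter (fun E : {set V} => v \in E) t|.
    apply: eq_card => E; rewrite !inE mem_filter.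
    by case: (boolP (E \in t)) => [/st ->|_]; rewrite ?andbF ?andbT.
  by rewrite addbCA addbb addbF.
rewrite -(card_uniqP ut) -(cardsID [set E in t] B) addnC; congr (_ + _).
  by apply: eq_card => E; rewrite !inE andbC; case: (boolP (E \in t)) => // /st ->.
by apply: eq_card => E; rewrite !inE andbC.
Qed.

Lemma even_card_ge3 B : B \subset edges e -> even_set B -> B != set0 -> 2 < #|B|.
Proof.
move=> sB eB; case/set0Pn => E EB.
have [x [y [exy defE]]] := edgesP _ (subsetP sB _ EB).
rewrite defE in EB; have xy := adj_neq exy.
have [z [eyz zx yzB]] := even_other sB eB EB.
have [w [ezw wy zwB]] := even_other sB eB yzB.
have yz := adj_neq eyz.
have u3 : uniq [:: edge x y; edge y z; edge z w].
  rewrite /= !inE !edge_eq negb_or (negPf xy) /= [x == z]eq_sym (negPf zx) /=.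
  by rewrite [y == w]eq_sym (negPf wy) (negPf yz) /= !andbF.
apply: (@leq_trans (size [:: edge x y; edge y z; edge z w])) => //.
rewrite -(card_uniqP u3); apply: subset_leq_card; apply/subsetP => F.
by rewrite !inE; case/or3P => /eqP ->.
Qed.

(** What is left after removing the walk is even and has at most two edges, and
    a nonempty even set has at least three. *)
Lemma even_closed_walk B x y (p : seq V) : B \subset edges e -> even_set B ->
  uniq [:: x, y & p] -> p != [::] -> {subset walk_edges x (y :: rcons p x) <= B} ->
  #|B| <= size p + 4 ->
  size p + 2 = #|B| /\ {subset B <= walk_edges x (y :: rcons p x)}.
Proof.
move=> sB eB u np st c.
have [|eB' cB'] := even_remove eB (uniq_closed_walk u np) st.
  move=> v; rewrite odd_walk /=; first by rewrite last_rcons addbb.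
  move: u; rewrite /= inE negb_or -andbA => /and3P [-> xp /andP [yp up]] /=.
  rewrite rcons_path; apply/andP; split.
    elim: p y yp up {np st c xp} => //= z p IH y; rewrite inE negb_or.
    by move=> /andP [yz _] /andP [zp /(IH _ zp) ->]; rewrite andbT.
  case/lastP: p np xp {yp up st c} => // p z _; rewrite mem_rcons inE negb_or.
  by rewrite last_rcons eq_sym => /andP [].
set B' := [set _ in B | _] in eB' cB'.
have sz : size (walk_edges x (y :: rcons p x)) = size p + 2.
  by rewrite size_pairmap /= size_rcons addn2.
have B0 : B' = set0.
  apply/eqP; apply: contraT => /(even_card_ge3 _ eB') H.
  have sB' : B' \subset edges e.
    by apply: subset_trans sB; apply/subsetP => E; rewrite !inE => /andP [].
  by have := H sB'; rewrite sz in cB'; move: c cB'; clear; lia.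
split; first by rewrite -cB' B0 cards0 sz.
move=> E EB; apply: contraT => nE; have : E \in B' by rewrite inE EB.
by rewrite B0 inE.
Qed.

(** An even set of at most five edges is a single cycle through any of its
    edges: follow edges until the walk closes up, and note that closing at a
    vertex other than the first would leave the starting edge out. *)
Lemma even_shape B x y : B \subset edges e -> even_set B -> edge x y \in B ->
  #|B| <= 5 -> exists p : seq V,
  [/\ size p + 2 = #|B|, uniq [:: x, y & p],
      {subset walk_edges x (y :: rcons p x) <= B} &
      {subset B <= walk_edges x (y :: rcons p x)}].
Proof.
move=> sB eB xyB c.
have adj u v : edge u v \in B -> e u v by move/(subsetP sB); rewrite mem_edges.
have xy := adj_neq (adj _ _ xyB).
have not_in (a b : V) (q : seq V) : a \notin [:: x; y] ->
    uniq [:: a, b & q] -> q != [::] -> {subset walk_edges a (b :: rcons q a) <= B} ->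
    x \notin [:: a, b & q] -> 1 < size q \/ #|B| <= 5 -> False.
  move=> _ u nq st xn _.
  have [|_ sub] := even_closed_walk sB eB u nq st.
    by apply: leq_trans c _; case: q nq {u st xn} => //= ? q _; lia.
  have := walk_edges_sub (sub _ xyB) (_ : x \in edge x y).
  rewrite in_edge eqxx => /(_ isT); rewrite !inE mem_rcons inE; move: xn.
  by rewrite !inE !negb_or => /and3P [/negPf -> /negPf -> /negPf ->].
have [z [eyz zx yzB]] := even_other sB eB xyB; have yz := adj_neq eyz.
have [w [ezw wy zwB]] := even_other sB eB yzB; have zw := adj_neq ezw.
have close (p : seq V) : uniq [:: x, y & p] -> p != [::] ->
    {subset walk_edges x (y :: rcons p x) <= B} -> exists p : seq V,
  [/\ size p + 2 = #|B|, uniq [:: x, y & p],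
      {subset walk_edges x (y :: rcons p x) <= B} &
      {subset B <= walk_edges x (y :: rcons p x)}].
  move=> u np st; exists p; have [|? ?] := even_closed_walk sB eB u np st; last by [].
  by apply: leq_trans c _; case: p np {u st} => //= ? p _; lia.
have subs (t : seq {set V}) : all [in B] t -> {subset t <= B} by move/allP.
have [wx|wx] := eqVneq w x.
  subst w; apply: (close [:: z]) => //.
    by rewrite /= !inE negb_or xy yz eq_sym zx.
  by apply: subs; rewrite /= xyB yzB zwB.
have [v [ewv vz wvB]] := even_other sB eB zwB; have wv := adj_neq ewv.
have [vx|vx] := eqVneq v x.
  subst v; apply: (close [:: z; w]) => //.
    rewrite /= !inE !negb_or xy yz zw ![x == _]eq_sym zx wx.
    by rewrite eq_sym wy.
  by apply: subs; rewrite /= xyB yzB zwB wvB.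
have [vy|vy] := eqVneq v y.
  subst v; exfalso; apply: (not_in z w [:: y]) => //; last by right.
  - by rewrite !inE negb_or zx eq_sym yz.
  - by rewrite /= !inE negb_or zw [z == y]eq_sym yz wy.
  - by apply: subs; rewrite /= zwB wvB yzB.
  - by rewrite !inE !negb_or ![x == _]eq_sym zx wx eq_sym xy.
have [u [evu uw vuB]] := even_other sB eB wvB; have vu := adj_neq evu.
have [ux|ux] := eqVneq u x.
  subst u; apply: (close [:: z; w; v]) => //.
    rewrite /= !inE !negb_or xy yz zw wv ![x == _]eq_sym zx wx vx.
    by rewrite ![y == _]eq_sym wy vy [z == _]eq_sym vz.
  by apply: subs; rewrite /= xyB yzB zwB wvB vuB.
have [uz|uz] := eqVneq u z.
  subst u; exfalso; apply: (not_in z w [:: v]) => //; last by right.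
  - by rewrite !inE negb_or zx eq_sym yz.
  - by rewrite /= !inE negb_or zw wv eq_sym vz.
  - by apply: subs; rewrite /= zwB wvB vuB.
  - by rewrite !inE !negb_or ![x == _]eq_sym zx wx vx.
have [uy|uy] := eqVneq u y.
  subst u; exfalso; apply: (not_in z w [:: v; y]) => //; last by right.
  - by rewrite !inE negb_or zx eq_sym yz.
  - by rewrite /= !inE !negb_or zw wv wy vy [z == v]eq_sym vz [z == y]eq_sym yz.
  - by apply: subs; rewrite /= zwB wvB vuB yzB.
  - by rewrite !inE !negb_or ![x == _]eq_sym zx wx vx eq_sym xy.
(* five edges of a path; the far end [x] of the first one has degree one *)
have u6 : uniq [:: x; y; z; w; v; u].
  rewrite /= !inE !negb_or xy yz zw wv vu ![x == _]eq_sym zx wx vx ux.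
  by rewrite ![y == _]eq_sym wy vy uy ![z == _]eq_sym vz uz [w == _]eq_sym uw.
have st : {subset walk_edges x [:: y; z; w; v; u] <= B}.
  by apply: subs; rewrite /= xyB yzB zwB wvB vuB.
have Bw : {subset B <= walk_edges x [:: y; z; w; v; u]}.
  have ut := uniq_walk u6.
  have eqc : #|walk_edges x [:: y; z; w; v; u]| = 5 by rewrite (card_uniqP ut).
  move=> E EB; have /subset_leqif_cards [_] : [set F in walk_edges x [:: y; z; w; v; u]] \subset B.
    by apply/subsetP => F; rewrite inE => /st.
  rewrite cardsE eqc => /esym; have -> : (5 == #|B|) = true.
    rewrite eqn_leq c andbT -eqc; apply: subset_leq_card; apply/subsetP; exact: st.
  by move/eqP/setP => /(_ E); rewrite inE EB => ->.
have yxB : edge y x \in B by rewrite edgeC.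
have [s [exs sy xsB]] := even_other sB eB yxB.
move: u6; rewrite cons_uniq => /andP [xn _].
have := Bw _ xsB; rewrite /= inE edge_eq eqxx /= (negPf sy) (negPf xy) /=.
have nx : x \in edge x s by rewrite in_edge eqxx.
by move/(@walk_edges_sub y [:: z; w; v; u]) => /(_ x nx) /(negP xn).
Qed.

End EdgeSets.

(** * Duals *)

(** [l E] and [r E] are the faces on the two sides of the edge [E]; the graph
    need not be connected and faces with empty boundary may occur.  The two
    clauses say that the cycle space is contained in the cut space of the dual
    and that face boundaries are cycles. *)
Definition dual (V : finType) (e : rel V) : Prop :=
  exists (F : finType) (l r : {set V} -> F),
    (forall z : {set {set V}}, z \subset edges e -> even_set z ->
       exists w : F -> bool, {in edges e, forall E, (E \in z) = w (l E) (+) w (r E)}) /\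
    forall f, even_set [set E in edges e | (l E == f) (+) (r E == f)].

Section Chordal.
Variables (V : finType) (e : rel V).

Lemma chordal4 a b c d : uniq [:: a; b; c; d] ->
  e a b -> e b c -> e c d -> e d a -> e a c -> chordal_cycle e 4 [:: a; b; c; d].
Proof.
move=> u ab bc cd da ac; split=> //.
  by rewrite /ucycle /= ab bc cd da.
exists a, c; split; [by rewrite inE eqxx | by rewrite !inE eqxx !orbT |].
rewrite in_setD andbC; apply/andP; split; first by apply/edgesP; exists a, c.
apply/negP; rewrite inE => /existsP [x /andP [xc]]; move: u; rewrite /= !inE !negb_or -!andbA.
case/and4P => nab nac nad /and4P [nbc nbd ncd _].
move: xc; rewrite !inE => /or4P [] /eqP ->; rewrite /next /= ?eqxx.
- by rewrite edge_eq eqxx [c == b]eq_sym (negPf nbc) [c == a]eq_sym (negPf nac) !andbF.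
- by rewrite [b == a]eq_sym (negPf nab) edge_eq (negPf nab) (negPf nac).
- rewrite [c == a]eq_sym (negPf nac) [c == b]eq_sym (negPf nbc).
  by rewrite edge_eq (negPf nac) (negPf nad).
- rewrite [d == a]eq_sym (negPf nad) [d == b]eq_sym (negPf nbd) [d == c]eq_sym (negPf ncd).
  by rewrite edge_eq (negPf nad) (negPf ncd) andbF.
Qed.

Lemma chordal6 a b c d f g y : uniq [:: a; b; c; d; f; g] ->
  e a b -> e b c -> e c d -> e d f -> e f g -> e g a ->
  e a y -> y \in [:: c; d] -> chordal_cycle e 6 [:: a; b; c; d; f; g].
Proof.
move=> u ab bc cd df fg ga ay yc; split=> //.
  by rewrite /ucycle /= ab bc cd df fg ga.
exists a, y; split.
- by rewrite inE eqxx.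
- by move: yc; rewrite !inE => /orP [] ->; rewrite ?orbT.
rewrite in_setD andbC; apply/andP; split; first by apply/edgesP; exists a, y.
apply/negP; rewrite inE => /existsP [z /andP [zc]].
move: u; rewrite [uniq _]/= !inE !negb_or -!andbA.
case/and5P => nab nac nad naf /and5P [nag nbc nbd nbf /and5P [nbg ncd ncf ncg /and4P [ndf ndg nfg _]]].
have [ya yb yg] : [/\ y != a, y != b & y != g].
  by move: yc; rewrite !inE => /orP [] /eqP ->; split=> //; rewrite eq_sym.
have E u v : a != u -> a != v -> (edge a y == edge u v) = false.
  by move=> /negPf h1 /negPf h2; rewrite edge_eq h1 h2.
have E1 v : y != v -> (edge a y == edge a v) = false.
  by move=> /negPf h1; rewrite edge_eq h1 (negPf ya) !andbF.
have E2 v : y != v -> (edge a y == edge v a) = false.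
  by move=> yv; rewrite edgeC [edge v a]edgeC; rewrite edgeC; exact: E1.
move: zc; rewrite !inE => /predU1P [->|/predU1P [->|/predU1P [->|/or3P [] /eqP ->]]];
  rewrite /next /= ?eqxx.
- by rewrite E1.
- by rewrite [b == a]eq_sym (negPf nab) E.
- by rewrite [c == a]eq_sym (negPf nac) [c == b]eq_sym (negPf nbc) E.
- rewrite [d == a]eq_sym (negPf nad) [d == b]eq_sym (negPf nbd) [d == c]eq_sym (negPf ncd).
  by rewrite E.
- rewrite [f == a]eq_sym (negPf naf) [f == b]eq_sym (negPf nbf) [f == c]eq_sym (negPf ncf).
  by rewrite [f == d]eq_sym (negPf ndf) E.
- rewrite [g == a]eq_sym (negPf nag) [g == b]eq_sym (negPf nbg) [g == c]eq_sym (negPf ncg).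
  by rewrite [g == d]eq_sym (negPf ndg) [g == f]eq_sym (negPf nfg) E2.
Qed.
End Chordal.

(** * Faces of a graph of minimum degree three without cut vertices *)

Section Faces.
Variables (V F : finType) (e : rel V) (l r : {set V} -> F) (U : {set V}).
Hypothesis sym_e : symmetric e.
Hypothesis irr_e : irreflexive e.
Hypothesis eU : forall x y, e x y -> x \in U.
Hypothesis deg3 : forall x, x \in U -> 2 < #|nbr e x|.
(* No vertex [y] separates two of its neighbours. *)
Hypothesis conn : forall y x t, e y x -> e y t ->
  connect [rel a b | [&& e a b, a != y & b != y]] x t.
Hypothesis cut : forall z : {set {set V}}, z \subset edges e -> even_set z ->
  exists w : F -> bool, {in edges e, forall E, (E \in z) = w (l E) (+) w (r E)}.
Hypothesis bd_even : forall f, even_set [set E in edges e | (l E == f) (+) (r E == f)].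

(** A cycle through [y] that uses prescribed edges there: close up a path that
    avoids [y].  With the cuts of the dual it shows that the faces at [y]
    follow each other as in a drawing. *)
Lemma star_cycle y x t : x != t -> e y x -> e y t ->
  exists z : {set {set V}}, [/\ z \subset edges e, even_set z &
    forall s, e y s -> (edge y s \in z) = (s == x) || (s == t)].
Proof.
move=> xt yx yt; pose ey := [rel a b | [&& e a b, a != y & b != y]].
have sym_y : symmetric ey by move=> a b /=; rewrite sym_e [(a != y) && _]andbC.
have irr_y : irreflexive ey by move=> a /=; rewrite irr_e.
have [J sJ oJ] := path_join sym_y irr_y (conn yx yt).
have nJ s : edge y s \notin J.
  apply/negP => /(subsetP sJ) /edgesP [a [b [/and3P [_ ay by_] /eqP]]].
  by rewrite edge_eq ![y == _]eq_sym (negPf ay) (negPf by_).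
have sJe : J \subset edges e.
  apply/subsetP => E /(subsetP sJ) /edgesP [a [b [/and3P [ab _ _] ->]]].
  by rewrite (mem_edges sym_e).
have yxn := adj_neq irr_e yx; have ytn := adj_neq irr_e yt.
exists (symdiff (symdiff J [set edge y x]) [set edge y t]); split.
- apply/subsetP => E; rewrite !in_symdiff !in_set1.
  case: (eqVneq E (edge y x)) => [->|_]; first by rewrite (mem_edges sym_e).
  case: (eqVneq E (edge y t)) => [->|_]; first by rewrite (mem_edges sym_e).
  by rewrite !addbF => /(subsetP sJe).
- move=> v; rewrite !odd_at_symdiff !odd_at1 // oJ.
  by do 3![case: (v == _)].
- move=> s ys; rewrite !in_symdiff !in_set1 (negPf (nJ s)) !edge_eq eqxx /=.
  rewrite (negPf yxn) (negPf ytn) /= !orbF.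
  by case: (eqVneq s x) => [->|_] //=; rewrite (negPf xt).
Qed.

Lemma sides_neq E : E \in edges e -> l E != r E.
Proof.
case/edgesP => y [x [yx ->]].
have [|t yt] := @pick_nbr _ e [:: x] y; first by rewrite (ltn_trans _ (deg3 (eU yx))).
rewrite inE => tx; have xt : x != t by rewrite eq_sym.
have [z [sz ez hz]] := star_cycle xt yx yt.
have [w hw] := cut sz ez; have := hw (edge y x); rewrite (mem_edges sym_e) yx.
rewrite hz // eqxx => /(_ isT) H; apply/negP => /eqP lr.
by rewrite lr addbb in H.
Qed.

Definition bd f : {set {set V}} := [set E in edges e | (l E == f) (+) (r E == f)].
Definition opp E f := if l E == f then r E else l E.

Lemma bd_sub f : bd f \subset edges e.
Proof. by apply/subsetP => E; rewrite in_set => /andP []. Qed.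

Lemma bdP E f : E \in edges e -> (E \in bd f) = (l E == f) || (r E == f).
Proof.
move=> Ee; rewrite in_set Ee /=; have := sides_neq Ee.
case: (eqVneq (l E) f) => [<-|//] /=; rewrite eq_sym => /negPf -> //.
Qed.

Lemma opp_neq E f : E \in edges e -> opp E f != f.
Proof.
move=> Ee; rewrite /opp; case: (eqVneq (l E) f) => [<-|//].
by rewrite eq_sym sides_neq.
Qed.

Lemma opp_bd E f : E \in edges e -> E \in bd (opp E f).
Proof. by move=> Ee; rewrite bdP // /opp; case: ifP; rewrite eqxx ?orbT. Qed.

Lemma bd_cut (w : F -> bool) E f g : f != g -> E \in bd f -> E \in bd g ->
  w (l E) (+) w (r E) = w f (+) w g.
Proof.
move=> fg Ef Eg; have Ee := subsetP (bd_sub f) _ Ef.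
move: Ef Eg; rewrite !bdP //.
case/orP => /eqP fE; case/orP => /eqP gE.
- by rewrite -fE -gE eqxx in fg.
- by rewrite fE gE.
- by rewrite fE gE addbC.
- by rewrite -fE -gE eqxx in fg.
Qed.

(** Two faces that share two edges at [y] would see them with the same value in
    every cut, but a cycle can use one of them together with a third edge. *)
Lemma no_shared_pair f g y x t : f != g -> x != t ->
  edge y x \in bd f -> edge y t \in bd f -> edge y x \in bd g -> edge y t \in bd g ->
  False.
Proof.
move=> fg xt xf tf xg tg.
have yx : e y x by rewrite -(mem_edges sym_e) (subsetP (bd_sub f)).
have yt : e y t by rewrite -(mem_edges sym_e) (subsetP (bd_sub f)).
have [|s ys] := @pick_nbr _ e [:: x; t] y; first exact: deg3 (eU yx).
rewrite !inE negb_or => /andP [sx st]; have xs : x != s by rewrite eq_sym.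
have [z [sz ez hz]] := star_cycle xs yx ys.
have [w hw] := cut sz ez.
have := hw (edge y x); have := hw (edge y t); rewrite !(mem_edges sym_e) yx yt !hz //.
rewrite eqxx (bd_cut w fg xf xg) (bd_cut w fg tf tg).
by rewrite eq_sym (negPf xt) eq_sym (negPf st) => /(_ isT) <- /(_ isT).
Qed.

Definition faces : {set F} := [set f | bd f != set0].

Lemma bd_ge3 f : f \in faces -> 2 < #|bd f|.
Proof. by rewrite inE; apply: even_card_ge3 => //; [exact: bd_sub | exact: bd_even]. Qed.

(** Prescribing parities at all vertices but one shows that there are at least
    2 ^ (|E| - |U| + 1) even sets; each is a cut of the dual, that is a set of
    faces up to complementation, which leaves 2 ^ (|F| - 1) possibilities. *)
Lemma euler_bound u : u \in U -> edges e != set0 -> #|edges e| + 2 <= #|U| + #|faces|.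
Proof.
move=> uU /set0Pn [E0 E0e].
pose Ker := [set z in powerset (edges e) | [forall v, odd_at z v == false]].
have KerP z : z \in Ker <-> z \subset edges e /\ even_set z.
  rewrite in_set powersetE; split=> [/andP [sz /forallP ez]|[sz ez]].
    by split=> // v; apply/eqP.
  by rewrite sz; apply/forallP => v; rewrite ez.
have f0F : l E0 \in faces.
  by rewrite inE; apply/set0Pn; exists E0; rewrite bdP // eqxx.
have kerF : #|Ker| <= 2 ^ #|faces|.-1.
  have -> : #|faces|.-1 = #|faces :\ l E0| by have := cardsD1 (l E0) faces; rewrite f0F /=; lia.
  rewrite -card_powerset.
  pose cutset (W : {set F}) := [set E in edges e | (l E \in W) (+) (r E \in W)].
  apply: leq_trans (leq_imset_card cutset _); apply: subset_leq_card.
  apply/subsetP => z /KerP [sz ez]; have [w hw] := cut sz ez.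
  have inF E : E \in edges e -> l E \in faces /\ r E \in faces.
    by move=> Ee; split; rewrite inE; apply/set0Pn; exists E; rewrite bdP // eqxx ?orbT.
  apply/imsetP; exists [set f in faces | w f (+) w (l E0)].
    rewrite powersetE; apply/subsetP => f; rewrite in_set in_setD1 => /andP [-> fw].
    by rewrite andbT; apply: contraTneq fw => ->; rewrite addbb.
  apply/setP => E; rewrite in_set; case Ee: (E \in edges e) => /=; last first.
    by apply/negbTE; apply: contraFN Ee; apply: (subsetP sz).
  have [lE rE] := inF _ Ee; rewrite hw // [l E \in _]in_set [r E \in _]in_set lE rE /=.
  by case: (w (l E)); case: (w (r E)); case: (w (l E0)).
have powE : 2 ^ #|edges e| <= #|Ker| * 2 ^ #|U|.-1.
  have -> : #|U|.-1 = #|U :\ u| by have := cardsD1 u U; rewrite uU /=; lia.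
  rewrite -!card_powerset.
  pose bnd z := [set v in U :\ u | odd_at z v].
  have bndP z : bnd z \subset U :\ u by apply/subsetP => v; rewrite in_set => /andP [].
  have fib (W : {set V}) : #|[set z in powerset (edges e) | bnd z == W]| <= #|Ker|.
    have [->|[z0]] := set_0Vmem [set z in powerset (edges e) | bnd z == W].
      by rewrite cards0.
    rewrite in_set powersetE => /andP [sz0 /eqP bz0].
    have inj : injective (symdiff z0).
      move=> z z' /setP H; apply/setP => E; have := H E; rewrite !in_symdiff.
      by case: (E \in z0); case: (E \in z); case: (E \in z').
    rewrite -(card_imset _ inj); apply: subset_leq_card; apply/subsetP => _ /imsetP [z + ->].
    rewrite in_set powersetE => /andP [sz /eqP bz]; apply/KerP.
    have sd : symdiff z0 z \subset edges e.
      apply/subsetP => E; rewrite in_symdiff.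
      by case Ez0: (E \in z0) => Ez; [exact: (subsetP sz0) | exact: (subsetP sz)].
    split=> //; apply: (@handshake_odd _ _ u) => [E /(subsetP sd)|v vu].
      exact: card_edge.
    rewrite odd_at_symdiff; have [vU|vU] := boolP (v \in U).
      have mem (z1 : {set {set V}}) : (v \in bnd z1) = odd_at z1 v by rewrite /bnd in_set in_setD1 vu vU.
      by rewrite -!mem bz0 bz addbb.
    have iso (z1 : {set {set V}}) : z1 \subset edges e -> odd_at z1 v = false.
      move=> s1; rewrite /odd_at (_ : [set _ in _ | _] = set0) ?cards0 //.
      apply/setP => E; rewrite in_set in_set0; apply/negP => /andP [/(subsetP s1) Ee vE].
      have [x vx _] := edges_at sym_e Ee vE.
      by case/negP: vU; apply: eU vx.
    by rewrite !iso.
  rewrite -[X in X <= _]sum1_card (partition_big bnd (fun W => W \in powerset (U :\ u))) /=; last first.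
    by move=> z _; rewrite powersetE.
  rewrite mulnC -sum_nat_const; apply: leq_sum => W _.
  rewrite sum1_card; apply: leq_trans (fib W); apply: eq_leq.
  by apply: eq_card => z; rewrite [RHS]in_set.
have : 2 ^ #|edges e| <= 2 ^ (#|faces|.-1 + #|U|.-1).
  by rewrite expnD; apply: leq_trans powE _; rewrite leq_mul2r kerF orbT.
rewrite leq_exp2l //.
have : 0 < #|U| by apply/card_gt0P; exists u.
have : 0 < #|faces| by apply/card_gt0P; exists (l E0).
lia.
Qed.

Hypothesis no4 : ~ exists c, chordal_cycle e 4 c.
Hypothesis no6 : ~ exists c, chordal_cycle e 6 c.

Ltac split_uniq H :=
  move: H; rewrite /= !inE ?negb_or -?andbA; repeat (case/andP => ?); move=> _.
Ltac distinct :=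
  rewrite /= ?inE ?negb_or -?andbA; repeat (apply/andP; split);
  first [assumption | rewrite eq_sym; assumption | done].

Lemma bd_adj f x y : edge x y \in bd f -> e x y.
Proof. by move/(subsetP (bd_sub f)); rewrite (mem_edges sym_e). Qed.

Lemma triangle_shape f x y : edge x y \in bd f -> #|bd f| = 3 ->
  exists z, [/\ uniq [:: x; y; z], edge y z \in bd f & edge z x \in bd f].
Proof.
move=> xy n3; have [|p [sp u st _]] := even_shape sym_e irr_e (bd_sub f) (bd_even f) xy.
  by rewrite n3.
have {sp} : size p = 1 by move: sp; rewrite n3; clear; lia.
case: p u st => [|z [|? ?]] //= u st _.
by exists z; split=> //; apply: st; rewrite !inE eqxx ?orbT.
Qed.

Lemma square_shape f x y : edge x y \in bd f -> #|bd f| = 4 ->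
  exists z w, [/\ uniq [:: x; y; z; w],
    edge y z \in bd f, edge z w \in bd f & edge w x \in bd f /\
    {subset bd f <= [:: edge x y; edge y z; edge z w; edge w x]}].
Proof.
move=> xy n4; have [|p [sp u st ts]] := even_shape sym_e irr_e (bd_sub f) (bd_even f) xy.
  by rewrite n4.
have {sp} : size p = 2 by move: sp; rewrite n4; clear; lia.
case: p u st ts => [|z [|w [|? ?]]] //= u st ts _.
by exists z, w; do 2?split=> //; apply: st; rewrite !inE eqxx ?orbT.
Qed.

Lemma pentagon_shape f x y : edge x y \in bd f -> #|bd f| = 5 ->
  exists z w v, [/\ uniq [:: x; y; z; w; v], edge y z \in bd f,
    edge z w \in bd f, edge w v \in bd f & edge v x \in bd f].
Proof.
move=> xy n5; have [|p [sp u st _]] := even_shape sym_e irr_e (bd_sub f) (bd_even f) xy.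
  by rewrite n5.
have {sp} : size p = 3 by move: sp; rewrite n5; clear; lia.
case: p u st => [|z [|w [|v [|? ?]]]] //= u st _.
by exists z, w, v; split=> //; apply: st; rewrite !inE eqxx ?orbT.
Qed.

Lemma no_chord4 a b c d : uniq [:: a; b; c; d] ->
  e a b -> e b c -> e c d -> e d a -> e a c -> False.
Proof. by move=> *; apply: no4; exists [:: a; b; c; d]; apply: chordal4. Qed.

Lemma no_chord6 a b c d f g y : uniq [:: a; b; c; d; f; g] ->
  e a b -> e b c -> e c d -> e d f -> e f g -> e g a ->
  e a y -> y \in [:: c; d] -> False.
Proof.
by move=> *; apply: no6; exists [:: a; b; c; d; f; g]; apply: (@chordal6 _ _ _ _ _ _ _ _ y).
Qed.

Lemma adj_sym x y : e x y -> e y x. Proof. by rewrite sym_e. Qed.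

(** If the third vertices differ, the two triangles form a chordal 4-cycle.
    The next two lemmas go the same way: the union of two faces along an edge
    is a chordal 6-cycle, and when the faces touch elsewhere one finds a chordal
    4-cycle or a shared pair of edges. *)
Lemma triangle_triangle f g x y : f != g -> edge x y \in bd f -> edge x y \in bd g ->
  #|bd f| = 3 -> #|bd g| = 3 -> False.
Proof.
move=> fg xf xg nf ng.
have [z [uf yzf zxf]] := triangle_shape xf nf.
have [a [ug yag axg]] := triangle_shape xg ng.
split_uniq uf; split_uniq ug.
have [za|za] := eqVneq z a.
  subst a; apply: (@no_shared_pair f g y x z) => //; by rewrite edgeC.
apply: (@no_chord4 x z y a); rewrite ?[e _ x]sym_e.
- by distinct.
- by apply: adj_sym; apply: bd_adj zxf.
- by apply: adj_sym; apply: bd_adj yzf.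
- exact: bd_adj yag.
- by rewrite sym_e; apply: bd_adj axg.
- exact: bd_adj xf.
Qed.

Lemma triangle_pentagon f g x y : f != g -> edge x y \in bd f -> edge x y \in bd g ->
  #|bd f| = 3 -> #|bd g| = 5 -> False.
Proof.
move=> fg xf xg nf ng.
have [a [uf yaf axf]] := triangle_shape xf nf.
have [z [w [v [ug yzg zwg wvg vxg]]]] := pentagon_shape xg ng.
split_uniq uf; split_uniq ug.
have xy := bd_adj xf; have ya := bd_adj yaf; have ax := bd_adj axf.
have yz := bd_adj yzg; have zw := bd_adj zwg; have wv := bd_adj wvg; have vx := bd_adj vxg.
have [az|az] := eqVneq a z.
  subst a; apply: (@no_shared_pair f g y x z) => //; by rewrite edgeC.
have [av|av] := eqVneq a v.
  by subst a; apply: (@no_shared_pair f g x y v) => //; rewrite edgeC.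
have [aw|aw] := eqVneq a w.
  by subst a; apply: (@no_chord4 y z w x) => //; distinct.
apply: (@no_chord6 x a y z w v y) => //; rewrite ?inE ?eqxx //; try exact: adj_sym.
by distinct.
Qed.

Lemma square_square f g x y : f != g -> edge x y \in bd f -> edge x y \in bd g ->
  #|bd f| = 4 -> #|bd g| = 4 -> False.
Proof.
move=> fg xf xg nf ng.
have [z [w [uf yzf zwf [wxf _]]]] := square_shape xf nf.
have [u [v [ug yug uvg [vxg _]]]] := square_shape xg ng.
split_uniq uf; split_uniq ug.
have xy := bd_adj xf; have yz := bd_adj yzf; have zw := bd_adj zwf; have wx := bd_adj wxf.
have yu := bd_adj yug; have uv := bd_adj uvg; have vx := bd_adj vxg.
have [zu|zu] := eqVneq z u.
  subst u; apply: (@no_shared_pair f g y x z) => //; by rewrite edgeC.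
have [wv|wv] := eqVneq w v.
  by subst v; apply: (@no_shared_pair f g x y w) => //; rewrite edgeC.
have [zv|zv] := eqVneq z v.
  by subst v; apply: (@no_chord4 x y z w) => //; [distinct | exact: adj_sym].
have [wu|wu] := eqVneq w u.
  by subst u; apply: (@no_chord4 y z w x) => //; distinct.
apply: (@no_chord6 x w z y u v y) => //; rewrite ?inE ?eqxx ?orbT //; try exact: adj_sym.
by distinct.
Qed.

(** A quadrilateral with triangles on two of its sides is a hexagon with
    chords, or has a chordal 4-cycle if the triangles have the same apex. *)
Lemma square_two_triangles f g g' x y E : edge x y \in bd f -> E \in bd f ->
  E != edge x y -> edge x y \in bd g -> E \in bd g' ->
  #|bd f| = 4 -> #|bd g| = 3 -> #|bd g'| = 3 -> False.
Proof.
move=> xf Ef Exy xg Eg' nf ng ng'.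
have [z [w [uf yzf zwf [wxf ts]]]] := square_shape xf nf.
have [a [ug yag axg]] := triangle_shape xg ng.
split_uniq uf; split_uniq ug.
have xy := bd_adj xf; have yz := bd_adj yzf; have zw := bd_adj zwf; have wx := bd_adj wxf.
have ya := bd_adj yag; have ax := bd_adj axg.
have nxz : ~ e x z by move=> xz; apply: (@no_chord4 x y z w) => //; distinct.
have nyw : ~ e y w by move=> yw; apply: (@no_chord4 y z w x) => //; distinct.
have az : a != z by apply/eqP => az; subst a; apply: nxz; exact: adj_sym.
have aw : a != w by apply/eqP => aw; subst a; apply: nyw.
have := ts E Ef; rewrite inE (negPf Exy) /= !inE => /or3P [] /eqP defE; subst E.
- have [b [ub zbg byg]] := triangle_shape Eg' ng'; split_uniq ub.
  have zb := bd_adj zbg; have by_ := bd_adj byg.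
  have bx : b != x by apply/eqP => bE; subst b; apply: nxz; exact: adj_sym.
  have bw : b != w by apply/eqP => bE; subst b; apply: nyw; exact: adj_sym.
  have [ab|ab] := eqVneq a b.
    by subst b; apply: (@no_chord4 y z a x) => //; distinct.
  apply: (@no_chord6 x a y b z w y) => //; rewrite ?inE ?eqxx ?orbT //; try exact: adj_sym.
  by distinct.
- have [b [ub wbg bzg]] := triangle_shape Eg' ng'; split_uniq ub.
  have wb := bd_adj wbg; have bz := bd_adj bzg.
  have bx : b != x by apply/eqP => bE; subst b; apply: nxz.
  have by_ : b != y by apply/eqP => bE; subst b; apply: nyw; exact: adj_sym.
  have [ab|ab] := eqVneq a b.
    by subst b; apply: (@no_chord4 y z a x) => //; [distinct | exact: adj_sym].
  apply: (@no_chord6 x a y z b w y) => //; rewrite ?inE ?eqxx ?orbT //; try exact: adj_sym.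
  by distinct.
- have [b [ub xbg bwg]] := triangle_shape Eg' ng'; split_uniq ub.
  have xb := bd_adj xbg; have bw := bd_adj bwg.
  have by_ : b != y by apply/eqP => bE; subst b; apply: nyw.
  have bz : b != z by apply/eqP => bE; subst b; apply: nxz.
  have [ab|ab] := eqVneq a b.
    by subst b; apply: (@no_chord4 x y a w) => //; distinct.
  apply: (@no_chord6 x a y z w b y) => //; rewrite ?inE ?eqxx ?orbT //; try exact: adj_sym.
  by distinct.
Qed.

(** What [f] gets from [g] through each common edge: a triangle 3, and a
    quadrilateral 1 if [g] has at least five sides. *)
Definition flow (f g : F) : nat :=
  3 * (#|bd f| == 3) + ((#|bd f| == 4) && (4 < #|bd g|)).

(** Faces start with 9 times their length and end with at least 36, that is
    with 9 times 4.  A triangle gets 3 through each side.  A quadrilateral next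
    to one triangle pays 3 and gets 1 through each of the other three sides.  A
    pentagon has no adjacent triangle and pays at most 5, and longer faces can
    pay 3 through every side. *)
Lemma face_charge f : f \in faces ->
  36 + \sum_(E in bd f) flow (opp E f) f <= 9 * #|bd f| + \sum_(E in bd f) flow f (opp E f).
Proof.
move=> fF; have n3 := bd_ge3 fF.
have side E : E \in bd f -> [/\ f != opp E f, E \in bd (opp E f) &
    exists x y, E = edge x y].
  move=> Ef; have Ee := subsetP (bd_sub f) _ Ef; split.
  - by rewrite eq_sym opp_neq.
  - exact: opp_bd.
  - by have [x [y [_ ->]]] := edgesP _ _ Ee; exists x, y.
have out_le c : {in bd f, forall E, flow (opp E f) f <= c} ->
    \sum_(E in bd f) flow (opp E f) f <= #|bd f| * c.
  by move=> H; rewrite -sum_nat_const; apply: leq_sum.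
have le3 E : flow (opp E f) f <= 3.
  by rewrite /flow; case: (_ =P 3) => [->|_] //=; case: (_ && _).
have [n6|n5] := ltnP 5 #|bd f|.
  have := out_le 3 (fun E _ => le3 E); lia.
have [n|n] := eqVneq #|bd f| 5.
  have : \sum_(E in bd f) flow (opp E f) f <= #|bd f| * 1.
    apply: out_le => E Ef; have [fg Eg [x [y defE]]] := side E Ef; subst E.
    rewrite /flow; case: (_ =P 3) => [n3'|_]; last by case: (_ && _).
    rewrite eq_sym in fg.
    by case: (triangle_pentagon fg Eg Ef n3' n).
  lia.
have [m|m] := eqVneq #|bd f| 3.
  have : \sum_(E in bd f) flow (opp E f) f <= #|bd f| * 0.
    apply: out_le => E Ef; have [fg Eg [x [y defE]]] := side E Ef; subst E.
    rewrite /flow m andbF; case: (_ =P 3) => [n3'|//].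
    by case: (triangle_triangle fg Ef Eg m n3').
  have : \sum_(E in bd f) flow f (opp E f) = #|bd f| * 3.
    rewrite -sum_nat_const; apply: eq_bigr => E Ef.
    by rewrite /flow m.
  lia.
have n4 : #|bd f| = 4 by lia.
have flowE E : E \in bd f -> flow (opp E f) f = 3 * (#|bd (opp E f)| == 3).
  move=> Ef; rewrite /flow n4 andbF addn0; by [].
have flowI E : E \in bd f -> flow f (opp E f) = (#|bd (opp E f)| != 3).
  move=> Ef; have [fg Eg [x [y defE]]] := side E Ef; subst E.
  rewrite /flow n4 /=; congr nat_of_bool.
  have gF : opp (edge x y) f \in faces by rewrite inE; apply/set0Pn; exists (edge x y).
  have := bd_ge3 gF.
  have : #|bd (opp (edge x y) f)| != 4.
    by apply/eqP => n4'; apply: (square_square fg Ef Eg n4 n4').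
  by case: #|bd _| => [|[|[|[|[|?]]]]].
rewrite (eq_bigr _ flowE) [X in _ <= _ + X](eq_bigr _ flowI) n4.
have [/exists_inP [E Ef tE]|] := boolP [exists E in bd f, #|bd (opp E f)| == 3]; last first.
  rewrite negb_exists_in => /forall_inP H.
  by rewrite big1 // => E /H /negPf ->.
have only E' : E' \in bd f -> E' != E -> #|bd (opp E' f)| != 3.
  move=> E'f E'E; have [fg Eg [x [y defE]]] := side E Ef; subst E.
  have [fg' Eg' _] := side E' E'f; apply/eqP => t'.
  exact: (square_two_triangles Ef E'f E'E Eg Eg' n4 (eqP tE) t').
rewrite (bigD1 E Ef) [X in _ <= _ + X](bigD1 E Ef) /= tE /=.
rewrite big1 => [|E' /andP [E'f E'E]]; last by rewrite (negPf (only E' E'f E'E)).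
rewrite (eq_bigr (fun=> 1)) => [|E' /andP [E'f E'E]]; last by rewrite only.
rewrite sum1_card; have := cardsD1 E (bd f); rewrite Ef n4 /= => c.
have -> : #|[pred i in bd f | i != E]| = #|bd f :\ E|.
  by apply: eq_card => E'; rewrite in_setD1 andbC.
by move: c; rewrite add1n => -[<-].
Qed.

(** Each edge lies on the boundary of exactly two faces. *)
Lemma sum_bd (phi : F -> F -> nat) :
  \sum_(f in faces) \sum_(E in bd f) phi f (opp E f) =
  \sum_(E in edges e) (phi (l E) (r E) + phi (r E) (l E)).
Proof.
rewrite (exchange_big_dep [in edges e]) /=; last by move=> f E _ /(subsetP (bd_sub f)).
apply: eq_bigr => E Ee.
have lr := sides_neq Ee.
have lF : l E \in faces by rewrite inE; apply/set0Pn; exists E; rewrite bdP // eqxx.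
have rF : r E \in faces by rewrite inE; apply/set0Pn; exists E; rewrite bdP // eqxx orbT.
rewrite (bigD1 (l E)) /=; last by rewrite lF bdP // eqxx.
rewrite (bigD1 (r E)) /=; last by rewrite rF bdP // eqxx orbT eq_sym lr.
rewrite big1 ?addn0 => [|f /andP [/andP [/andP [_ +] fl] fr]].
  by rewrite /opp eqxx (negPf lr).
by rewrite bdP // ![_ == f]eq_sym (negPf fl) (negPf fr).
Qed.

(** Faces have average length at least 4, so |E| >= 2 |F|; insert this into
    Euler's inequality. *)
Lemma core_density : U != set0 -> #|edges e| + 4 <= 2 * #|U|.
Proof.
case/set0Pn => u uU.
have [E0|E0] := eqVneq (edges e) set0.
  have [|y uy _] := @pick_nbr _ e [::] u; first exact: ltn_trans (deg3 uU).
  have : edge u y \in edges e by rewrite (mem_edges sym_e).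
  by rewrite E0 inE.
have B := euler_bound uU E0.
have H : \sum_(f in faces) (36 + \sum_(E in bd f) flow (opp E f) f) <=
   \sum_(f in faces) (9 * #|bd f| + \sum_(E in bd f) flow f (opp E f)).
  by apply: leq_sum => f; apply: face_charge.
move: H; rewrite [X in X <= _]big_split [X in _ <= X]big_split /=.
rewrite (sum_bd (fun f g => flow g f)) (sum_bd flow) sum_nat_const.
have -> : \sum_(f in faces) 9 * #|bd f| = 9 * (2 * #|edges e|).
  rewrite -big_distrr /=; congr (_ * _); have := sum_bd (fun _ _ => 1).
  rewrite sum_nat_const mulnC => <-; apply: eq_bigr => f _; by rewrite sum1_card.
have -> : \sum_(E in edges e) (flow (r E) (l E) + flow (l E) (r E)) =
   \sum_(E in edges e) (flow (l E) (r E) + flow (r E) (l E)).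
  by apply: eq_bigr => E _; rewrite addnC.
have arith (a b c : nat) : a + 2 <= c + b -> b * 36 <= 9 * (2 * a) -> a + 4 <= 2 * c by lia.
by rewrite leq_add2r; apply: arith.
Qed.

End Faces.

(** * Sparsity of all induced subgraphs *)

Section Density.
Variables (V : finType) (e : rel V).
Hypothesis sym_e : symmetric e.
Hypothesis irr_e : irreflexive e.

Lemma chordal_sub (e' : rel V) n c : subrel e' e -> chordal_cycle e' n c ->
  chordal_cycle e n c.
Proof.
move=> sub [c3 cn cyc [x [y [xc yc h]]]]; split=> //.
  by case/andP: cyc => cyc u; rewrite /ucycle u (sub_cycle sub).
exists x, y; split=> //; move: h; rewrite !in_setD => /andP [-> /edgesP [a [b [ab E]]]] /=.
by apply/edgesP; exists a, b; split=> //; apply: sub.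
Qed.

Lemma degree_sum : \sum_x #|nbr e x| = 2 * #|edges e|.
Proof.
rewrite -(handshake (@card_edge _ _ irr_e)); apply: eq_bigr => v _.
have inj : {in nbr e v &, injective (edge v)}.
  move=> x y; rewrite !inE => vx vy /eqP; rewrite edge_eq eqxx /=.
  by rewrite [v == y](negPf (adj_neq irr_e vy)) /= orbF => /eqP.
rewrite -(card_in_imset inj); apply: eq_card => E; rewrite in_set.
apply/imsetP/andP => [[x + ->]|[Ee vE]].
  by rewrite inE => vx; rewrite (mem_edges sym_e) vx in_edge eqxx.
by have [x vx ->] := edges_at sym_e Ee vE; exists x; rewrite ?inE.
Qed.

End Density.

Section Sparse.
Variables (V : finType) (e : rel V).
Hypothesis sym_e : symmetric e.
Hypothesis irr_e : irreflexive e.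
Hypothesis no4 : ~ exists c, chordal_cycle e 4 c.
Hypothesis no6 : ~ exists c, chordal_cycle e 6 c.
Hypothesis duals : forall e' : rel V, subrel e' e -> symmetric e' -> dual e'.

Local Notation D U := (\sum_(x in U) #|nbr e x :&: U|).

Lemma density_remove (U : {set V}) y : y \in U ->
  D U <= D (U :\ y) + 2 * #|nbr e y :&: U|.
Proof.
move=> yU; rewrite (big_setD1 y yU) /= mul2n -addnn addnA addnC leq_add2r.
have : \sum_(x in U :\ y) #|nbr e x :&: U| <=
    \sum_(x in U :\ y) (#|nbr e x :&: (U :\ y)| + e x y).
  apply: leq_sum => x xU; rewrite [X in X <= _](cardsD1 y) addnC !inE yU andbT leq_add2r.
  by apply: subset_leq_card; apply/subsetP => z; rewrite !inE => /and3P [-> -> ->].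
move/leq_trans; apply; rewrite big_split /= leq_add2l -big_mkcondr /= sum1_card.
apply: subset_leq_card; apply/subsetP => x; rewrite unfold_in !inE /=.
by rewrite -!andbA sym_e => /and3P [_ -> ->].
Qed.

(** No edge leaves [C] except towards [y], so every edge lies in one of the two
    parts, which meet only in [y]. *)
Lemma density_separate (U C : {set V}) y : y \in U -> C \subset U :\ y ->
  {in C & U :\: C, forall a b, e a b -> b = y} ->
  D U <= D (y |: C) + D (U :\: C).
Proof.
move=> yU sC sep; have yC : y \notin C by apply/negP => /(subsetP sC); rewrite !inE eqxx.
have sCU : C \subset U by apply: subset_trans sC (subD1set _ _).
rewrite (big_setID C) /= (setIidPr sCU) big_setU1 //= addnAC.
have yUC : y \in U :\: C by rewrite inE yC.
have le1 : \sum_(a in C) #|nbr e a :&: U| <= \sum_(a in C) #|nbr e a :&: (y |: C)|.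
  apply: leq_sum => a aC; apply: subset_leq_card; apply/subsetP => b.
  rewrite in_setI => /andP [ab bU]; rewrite in_setI in_setU1 ab /=.
  have [bC|bC] := boolP (b \in C); first by rewrite orbT.
  by rewrite inE in ab; rewrite (sep a b aC) ?eqxx // inE bC.
rewrite [X in X <= _]addnC; apply: leq_add => //; rewrite !(big_setD1 y yUC) /= addnA.
apply: leq_add.
  rewrite -(cardsID C (nbr e y :&: U)); apply: leq_add; apply: subset_leq_card.
    by apply/subsetP => b; rewrite !inE => /andP [/andP [-> _] ->]; rewrite orbT.
  by apply/subsetP => b; rewrite !inE => /and3P [-> -> ->].
apply: leq_sum => a; rewrite !inE => /and3P [ay aC aU].
apply: subset_leq_card; apply/subsetP => b; rewrite !inE => /andP [ab bU].
rewrite ab bU andbT /=; apply/negP => bC.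
by case/eqP: ay; apply: (sep b a bC); rewrite ?inE ?aC // sym_e.
Qed.

(** At a cut vertex the bounds 2a - 3 and 2b - 3 with a + b = n + 1 add up to
    2n - 4.  In the remaining case the induced subgraph, seen as a relation on
    all of [V], satisfies the assumptions of [core_density]. *)
Theorem dual_sparse : sparse e.
Proof.
move=> U; have [n] := ubnP #|U|; elim: n U => // n IH U leU U1.
have [/exists_inP [y yU dy]|] := boolP [exists y in U, #|nbr e y :&: U| <= 2].
  have := density_remove yU; have cU := cardsD1 y U; rewrite yU /= in cU.
  have [U2|U2] := ltnP 1 #|U :\ y|.
    by have := IH (U :\ y) _ U2; move: cU leU dy; clear; lia.
  have -> : D (U :\ y) = 0.
    have /cards1P [x defx] : #|U :\ y| == 1 by apply/eqP; move: cU U1 U2; clear; lia.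
    rewrite defx big_set1; apply/eqP; rewrite cards_eq0; apply/eqP/setP => z.
    by rewrite !inE; case: eqP => [->|]; rewrite ?irr_e ?andbF.
  have : #|nbr e y :&: U| <= #|U :\ y|.
    apply: subset_leq_card; apply/subsetP => z; rewrite !inE => /andP [yz ->].
    by rewrite andbT; apply: contraTneq yz => ->; rewrite irr_e.
  by move: cU U1 U2; clear; lia.
rewrite negb_exists_in => /forall_inP deg3.
pose eU := [rel a b | [&& e a b, a \in U & b \in U]].
have symU : symmetric eU by move=> a b /=; rewrite sym_e [(a \in U) && _]andbC.
have irrU : irreflexive eU by move=> a /=; rewrite irr_e.
have subU : subrel eU e by move=> a b /= /and3P [].
have nbrU x : x \in U -> nbr eU x = nbr e x :&: U.
  by move=> xU; apply/setP => z; rewrite !inE /= xU.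
pose ey y := [rel a b | [&& eU a b, a != y & b != y]].
have [[y [x [t [yx yt nc]]]]|conn] := boolp.pselect
  (exists y x t, [/\ eU y x, eU y t & ~~ connect (ey y) x t]).
  have [_ yU xU] := and3P yx; have [_ _ tU] := and3P yt.
  pose C := [set v | connect (ey y) x v].
  have xC : x \in C by rewrite inE connect0.
  have tC : t \notin C by rewrite inE.
  have sC : C \subset U :\ y.
    apply/subsetP => v; rewrite inE => /connectP [p]; case/lastP: p => [|p z].
      move=> _ -> /=; rewrite !inE xU andbT eq_sym.
      exact: (adj_neq irrU yx).
    rewrite rcons_path last_rcons => /andP [_ /and3P [/and3P [_ _ zU] _ zy]] ->.
    by rewrite !inE zy zU.
  have yC : y \notin C by apply/negP => /(subsetP sC); rewrite !inE eqxx.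
  have sep : {in C & U :\: C, forall a b, e a b -> b = y}.
    move=> a b aC; rewrite inE => /andP [bC bU] ab; apply/eqP; apply: contraNT bC => nby.
    have := subsetP sC a aC; rewrite !inE => /andP [ay aU]; rewrite inE in aC.
    by apply: connect_trans aC (connect1 _); rewrite /= ab aU bU ay nby.
  have le := density_separate yU sC sep.
  have cC : #|y |: C| = #|C|.+1 by rewrite cardsU1 yC.
  have cU : #|U :\: C| + #|C| = #|U|.
    rewrite -(cardsID C U) addnC; congr (_ + _); apply: eq_card => v.
    rewrite in_setI andbC; case: (boolP (v \in C)) => //= vC.
    by have := subsetP sC v vC; rewrite in_setD1 => /andP [_ ->].
  have C0 : 0 < #|C| by apply/card_gt0P; exists x.
  have UC : 1 < #|U :\: C|.
    apply/card_gt1P; exists y, t; split.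
    - by rewrite in_setD yC.
    - by rewrite in_setD tC.
    - exact: (adj_neq irrU yt).
  have i1 := IH (y |: C); have i2 := IH (U :\: C).
  rewrite cC in i1; move: i1 i2 le cU C0 UC leU; clear.
  set d := D U; set d1 := D _; set d2 := D _.
  by lia.
have conn' y x t : eU y x -> eU y t -> connect (ey y) x t.
  by move=> yx yt; apply: contraT => nc; case: conn; exists y, x, t.
have [F [l [r [cut bd_even]]]] := duals subU symU.
have eUU x y : eU x y -> x \in U by case/and3P.
have deg3' x : x \in U -> 2 < #|nbr eU x|.
  by move=> xU; rewrite nbrU // ltnNge; apply: deg3.
have no4' : ~ exists c, chordal_cycle eU 4 c.
  by case=> c /(chordal_sub subU) hc; apply: no4; exists c.
have no6' : ~ exists c, chordal_cycle eU 6 c.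
  by case=> c /(chordal_sub subU) hc; apply: no6; exists c.
have U0 : U != set0 by rewrite -card_gt0; exact: ltnW.
have dens := core_density symU irrU eUU deg3' conn' cut bd_even no4' no6' U0.
have -> : D U = 2 * #|edges eU|.
  rewrite -(degree_sum symU irrU) [RHS](bigID [in U]) /=.
  rewrite [X in _ = _ + X]big1 ?addn0; last first.
    move=> x xU; apply/eqP; rewrite cards_eq0; apply/eqP/setP => z.
    by rewrite !inE /= (negPf xU) andbF.
  by apply: eq_bigr => x xU; rewrite nbrU.
by move: dens; clear; lia.
Qed.
End Sparse.

(** * Duality in the grid *)

Local Notation "\xor_ ( i | P ) F" := (\big[addb/false]_(i | P) F)
  (at level 41, F at level 41, i, P at level 50).
Local Notation "\xor_ ( i 'in' A ) F" := (\big[addb/false]_(i in A) F)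
  (at level 41, F at level 41, i, A at level 50).
Local Notation "\xor_ i F" := (\big[addb/false]_i F)
  (at level 41, i at level 0, F at level 41).

Lemma odd_card_xor (T : finType) (A : {pred T}) : odd #|A| = \xor_(x in A) true.
Proof. by rewrite -sum1_card (big_morph odd oddD (erefl : odd 0 = false)). Qed.

Lemma xor_pred1 (T : finType) (x : T) (f : T -> bool) : \xor_i (f i && (i == x)) = f x.
Proof.
rewrite (bigD1 x) //= eqxx andbT big1 ?addbF // => i ix.
by rewrite (negPf ix) andbF.
Qed.

Lemma odd_at_xor (V : finType) (B : {set {set V}}) v :
  odd_at B v = \xor_(E in B) (v \in E).
Proof.
rewrite /odd_at odd_card_xor big_mkcond [RHS]big_mkcond; apply: eq_bigr => E _.
by rewrite in_set; case: (E \in B); case: (v \in E).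
Qed.

(** The grid is indexed as a torus so that successors are total; what is drawn
    on it stays off row and column 0, hence off the edges that wrap around.
    [(false, q)] is the horizontal edge from [q] to the right and [(true, q)]
    the vertical one upwards.  A cell is named by its lower left corner, so the
    edge [(b, q)] borders the cell [q] and the one below or to the left. *)
Section Grid.
Variable n : nat.
Local Notation Z := 'I_n.+1.
Definition node : Type := (Z * Z)%type.
Definition gedge : Type := (bool * (Z * Z))%type.
Definition tail (g : gedge) : Z * Z := g.2.
Definition tip (g : gedge) : Z * Z :=
  if g.1 then (g.2.1, ordS g.2.2) else (ordS g.2.1, g.2.2).
Definition cell_l (g : gedge) : Z * Z := g.2.
Definition cell_r (g : gedge) : Z * Z :=
  if g.1 then (ord_pred g.2.1, g.2.2) else (g.2.1, ord_pred g.2.2).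

(** The boundary mod 2 of a set of grid edges. *)
Definition flux (phi : gedge -> bool) (p : Z * Z) : bool :=
  \xor_g (phi g && ((p == tail g) (+) (p == tip g))).

Lemma flux_xor phi psi p :
  flux (fun g => phi g (+) psi g) p = flux phi p (+) flux psi p.
Proof. by rewrite /flux -big_split; apply: eq_bigr => g _; rewrite andb_addl. Qed.

Lemma flux_sum (I : finType) (A : {pred I}) (phi : I -> gedge -> bool) p :
  flux (fun g => \xor_(i in A) phi i g) p = \xor_(i in A) flux (phi i) p.
Proof.
rewrite /flux exchange_big /=; apply: eq_bigr => g _.
by rewrite big_distrl.
Qed.

Lemma flux1 g0 p : flux (fun g => g == g0) p = (p == tail g0) (+) (p == tip g0).
Proof. by rewrite /flux -[RHS](xor_pred1 g0 (fun g => (p == tail g) (+) (p == tip g))); apply: eq_bigr => g _; rewrite andbC. Qed.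

Lemma flux_set (A : pred (Z * Z)) phi :
  \xor_(p | A p) flux phi p = \xor_g (phi g && (A (tail g) (+) A (tip g))).
Proof.
rewrite /flux exchange_big /=; apply: eq_bigr => g _; rewrite big_mkcond /=.
transitivity (\xor_p (phi g && ((A p && (p == tail g)) (+) (A p && (p == tip g))))).
  by apply: eq_bigr => p _; case: (A p); rewrite ?andbF.
case: (phi g) => /=; last by rewrite big1.
by rewrite big_split /= !xor_pred1.
Qed.

Lemma fluxE phi i j : flux phi (i, j) =
  (phi (false, (i, j)) (+) phi (false, (ord_pred i, j))) (+)
  (phi (true, (i, j)) (+) phi (true, (i, ord_pred j))).
Proof.
have split_dir (f : gedge -> bool) :
    \xor_g f g = (\xor_q f (false, q)) (+) (\xor_q f (true, q)).
  by rewrite addbC -(big_bool _ (fun b => \xor_q f (b, q))) pair_bigA; apply: eq_bigr => -[].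
have pickq (f : Z * Z -> bool) (P : pred (Z * Z)) q0 : (forall q, P q = (q == q0)) ->
    \xor_q (f q && P q) = f q0.
  by move=> PE; rewrite -[RHS](xor_pred1 q0); apply: eq_bigr => q _; rewrite PE.
have predE (a b : Z) : (a == ordS b) = (b == ord_pred a).
  by apply/eqP/eqP => [->|->]; rewrite ?ordSK ?ord_predK.
rewrite /flux split_dir; congr (_ (+) _).
  under eq_bigr do rewrite andb_addr.
  rewrite big_split /=; congr (_ (+) _); apply: pickq => -[a b].
    by rewrite eq_sym.
  by rewrite /tip /= !xpair_eqE predE [j == b]eq_sym.
under eq_bigr do rewrite andb_addr.
rewrite big_split /=; congr (_ (+) _); apply: pickq => -[a b].
  by rewrite eq_sym.
by rewrite /tip /= !xpair_eqE predE [i == a]eq_sym.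
Qed.

(** Each of the four cells around [p] is bounded by two of the edges at [p]. *)
Lemma flux_cells (c : pred (Z * Z)) p :
  flux (fun g => c (cell_l g) (+) c (cell_r g)) p = false.
Proof.
case: p => i j; rewrite fluxE /cell_l /cell_r /=.
by case: (c (i, j)); case: (c (i, _)); case: (c (_, j)); case: (c _).
Qed.

(** A closed edge set that avoids row and column 0 is the boundary of a set of
    cells: a cell belongs to it according to the parity of the horizontal edges
    of the set below it in its column. *)
Lemma potential (phi : gedge -> bool) :
  (forall g, phi g -> [&& (tail g).1 != ord0, (tail g).2 != ord0,
                          (tip g).1 != ord0 & (tip g).2 != ord0]) ->
  (forall p, flux phi p = false) ->
  exists w : pred (Z * Z), forall g, phi g = w (cell_l g) (+) w (cell_r g).
Proof.
move=> inner closed.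
pose col i m := \big[addb/false]_(t < m) phi (false, (i, inord t)).
have colS i m : col i m.+1 = col i m (+) phi (false, (i, inord m)).
  by rewrite /col big_ord_recr.
have outer0 b i j : (i == ord0) || (j == ord0) -> phi (b, (i, j)) = false.
  by move=> ij; apply: contraTF ij => /inner /and4P [i0 j0 _ _]; rewrite negb_or i0.
have lift0 (i : Z) : i != ord0 -> (ord_pred i : nat) = i.-1 /\ 0 < i.
  move=> i0; have ip : 0 < i by rewrite lt0n.
  by split=> //; rewrite /= -subn1 -addnBAC // subn1 modnDr modn_small //; have := ltn_ord i; lia.
have pred0 : (@ord_pred n.+1 ord0 : nat) = n by rewrite /= modn_small.
(* the vertical edges are determined by the horizontal ones below them *)
have colV (i : Z) m : m <= n ->
    col i m.+1 (+) col (ord_pred i) m.+1 = phi (true, (i, inord m)).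
  elim: m => [|m IH] mn.
    rewrite /col !big_ord1 [inord 0](_ : _ = ord0); last by apply: val_inj; rewrite /= inordK.
    by rewrite !outer0 ?eqxx ?orbT.
  have := closed (i, inord m.+1); rewrite fluxE.
  have -> : ord_pred (inord m.+1) = inord m :> Z.
    have [] := lift0 (inord m.+1); first by rewrite -val_eqE /= inordK.
    by rewrite inordK // => h _; apply: ord_inj; rewrite h inordK //; lia.
  rewrite (colS i) (colS (ord_pred i)); have := IH (ltnW mn).
  move: (phi (false, (i, _))) (phi (false, (ord_pred i, _))) => a b.
  move: (phi (true, (i, inord m.+1))) (phi (true, (i, inord m))) => c d.
  move: (col i _) (col (ord_pred i) _) => x y.
  by case: x; case: y; case: a; case: b; case: c; case: d.
have topF i : phi (true, (i, inord n)) = false.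
  apply/negP => /inner /and4P [_ _ _]; rewrite /tip /= => /eqP []; apply: val_inj.
  by rewrite /= inordK // modnn.
have colT i : col i n.+1 = false.
  have step i1 : col i1 n.+1 = col (ord_pred i1) n.+1.
    by have := colV i1 n (leqnn n); rewrite topF; case: (col _ _); case: (col _ _).
  have col0 : col ord0 n.+1 = false.
    by rewrite /col big1 // => t _; rewrite outer0 ?eqxx.
  have [m] := ubnP (i : nat); elim: m i => // m IH i im.
  have [->|i0] := eqVneq i ord0; first exact: col0.
  have [h ip] := lift0 i i0; rewrite step; apply: IH; rewrite h; lia.
have colH (i j : Z) : phi (false, (i, j)) = col i j.+1 (+) col i (ord_pred j).+1.
  have [->|j0] := eqVneq j ord0.
    rewrite outer0 ?eqxx ?orbT // pred0 colT /col big_ord1.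
    rewrite [inord 0](_ : _ = ord0); last by apply: ord_inj; rewrite inordK.
    by rewrite outer0 ?eqxx ?orbT.
  have [h jp] := lift0 j j0; rewrite h prednK // colS inord_val.
  by case: (col i j); case: (phi _).
exists (fun q : Z * Z => col q.1 q.2.+1); case=> [[] [i j]]; last exact: colH.
by have := colV i j (leq_ord j); rewrite inord_val => <-.
Qed.

End Grid.

(** * Minors of the grid *)

Section Minor.
Variables (V : finType) (e : rel V) (n : nat).
Hypothesis sym_e : symmetric e.
Hypothesis irr_e : irreflexive e.
Local Notation P := ('I_n.+1 * 'I_n.+1)%type.
Local Notation tail := (@tail n).
Local Notation tip := (@tip n).
(* [lab p] is the vertex of the graph that the node [p] is contracted to, and
   [mark E] is the grid edge that represents [E]. *)
Variable lab : P -> option V.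
Variable mark : {set V} -> gedge n.

Definition node_adj (p q : P) : bool :=
  [exists g, ((tail g == p) && (tip g == q)) || ((tail g == q) && (tip g == p))].

Hypothesis inner : forall i j, lab (i, j) != None -> (i != ord0) && (j != ord0).
Hypothesis blobs : forall v p q, lab p = Some v -> lab q = Some v ->
  connect [rel a b | [&& node_adj a b, lab a == Some v & lab b == Some v]] p q.
Hypothesis marks : forall E, E \in edges e -> exists x y,
  [/\ E = edge x y, x != y, lab (tail (mark E)) = Some x & lab (tip (mark E)) = Some y].

Definition contracted (g : gedge n) : bool :=
  (lab (tail g) != None) && (lab (tail g) == lab (tip g)).
Definition deleted (g : gedge n) : bool :=
  ~~ contracted g && (g \notin mark @: edges e).

Lemma mark_end E v : E \in edges e ->
  (v \in E) = (lab (tail (mark E)) == Some v) (+) (lab (tip (mark E)) == Some v).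
Proof.
move=> Ee; have [x [y [-> xy -> ->]]] := marks Ee.
have someE a : (Some a == Some v) = (v == a) by rewrite eq_sym (inj_eq Some_inj).
rewrite in_edge !someE.
by case: (eqVneq v x) => [->|_] //=; rewrite (negPf xy).
Qed.

Lemma mark_inj : {in edges e &, injective mark}.
Proof.
move=> E E' Ee Ee' m; apply/setP => v.
by rewrite !mark_end // m.
Qed.

Lemma mark_not_contracted E : E \in edges e -> contracted (mark E) = false.
Proof.
move=> Ee; have [x [y [_ xy lx ly]]] := marks Ee.
by rewrite /contracted lx ly /= (inj_eq Some_inj) (negPf xy).
Qed.

Lemma blob_join p q : lab p != None -> lab p = lab q ->
  exists J : {ffun gedge n -> bool}, (forall g, J g -> contracted g) /\
    forall p', flux J p' = (p' == p) (+) (p' == q).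
Proof.
move=> lp0 lq; have [v lp] : exists v, lab p = Some v.
  by case: (lab p) lp0 => // v _; exists v.
rewrite lp in lq; have := blobs lp (esym lq).
case/connectP => s; elim: s p lp {lq lp0} => [|p1 s IH] p lp /=.
  move=> _ ->; exists [ffun=> false]; split=> [g|p']; first by rewrite ffunE.
  by rewrite addbb /flux big1 // => g _; rewrite ffunE.
case/andP=> /and3P [/existsP [g0 g0E] _ /eqP lp1] ps def_q.
have [J [Jc Jf]] := IH p1 lp1 ps def_q.
exists [ffun g => (g == g0) (+) J g]; split.
  move=> g; rewrite ffunE; case: eqP => [->|_] /= => [_|]; last exact: Jc.
  rewrite /contracted.
  by case/orP: g0E => /andP [/eqP -> /eqP ->]; rewrite lp lp1 eqxx.
move=> p'; have -> : flux [ffun g => (g == g0) (+) J g] p' =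
    flux (fun g => (g == g0) (+) J g) p'.
  by apply: eq_bigr => g _; rewrite ffunE.
rewrite flux_xor flux1 Jf.
by case/orP: g0E => /andP [/eqP -> /eqP ->]; do 3![case: (p' == _)].
Qed.

(** The marks of an even set have even flux in each class of nodes with the same
    label.  Joining the odd nodes of a class to a representative along
    contracted edges gives a closed edge set of the grid that contains no deleted
    edge, and [potential] applies. *)
Lemma minor_cut (z : {set {set V}}) : z \subset edges e -> even_set z ->
  exists w : pred P, (forall g, deleted g -> w (cell_l g) = w (cell_r g)) /\
    {in edges e, forall E, (E \in z) = w (cell_l (mark E)) (+) w (cell_r (mark E))}.
Proof.
move=> sz ez.
pose phi0 g := \xor_(E in z) (g == mark E).
have phi0_mark E : E \in edges e -> phi0 (mark E) = (E \in z).
  move=> Ee; rewrite /phi0 -[RHS](xor_pred1 E (fun E' => E' \in z)) big_mkcond; apply: eq_bigr => E' _.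
  case zE': (E' \in z) => //=; apply/eqP/eqP => [m|-> //].
  by apply/esym; apply: mark_inj => //; apply: (subsetP sz).
have phi0_sup g : phi0 g -> g \in mark @: edges e.
  apply: contraTT => ng; rewrite /phi0 big1 // => E zE; apply/negbTE.
  by apply: contra ng => /eqP ->; apply: imset_f; apply: (subsetP sz).
have labelled g : contracted g || (g \in mark @: edges e) ->
    (lab (tail g) != None) && (lab (tip g) != None).
  case/orP=> [/andP [l0 /eqP <-]|/imsetP [E Ee ->]]; first by rewrite l0.
  by have [x [y [_ _ -> ->]]] := marks Ee.
pose o p := flux phi0 p.
have o_lab p : o p -> lab p != None.
  apply: contraTneq => lp; rewrite /o /flux big1 // => g _.
  case pg: (phi0 g) => //=; have /andP [lt lh] := labelled g (introT orP (or_intror (phi0_sup g pg))).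
  have [pt|_] := eqVneq p (tail g); first by rewrite -pt lp in lt.
  by have [pt|_] := eqVneq p (tip g); first by rewrite -pt lp in lh.
have o_even v : \xor_(p | lab p == Some v) o p = false.
  rewrite flux_set -[RHS](ez v) odd_at_xor.
  transitivity (\xor_(E in z) \xor_g ((g == mark E) &&
      ((lab (tail g) == Some v) (+) (lab (tip g) == Some v)))).
    by rewrite [RHS]exchange_big /=; apply: eq_bigr => g _; rewrite /phi0 big_distrl.
  apply: eq_bigr => E zE; rewrite (mark_end _ (subsetP sz _ zE)).
  rewrite -[RHS](xor_pred1 (mark E) (fun g => (lab (tail g) == Some v) (+) (lab (tip g) == Some v))).
  by apply: eq_bigr => g _; rewrite andbC.
pose rep (x : option V) : P := odflt (ord0, ord0) [pick q | lab q == x].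
have lab_rep p : lab (rep (lab p)) = lab p.
  by rewrite /rep; case: pickP => [q /eqP //|/(_ p)]; rewrite eqxx.
have joins p : exists J : {ffun gedge n -> bool}, (forall g, J g -> contracted g) /\
    (lab p != None -> forall p', flux J p' = (p' == p) (+) (p' == rep (lab p))).
  have [lp|lp] := eqVneq (lab p) None.
    by exists [ffun=> false]; split=> [g|//]; rewrite ffunE.
  have [J [Jc Jf]] := blob_join lp (esym (lab_rep p)).
  by exists J; split=> // _.
have [Jf JfP] := fin_all_exists joins.
pose phi g := phi0 g (+) \xor_(p in o) Jf p g.
have Jsum_sup g : \xor_(p in o) Jf p g -> contracted g.
  apply: contraTT => ng; rewrite big1 // => p _; apply/negbTE; apply: contra ng.
  by case: (JfP p) => H _; apply: H.
have phi_sup g : phi g -> contracted g || (g \in mark @: edges e).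
  rewrite /phi; case p0: (phi0 g) => /=; first by rewrite (phi0_sup g p0) orbT.
  by move/Jsum_sup => ->.
have closed p' : flux phi p' = false.
  rewrite /phi flux_xor -/(o p') flux_sum.
  rewrite (eq_bigr (fun p => (p' == p) (+) (p' == rep (lab p)))); last first.
    by move=> p op; case: (JfP p) => _ H; apply: H; apply: o_lab.
  rewrite big_split /=.
  have -> : \xor_(p in o) (p' == p) = o p'.
    rewrite -[RHS](xor_pred1 p') big_mkcond; apply: eq_bigr => p _.
    by rewrite eq_sym -[p \in o]/(o p); case: (o p).
  rewrite addbA addbb addFb.
  case pr: (p' == rep (lab p')); last first.
    rewrite big1 // => p _; apply: contraFF pr => /eqP ->.
    by rewrite lab_rep.
  case lp': (lab p') => [v|].
    rewrite -[RHS](o_even v) big_mkcond [RHS]big_mkcond; apply: eq_bigr => p _.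
    rewrite -[p \in o]/(o p); case op: (o p); last by case: ifP.
    have [lp|lp] := eqVneq (lab p) (Some v).
      by rewrite lp -lp' pr.
    apply: contraNF lp => /eqP p'E; by rewrite -(lab_rep p) -p'E lp'.
  rewrite big1 // => p op; apply/negbTE; apply: contra (o_lab p op) => /eqP p'E.
  by rewrite -(lab_rep p) -p'E lp'.
have [|w hw] := potential _ closed.
  move=> g /phi_sup /labelled /andP [].
  rewrite {1}[tail g]surjective_pairing {1}[tip g]surjective_pairing.
  by move=> /inner /andP [-> ->] /inner /andP [-> ->].
exists w; split=> [g|E Ee].
  case/andP=> nc nm; have : phi g = false.
    by apply/negbTE; apply/negP => /phi_sup; rewrite (negPf nc) (negPf nm).
  by rewrite hw; case: (w _); case: (w _).
rewrite -hw /phi phi0_mark //; case J: (\xor_(p in o) Jf p (mark E)).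
  by have := Jsum_sup _ J; rewrite mark_not_contracted.
by rewrite addbF.
Qed.

(** The faces are the classes of cells connected across deleted edges.  Seen
    from a vertex, the boundary of a face is the flux of a boundary of cells out
    of its class of nodes, since contracted edges do not leave the class and
    deleted ones do not separate faces. *)
Theorem minor_dual : dual e.
Proof.
pose adj := [rel f g : P | [exists h, deleted h &&
  (((cell_l h == f) && (cell_r h == g)) || ((cell_l h == g) && (cell_r h == f)))]].
have adj_sym : symmetric adj.
  by move=> f g /=; apply: eq_existsb => h; rewrite orbC.
have cadj : connect_sym adj := sym_connect_sym adj_sym.
pose cls := fingraph.root adj.
have cls_del g : deleted g -> cls (cell_l g) = cls (cell_r g).
  move=> dg; apply/eqP; rewrite /cls (root_connect cadj); apply: connect1.
  by apply/existsP; exists g; rewrite dg !eqxx.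
exists ('I_n.+1 * 'I_n.+1)%type, (fun E => cls (cell_l (mark E))),
  (fun E => cls (cell_r (mark E))); split=> [z sz ez|f v].
  have [w [wdel wz]] := minor_cut sz ez.
  have cw : closed adj w.
    move=> a b /existsP [h /andP [dh]]; have := wdel h dh; rewrite !unfold_in => wh.
    by case/orP => /andP [/eqP <- /eqP <-].
  have wcls q : w (cls q) = w q.
    exact: (esym (closed_connect cw (connect_root adj q))).
  by exists w => E Ee; rewrite !wcls wz.
pose c q := cls q == f.
pose chi g := c (cell_l g) (+) c (cell_r g).
pose A p := lab p == Some v.
have := flux_set A chi; rewrite big1; last by move=> p _; apply: flux_cells.
move=> H; rewrite odd_at_xor [RHS]H.
rewrite [RHS](bigID [in mark @: edges e]) /= [X in _ = _ (+) X]big1 ?addbF; last first.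
  move=> g ng; case cg: (contracted g).
    by case/andP: cg => _ /eqP lE; rewrite /A lE addbb andbF.
  by rewrite /chi /c cls_del ?addbb // /deleted cg.
rewrite (big_imset _ mark_inj) /= big_mkcond [RHS]big_mkcond; apply: eq_bigr => E _.
rewrite in_set; case Ee: (E \in edges e) => //=.
by rewrite (mark_end v Ee) /chi /c /A; case: (_ (+) _).
Qed.
End Minor.

(** * Blobs and tentacles *)

Lemma connect_exit (T : finType) (r : rel T) (G : pred T) x y :
  connect r x y -> G x -> ~~ G y -> exists a b, [/\ r a b, G a & ~~ G b].
Proof.
case/connectP => s; elim: s x => [|z s IH] x /=; first by move=> _ -> ->.
case/andP=> xz pz def_y Gx nGy; have [Gz|nGz] := boolP (G z); first exact: (IH z).
by exists x, z.
Qed.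

Section Blobs.
Variables (V : finType) (e : rel V) (n : nat).
Hypothesis sym_e : symmetric e.
Hypothesis irr_e : irreflexive e.
Local Notation P := ('I_n.+1 * 'I_n.+1)%type.
Variables (blob : V -> pred P) (near : {set V} -> pred P).

Definition steps (Q : pred P) : rel P := [rel a b | [&& node_adj a b, Q a & Q b]].

Hypothesis blob_inner : forall z i j, blob z (i, j) -> (i != ord0) && (j != ord0).
Hypothesis near_inner : forall E i j, E \in edges e -> near E (i, j) ->
  (i != ord0) && (j != ord0).
Hypothesis blob_connected : forall z a b, blob z a -> blob z b ->
  connect (steps (blob z)) a b.
Hypothesis blob_disjoint : forall z z' a, blob z a -> blob z' a -> z = z'.
Hypothesis near_blob : forall E z a, E \in edges e -> near E a -> blob z a -> z \in E.
Hypothesis near_near : forall E F a, E \in edges e -> F \in edges e -> E != F ->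
  near E a -> near F a -> exists z, blob z a.
Hypothesis chain : forall x y, e x y -> exists a b,
  [/\ blob x a, blob y b & connect (steps (near (edge x y))) a b].

(** To make the nodes disjointly owned, each edge [E] is oriented and the nodes
    near its arc go to its source, as far as they can be reached from the blob
    of the source without entering another blob.  The vertex then owns its blob
    and its tentacles, a connected set, and the tentacle of [E] touches the blob
    at the other end of [E]. *)
Definition source (E : {set V}) : option V := [pick u in E].
Definition in_blob a := [exists z, blob z a].
Definition tentacle E u a := (near E a && ~~ in_blob a) || blob u a.
Definition reached E a := [exists u, exists b,
  [&& source E == Some u, blob u b & connect (steps (tentacle E u)) b a]].
Definition owner a : option V :=
  if [pick z | blob z a] is Some z then Some z
  else if [pick E in edges e | near E a && reached E a] is Some E then source E
  else None.

Lemma node_adj_sym : symmetric (@node_adj n).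
Proof. by move=> a b; apply: eq_existsb => g; rewrite orbC. Qed.

Lemma steps_sym Q : symmetric (steps Q).
Proof.
by move=> a b; apply/and3P/and3P => -[adj Qa Qb]; split=> //; rewrite node_adj_sym.
Qed.

Lemma owner_blob z a : blob z a -> owner a = Some z.
Proof.
move=> za; rewrite /owner; case: pickP => [z' z'a|/(_ z)]; last by rewrite za.
by rewrite (blob_disjoint za z'a).
Qed.

Lemma owner_near E a : E \in edges e -> near E a -> reached E a -> ~~ in_blob a ->
  owner a = source E.
Proof.
move=> Ee nE rE nb; rewrite /owner; case: pickP => [z za|_].
  by case/existsP: nb; exists z.
case: pickP => [F /and3P [Fe nF _]|/(_ E)]; last by rewrite Ee nE rE.
have [-> //|EF] := eqVneq E F.
by have [z za] := near_near Ee Fe EF nE nF; case/existsP: nb; exists z.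
Qed.

Lemma sourceP E : E \in edges e -> exists u v,
  [/\ source E = Some u, e u v & E = edge u v].
Proof.
move=> Ee; have [x [y [xy defE]]] := edgesP _ _ Ee.
rewrite /source; case: pickP => [u uE|/(_ x)]; last by rewrite defE in_edge eqxx.
have [v uv ->] := edges_at sym_e Ee uE.
by exists u, v.
Qed.

Lemma owner_tentacle E u a : E \in edges e -> source E = Some u ->
  reached E a -> tentacle E u a -> owner a = Some u.
Proof.
move=> Ee sE rE /orP [/andP [nE nb]|ua]; last exact: owner_blob.
by rewrite (owner_near Ee nE rE nb).
Qed.

Lemma reached_step E u a b : source E = Some u -> reached E a ->
  steps (tentacle E u) a b -> reached E b.
Proof.
move=> sE /existsP [u' /existsP [c /and3P [/eqP sE' uc ca]]] ab.
move: sE'; rewrite sE => -[uu']; rewrite -uu' in uc ca.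
apply/existsP; exists u; apply/existsP; exists c; rewrite sE eqxx uc /=.
exact: connect_trans ca (connect1 ab).
Qed.

Lemma owned_from_blob a v : owner a = Some v -> exists2 b, blob v b &
  connect (steps (fun c => owner c == Some v)) b a.
Proof.
move=> oa; have := oa; rewrite {1}/owner; case: pickP => [z za [zv]|nb].
  by exists a; rewrite ?connect0 // -zv.
case: pickP => // E /and3P [Ee nE rE] sE.
have [u /existsP [c /and3P [/eqP sE' uc ca]]] := existsP rE.
move: sE'; rewrite sE => -[vu]; rewrite -vu in uc ca.
exists c => //; have rc : reached E c.
  by apply/existsP; exists v; apply/existsP; exists c; rewrite sE eqxx uc connect0.
have tc : tentacle E v c by rewrite /tentacle uc orbT.
case/connectP: ca => s; elim: s c {uc} rc tc => [|d s IH] c rc tc /=.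
  by move=> _ ->.
case/andP=> cd pd def_a; have rd := reached_step sE rc cd.
have td : tentacle E v d by case/and3P: cd.
apply: connect_trans (IH d rd td pd def_a); apply: connect1.
case/and3P: cd => adj _ _.
by rewrite /steps /= adj (owner_tentacle Ee sE rc tc) (owner_tentacle Ee sE rd td) eqxx.
Qed.

Lemma owner_connected v a b : owner a = Some v -> owner b = Some v ->
  connect (steps (fun c => owner c == Some v)) a b.
Proof.
move=> /owned_from_blob [a' va' aa'] /owned_from_blob [b' vb' bb'].
rewrite (sym_connect_sym (steps_sym _)) in aa'.
apply: connect_trans aa' (connect_trans _ bb').
have sub : subrel (steps (blob v)) (steps (fun c => owner c == Some v)).
  move=> c d /and3P [adj vc vd].
  by rewrite /steps /= adj (owner_blob vc) (owner_blob vd) eqxx.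
exact: (connect_sub (fun c d cd => connect1 (sub c d cd))) (blob_connected va' vb').
Qed.

(** Walk along [E] from the blob of the source and stop where its tentacle ends.
    The next node is in a blob other than that of the source, hence in the blob
    of the other end. *)
Lemma edge_crossing E : E \in edges e -> exists g : gedge n, exists x y,
  [/\ E = edge x y, x != y, owner (tail g) = Some x & owner (tip g) = Some y].
Proof.
move=> Ee; have [u [v [sE uv defE]]] := sourceP Ee.
have [a [b [ua vb ab]]] := chain uv; rewrite -defE in ab.
have neq := adj_neq irr_e uv.
pose G c := reached E c && tentacle E u c.
have Ga : G a.
  rewrite /G /tentacle ua orbT andbT.
  by apply/existsP; exists u; apply/existsP; exists a; rewrite sE eqxx ua connect0.
have nGb : ~~ G b.
  rewrite /G /tentacle !negb_and negb_or negbK; apply/orP; right.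
  rewrite negb_and negbK; apply/andP; split.
    by apply/orP; right; apply/existsP; exists v.
  by apply/negP => ub; case/eqP: neq; apply: blob_disjoint ub vb.
have [c [d [/and3P [adj _ nd] /andP [rc tc] nGd]]] := connect_exit ab Ga nGb.
have ntd : ~~ tentacle E u d.
  apply: contra nGd => td; rewrite /G td andbT.
  by apply: (reached_step sE rc); rewrite /steps /= adj tc td.
move: ntd; rewrite /tentacle negb_or nd /= negbK => /andP [/existsP [z zd] nud].
have := near_blob Ee nd zd; rewrite defE in_edge => /orP [/eqP zu|/eqP zv].
  by rewrite -zu zd in nud.
have oc := owner_tentacle Ee sE rc tc; have od := owner_blob zd; rewrite zv in od.
have [g /orP [] /andP [/eqP tg /eqP hg]] := existsP adj; exists g.
  by exists u, v; rewrite tg hg.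
by exists v, u; rewrite tg hg eq_sym; split=> //; rewrite edgeC.
Qed.

Theorem blobs_dual : dual e.
Proof.
have [mark markP] : exists mark : {set V} -> gedge n, forall E, E \in edges e ->
    exists x y, [/\ E = edge x y, x != y, owner (tail (mark E)) = Some x &
      owner (tip (mark E)) = Some y].
  have all E : exists g : gedge n, E \in edges e -> exists x y,
      [/\ E = edge x y, x != y, owner (tail g) = Some x & owner (tip g) = Some y].
    have [/edge_crossing [g hg]|nE] := boolP (E \in edges e); first by exists g.
    by exists (false, (ord0, ord0)).
  by have [mark markP] := fin_all_exists all; exists mark.
apply: (@minor_dual V e n owner mark) => //; last first.
  by move=> v p q; apply: owner_connected.
move=> i j; rewrite /owner; case: pickP => [z za _|_]; first exact: blob_inner za.
by case: pickP => // E /and3P [Ee nE _] _; apply: near_inner nE.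
Qed.

End Blobs.

(** * Paths in the grid *)

Definition between (a b t : nat) : bool := minn a b <= t <= maxn a b.

Lemma between_close (n : nat) (i j t : 'I_n) :
  i <= j + 1 -> j <= i + 1 -> between i j t -> t = i \/ t = j.
Proof.
move=> ij ji /andP [t1 t2]; have [ti|ti] := eqVneq (t : nat) i.
  by left; apply: ord_inj.
by right; apply: ord_inj; lia.
Qed.

Lemma between_or (a b t : nat) : between a b t -> (a <= t <= b) \/ (b <= t <= a).
Proof.
by rewrite /between; case: (leqP a b) => _ /andP [-> ->]; [left | right].
Qed.

Section Paths.
Variables (n : nat) (Q : pred ('I_n.+1 * 'I_n.+1)).
Local Notation Z := 'I_n.+1.

Lemma connect_row (i i' j : Z) : (forall t : Z, between i i' t -> Q (t, j)) ->
  connect (steps Q) (i, j) (i', j).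
Proof.
wlog le : i i' / i <= i'.
  move=> H; case: (leqP i i') => [|/ltnW] le; first exact: H.
  move=> HQ; rewrite (sym_connect_sym (steps_sym Q)); apply: H => // t bt.
  by apply: HQ; rewrite /between minnC maxnC.
rewrite /between (minn_idPl le) (maxn_idPr le).
move defm : (i' - i) => m; elim: m i' defm le => [|m IH] i' defm le HQ.
  by have -> : i' = i; [apply: ord_inj; lia | rewrite connect0].
have lt1 : i'.-1 < n.+1 by have := ltn_ord i'; lia.
pose t := Ordinal lt1.
have ti : ordS t = i' by apply: ord_inj; rewrite /= modn_small; have := ltn_ord i'; lia.
apply: (connect_trans (y := (t, j))).
  by apply: IH => /= [||u /andP [u1 u2]]; try lia; apply: HQ; lia.
apply: connect1; rewrite /steps /= !HQ /= ?andbT; try lia.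
by apply/existsP; exists (false, (t, j)); rewrite /tail /tip /= ti !eqxx.
Qed.

Lemma connect_col (i j j' : Z) : (forall t : Z, between j j' t -> Q (i, t)) ->
  connect (steps Q) (i, j) (i, j').
Proof.
wlog le : j j' / j <= j'.
  move=> H; case: (leqP j j') => [|/ltnW] le; first exact: H.
  move=> HQ; rewrite (sym_connect_sym (steps_sym Q)); apply: H => // t bt.
  by apply: HQ; rewrite /between minnC maxnC.
rewrite /between (minn_idPl le) (maxn_idPr le).
move defm : (j' - j) => m; elim: m j' defm le => [|m IH] j' defm le HQ.
  by have -> : j' = j; [apply: ord_inj; lia | rewrite connect0].
have lt1 : j'.-1 < n.+1 by have := ltn_ord j'; lia.
pose t := Ordinal lt1.
have tj : ordS t = j' by apply: ord_inj; rewrite /= modn_small; have := ltn_ord j'; lia.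
apply: (connect_trans (y := (i, t))).
  by apply: IH => /= [||u /andP [u1 u2]]; try lia; apply: HQ; lia.
apply: connect1; rewrite /steps /= !HQ /= ?andbT; try lia.
by apply/existsP; exists (true, (i, t)); rewrite /tail /tip /= tj !eqxx.
Qed.

Lemma connect_elbow (i i' j j' : Z) : (forall t : Z, between i i' t -> Q (t, j)) ->
  (forall t : Z, between j j' t -> Q (i', t)) -> connect (steps Q) (i, j) (i', j').
Proof.
by move=> Qi Qj; apply: connect_trans (connect_row Qi) (connect_col Qj).
Qed.
End Paths.

From mathcomp Require Import lra.
From mathcomp Require Import all_classical all_reals all_analysis.
Import Order.TTheory GRing.Theory Num.Theory.
Import numFieldNormedType.Exports.

(** * Compactness *)

Section Topology.
Local Open Scope classical_set_scope.
Local Open Scope ring_scope.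
Variable R : realType.
Implicit Types (a b : R * R) (A B O : set (R * R)).

Lemma ball_coord a (c : R) b : ball a c b <-> `|a.1 - b.1| < c /\ `|a.2 - b.2| < c.
Proof. by []. Qed.

(** Points of a compact set that are close to a closed set are close to the
    intersection.  With [O] empty this is the positive distance of disjoint
    sets. *)
Lemma separate A B O : compact A -> closed B -> open O -> A `&` B `<=` O ->
  exists2 d : R, 0 < d & forall a b, A a -> B b -> ball a d b -> O a.
Proof.
move=> cA cB oO AB.
have : \forall d \near 0^'+, A `<=` (fun a => forall b, B b -> ball a d b -> O a).
  apply: (compact_near_coveringP A).1 cA _ _ _ _ _ => x Ax.
  have [Ox|nOx] := pselect (O x).
    near=> x' d; have Ox' : O x' by near: x'; exact: open_nbhs_nbhs.
    by move=> b _ _.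
  have nBx : (~` B) x by move=> Bx; apply: nOx; apply: AB.
  have : nbhs x (~` B) by apply: open_nbhs_nbhs; split=> //; exact: closed_openC.
  move/nbhs_ballP => [eps /= eps0 xB].
  near=> x' d.
  have xx' : ball x (eps / 2) x' by near: x'; apply: nbhsx_ballx; rewrite divr_gt0.
  have de : d <= eps / 2 by near: d; apply: nbhs_right_le; rewrite divr_gt0.
  move=> b Bb x'b; exfalso; apply: (xB b _ Bb); rewrite [eps]splitr.
  exact: ball_triangle xx' (le_ball de x'b).
move=> H; have [d [d0 Hd]] : exists d, 0 < d /\ A `<=` (fun a => forall b, B b -> ball a d b -> O a).
  apply: (@filter_ex _ 0^'+); near=> d; split; first by near: d; exact: nbhs_right_gt.
  by near: d.
by exists d => // a b Aa; apply: Hd.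
Unshelve. all: by end_near. Qed.

Lemma common_eps (I : finType) (P : I -> R -> Prop) :
  (forall i d d', 0 < d' -> d' <= d -> P i d -> P i d') ->
  (forall i, exists2 d, 0 < d & P i d) -> exists2 d, 0 < d & forall i, P i d.
Proof.
move=> mono ex; suff [d d0 H] : exists2 d, 0 < d & forall i, i \in enum I -> P i d.
  by exists d => // i; apply: H; rewrite mem_enum.
elim: (enum I) => [|i s [d d0 H]]; first by exists 1.
have [d' d'0 Pi] := ex i; exists (Num.min d d'); first by rewrite lt_min d0.
have m0 : 0 < Num.min d d' by rewrite lt_min d0.
move=> j; rewrite inE => /predU1P [->|js].
  by apply: mono Pi => //; rewrite ge_min lexx orbT.
by apply: mono (H j js) => //; rewrite ge_min lexx.
Qed.

Lemma uniform_continuity (g : R -> R * R) (h : R) : 0 < h ->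
  {within `[0, 1], continuous g} ->
  exists2 d, 0 < d & forall s t, `[0, 1]%classic s -> `[0, 1]%classic t ->
    `|s - t| < d -> ball (g s) h (g t).
Proof.
move=> h0 /subspace_continuousP cg.
have c01 : compact (`[0, 1]%classic : set R) by exact: segment_compact.
have : \forall d \near 0^'+, `[0, 1]%classic `<=` (fun s : R => forall t, `[0, 1]%classic t ->
    `|s - t| < d -> ball (g s) h (g t)).
  apply: (near_covering_withinP _).2 ((compact_near_coveringP _).1 c01) _ _ _ _ _ => x x01.
  have /cg/cvg_ballP /(_ (h / 2)) := x01; rewrite divr_gt0 // => /(_ isT).
  rewrite near_withinE => /nbhs_ballP [eps /= eps0 xg].
  near=> x' d.
  have xx' : ball x (eps / 2) x' by near: x'; apply: nbhsx_ballx; rewrite divr_gt0.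
  have de : d <= eps / 2 by near: d; apply: nbhs_right_le; rewrite divr_gt0.
  have e2 : eps / 2 <= eps by rewrite ler_pdivrMr // ler_pMr // ler1n.
  move=> x'01 t t01 x't; rewrite [h]splitr; apply: (@ball_triangle _ _ (g x)).
    by apply: ball_sym; apply: xg => //; apply: le_ball xx'.
  apply: xg => //; rewrite [eps]splitr; apply: ball_triangle xx' _.
  exact: lt_le_trans x't de.
move=> H; have [d [d0 Hd]] : exists d, 0 < d /\ `[0, 1]%classic `<=` (fun s : R => forall t, `[0, 1]%classic t ->
    `|s - t| < d -> ball (g s) h (g t)).
  apply: (@filter_ex _ 0^'+); near=> d; split; first by near: d; exact: nbhs_right_gt.
  by near: d.
by exists d => // s t s01; apply: Hd.
Unshelve. all: by end_near. Qed.

Lemma arc_compact A a b : simple_arc A a b -> compact A.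
Proof.
case=> g [cg _ _ _ ->]; apply: continuous_compact => //; exact: segment_compact.
Qed.

(** The radius is written as an inverse so that the claim persists for smaller
    [d], as [common_eps] requires. *)
Lemma compact_ball A : compact A -> exists2 d : R, 0 < d & forall a, A a -> ball 0 d^-1 a.
Proof.
move=> /compact_bounded [M [_ HM]].
exists (`|M| + 2)^-1 => [|a Aa]; first by rewrite invr_gt0 ltr_wpDl.
rewrite invrK; have := HM (`|M| + 1) _ a Aa; rewrite -ball_normE /= sub0r normrN.
move=> H; apply: le_lt_trans (H _) _; last by rewrite ltrD2l ltr1n.
by rewrite ltr_pwDr // ler_norm.
Qed.

End Topology.

(** * Rounding to the grid *)

Section Rounding.
Local Open Scope classical_set_scope.
Local Open Scope ring_scope.
Variables (R : realType) (h x0 M : R) (n : nat).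
Hypothesis h0 : 0 < h.
Hypothesis lower : x0 <= - M.
Hypothesis upper : M - x0 <= n%:R * h.
Local Notation node := ('I_n.+1 * 'I_n.+1)%type.

Definition pos (q : node) : R * R := (x0 + q.1%:R * h, x0 + q.2%:R * h).
Definition round1 (x : R) : 'I_n.+1 := inord (Num.truncn ((x - x0) / h)).
Definition round2 (a : R * R) : node := (round1 a.1, round1 a.2).

Lemma round1P x : `|x| < M -> x0 + (round1 x)%:R * h <= x < x0 + (round1 x)%:R * h + h.
Proof.
rewrite ltr_norml => /andP [xM Mx].
have pos0 : 0 <= (x - x0) / h.
  by apply: divr_ge0; [rewrite subr_ge0; have := lower; lra | exact: ltW].
have /andP [t1 t2] := truncn_itv pos0.
have tn : (Num.truncn ((x - x0) / h) < n.+1)%N.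
  rewrite ltnS -(ler_nat R); apply: le_trans t1 _.
  by rewrite ler_pdivrMr //; have := upper; lra.
rewrite /round1 inordK //.
rewrite ler_pdivlMr // in t1; rewrite ltr_pdivrMr // in t2.
by apply/andP; split; rewrite -?addrA; [lra|rewrite -natr1 mulrDl mul1r in t2; lra].
Qed.

Lemma round2P a : ball 0 M a -> ball (pos (round2 a)) h a.
Proof.
move=> /ball_coord [/=]; rewrite !sub0r !normrN => a1 a2; apply/ball_coord => /=.
have /andP [l1 u1] := round1P a1; have /andP [l2 u2] := round1P a2.
by split; rewrite ltr_norml; apply/andP; split; lra.
Qed.

Lemma round1_close x y : `|x| < M -> `|y| < M -> `|x - y| < h ->
  (round1 x <= round1 y + 1)%N.
Proof.
move=> xM yM; have /andP [l1 u1] := round1P xM; have /andP [l2 u2] := round1P yM.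
rewrite ltr_norml => /andP [_ xy].
have : (round1 x)%:R * h < ((round1 y + 2)%N%:R) * h :> R.
  by rewrite natrD mulrDl; lra.
by rewrite ltr_pM2r // ltr_nat addn2 addn1 ltnS.
Qed.

(** Points at distance less than the mesh round to nodes that differ by at most
    one in each coordinate; they are joined through a corner, whose distance to
    [b] may exceed the mesh but not twice the mesh. *)
Lemma round2_steps (A : set (R * R)) (Q : pred node) a b :
  (forall q c, A c -> ball (pos q) (2 * h) c -> Q q) ->
  A a -> A b -> ball 0 M a -> ball 0 M b -> ball a h b ->
  connect (steps Q) (round2 a) (round2 b).
Proof.
move=> HQ Aa Ab aM bM ab.
have /ball_coord [/= pa1 pa2] := round2P aM; have /ball_coord [/= pb1 pb2] := round2P bM.
have /ball_coord [/= ab1 ab2] := ab.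
have := aM => /ball_coord [/=]; rewrite !sub0r !normrN => a1 a2.
have := bM => /ball_coord [/=]; rewrite !sub0r !normrN => b1 b2.
have hp := h0.
have ba1 : `|b.1 - a.1| < h by rewrite distrC.
have ba2 : `|b.2 - a.2| < h by rewrite distrC.
have c1 := round1_close a1 b1 ab1; have c1' := round1_close b1 a1 ba1.
have c2 := round1_close a2 b2 ab2; have c2' := round1_close b2 a2 ba2.
have corner : Q (round1 b.1, round1 a.2).
  apply: (HQ _ b Ab); apply/ball_coord => /=; split; first by apply: lt_trans pb1 _; lra.
  have -> : x0 + (round1 a.2)%:R * h - b.2 = (x0 + (round1 a.2)%:R * h - a.2) + (a.2 - b.2).
    by lra.
  by apply: le_lt_trans (ler_normD _ _) _; lra.
have Qa : Q (round2 a).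
  by apply: (HQ _ a Aa); apply: le_ball (round2P aM); lra.
have Qb : Q (round2 b).
  by apply: (HQ _ b Ab); apply: le_ball (round2P bM); lra.
apply: connect_elbow => t bt.
  by have [->|->] := between_close c1 c1' bt.
by have [->|->] := between_close c2 c2' bt.
Qed.

(** The nodes in a ball of the maximum norm form a box. *)
Lemma ball_box (c : R * R) (r : R) (Q : pred node) p q :
  (forall s, ball (pos s) r c -> Q s) ->
  ball (pos p) r c -> ball (pos q) r c -> connect (steps Q) p q.
Proof.
case: p => i j; case: q => i' j' HQ /ball_coord [/= p1 p2] /ball_coord [/= q1 q2].
have convex (k k' t : 'I_n.+1) (y : R) : between k k' t ->
    `|x0 + k%:R * h - y| < r -> `|x0 + k'%:R * h - y| < r -> `|x0 + t%:R * h - y| < r.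
  have mono (u v : 'I_n.+1) : (u <= v)%N -> u%:R * h <= v%:R * h :> R.
    by move=> uv; rewrite ler_pM2r // ler_nat.
  move=> bt; rewrite !ltr_norml => /andP [l1 u1] /andP [l2 u2].
  by case: (between_or bt) => /andP [/mono h1 /mono h2]; apply/andP; split; lra.
by apply: connect_elbow => t bt; apply: HQ; apply/ball_coord => /=; split => //; apply: convex bt _ _.
Qed.

End Rounding.

(** * From drawings to duals *)

Section Planar.
Local Open Scope classical_set_scope.
Local Open Scope ring_scope.
Variables (R : realType) (V : finType) (e : rel V).
Hypothesis sym_e : symmetric e.
Hypothesis irr_e : irreflexive e.

(** Rounding a sufficiently fine subdivision of the arc gives a path in the
    grid. *)
Lemma arc_chain (A : set (R * R)) (a b : R * R) (h x0 M : R) (n : nat)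
    (Q : pred ('I_n.+1 * 'I_n.+1)) :
  0 < h -> x0 <= - M -> M - x0 <= n%:R * h ->
  (forall c, A c -> ball 0 M c) ->
  (forall q c, A c -> ball (pos h x0 q) (2 * h) c -> Q q) ->
  simple_arc A a b -> connect (steps Q) (round2 h x0 n a) (round2 h x0 n b).
Proof.
move=> h0 lower upper AM HQ [g [cg _ g0 g1 defA]].
have [d d0 unif] := uniform_continuity h0 cg.
pose N := Num.truncn d^-1.
have di0 : 0 < d^-1 by rewrite invr_gt0.
have Nd : N.+1%:R^-1 < d.
  have /andP [_ Nd] := truncn_itv (ltW di0).
  by rewrite -[ltRHS]invrK ltf_pV2 ?posrE ?ltr0n.
pose t (i : nat) : R := i%:R / N.+1%:R.
have t01 i : (i <= N.+1)%N -> `[0, 1]%classic (t i).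
  move=> iN; rewrite /= in_itv /= /t divr_ge0 //= ler_pdivrMr ?ltr0n // mul1r ler_nat.
  by [].
have Ag i : (i <= N.+1)%N -> A (g (t i)) by move=> iN; rewrite defA; exists (t i) => //; exact: t01.
have stepN i : (i <= N.+1)%N -> connect (steps Q) (round2 h x0 n a) (round2 h x0 n (g (t i))).
  elim: i => [|i IH] iN; first by rewrite /t mul0r g0 connect0.
  apply: connect_trans (IH (ltnW iN)) _.
  apply: (@round2_steps R h x0 M n h0 lower upper A) => //; try exact: Ag; try exact: (ltnW iN).
  - by apply: Ag; exact: ltnW.
  - by apply: AM; apply: Ag; exact: ltnW.
  - by apply: AM; apply: Ag.
  apply: unif; [exact: t01 (ltnW iN) | exact: t01 | ].
  have -> : t i - t i.+1 = - N.+1%:R^-1.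
    by rewrite /t -mulrBl -[i.+1%:R]natr1 opprD addrA subrr sub0r mulN1r.
  by rewrite normrN gtr0_norm ?invr_gt0 ?ltr0n.
have := stepN N.+1 (leqnn _); rewrite /t divff ?g1 ?pnatr_eq0 //.
Qed.

(** The blob of a vertex consists of the nodes within [r] of it, and a node is
    near an arc if it is within twice the mesh [h].  The radius is chosen from
    the distances between vertices and between vertices and arcs, and then the
    mesh from the distance of two arcs away from their common ends. *)
Lemma planar_dual : planar R e -> dual e.
Proof.
move=> [p [A [pinj arcs ends disj]]].
have arcP E : E \in edges e -> exists x y, [/\ e x y, E = edge x y & simple_arc (A E) (p x) (p y)].
  by move=> /edgesP [x [y [xy ->]]]; exists x, y; split=> //; apply: arcs.
have cptA E : E \in edges e -> compact (A E).
  by move=> /arcP [x [y [_ _ /arc_compact]]].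
have clA E : E \in edges e -> closed (A E).
  by move=> /cptA; apply: compact_closed; apply: norm_hausdorff.
have cl1 z : closed [set p z].
  by apply: compact_closed; [apply: norm_hausdorff | exact: compact_set1].
have [d1 d10 H1] : exists2 d : R, 0 < d & forall zz : V * V, zz.1 != zz.2 ->
    ~ ball (p zz.1) d (p zz.2).
  apply: common_eps => [zz d d' _ le H ne b|[z z'] /=].
    exact: (H ne (le_ball le b)).
  have [->|ne] := eqVneq z z'; first by exists 1 => //; rewrite eqxx.
  have [|d d0 H] := separate (@compact_set1 _ (p z)) (cl1 z') open0.
    by move=> a [-> /= /pinj zz']; rewrite zz' eqxx in ne.
  by exists d => // _ b; apply: (H (p z) (p z')).
have [d2 d20 H2] : exists2 d : R, 0 < d & forall Ez : {set V} * V,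
    Ez.1 \in edges e -> Ez.2 \notin Ez.1 -> forall a, A Ez.1 a -> ~ ball (p Ez.2) d a.
  apply: common_eps => [Ez d d' _ le H Ee zE a Aa b|[E z] /=].
    exact: (H Ee zE a Aa (le_ball le b)).
  have [Ee|nE] := boolP (E \in edges e); last by exists 1 => // Ee; rewrite Ee in nE.
  have [zE|nz] := boolP (z \in E); first by exists 1 => //; rewrite zE.
  have [|d d0 H] := separate (@compact_set1 _ (p z)) (clA E Ee) open0.
    by move=> a [-> /(ends E z Ee)]; rewrite (negPf nz).
  by exists d => // _ _ a Aa b; apply: (H (p z) a).
(* Balls of radius [r] around two vertices, or around a vertex and a node near
   an arc that avoids it, are disjoint: r + r and r + 2 h are at most 4 r. *)
pose r := Num.min d1 d2 / 4.
have r0 : 0 < r by rewrite /r divr_gt0 // lt_min d10.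
have r1 : 4 * r <= d1 by rewrite /r mulrC divfK ?pnatr_eq0 // ge_min lexx.
have r2 : 4 * r <= d2 by rewrite /r mulrC divfK ?pnatr_eq0 // ge_min lexx orbT.
have [d3 d30 H3] : exists2 d : R, 0 < d & forall EF : {set V} * {set V},
    EF.1 \in edges e -> EF.2 \in edges e -> EF.1 != EF.2 ->
    forall a b, A EF.1 a -> A EF.2 b -> ball a d b -> exists z, ball (p z) (r / 2) a.
  apply: common_eps => [EF d d' _ le H Ee Fe EF12 a b Aa Ab ab|[E F] /=].
    exact: (H Ee Fe EF12 a b Aa Ab (le_ball le ab)).
  have [Ee|nE] := boolP (E \in edges e); last by exists 1 => // Ee; rewrite Ee in nE.
  have [Fe|nF] := boolP (F \in edges e); last by exists 1 => // _ Fe; rewrite Fe in nF.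
  have [->|EF] := eqVneq E F; first by exists 1 => // _ _; rewrite eqxx.
  pose O := \bigcup_z interior (ball (p z) (r / 2)).
  have oO : open O by apply: bigcup_open => z _; exact: open_interior.
  have [|d d0 H] := separate (cptA E Ee) (clA F Fe) oO.
    move=> a /(disj E F Ee Fe EF) [z _ <-]; exists z => //.
    by apply: nbhsx_ballx; rewrite divr_gt0.
  exists d => // _ _ _ a b Aa Ab /(H a b Aa Ab) [z _ /interior_subset za].
  by exists z.
(* A node within 2 h of two arcs brings them within 4 h <= d3 of each other, and
   is then within 2 h + r / 2 <= r of a vertex. *)
pose h := Num.min (d3 / 4) (r / 4).
have h0 : 0 < h.
  by rewrite /h lt_min; apply/andP; split; apply: divr_gt0.
have h3 : 4 * h <= d3.
  by rewrite mulrC -ler_pdivlMr // /h ge_min lexx.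
have hr : 4 * h <= r.
  by rewrite mulrC -ler_pdivlMr // /h ge_min lexx orbT.
have [d4 d40 H4] : exists2 d : R, 0 < d & forall Ez : {set V} * V,
    (Ez.1 \in edges e -> forall a, A Ez.1 a -> ball 0 d^-1 a) /\ ball 0 d^-1 (p Ez.2).
  apply: common_eps => [Ez d d' d'0 le [HA Hz]|[E z] /=].
    have le' : d^-1 <= d'^-1 by rewrite lef_pV2 ?posrE // (lt_le_trans d'0 le).
    split; last by apply: (le_ball le').
    by move=> Ee a Aa; apply: (le_ball le'); apply: HA.
  have [dz dz0 Hz] := compact_ball (@compact_set1 _ (p z)).
  have [Ee|nE] := boolP (E \in edges e); last first.
    by exists dz => //; split; [by [] | exact: Hz].
  have [dE dE0 HE] := compact_ball (cptA E Ee).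
  have m0 : 0 < Num.min dE dz by rewrite lt_min dE0.
  exists (Num.min dE dz) => //; split=> [_ a Aa|].
    by apply: le_ball (HE a Aa); rewrite lef_pV2 ?posrE // ge_min lexx.
  by apply: le_ball (Hz _ _) => //; rewrite lef_pV2 ?posrE // ge_min lexx orbT.
pose M := d4^-1; have M0 : 0 < M by rewrite invr_gt0.
have AM E a : E \in edges e -> A E a -> ball 0 M a.
  by move=> Ee Aa; have /edgesP [x _] := Ee; have [H _] := H4 (E, x); apply: H.
have pM z : ball 0 M (p z) by have [_] := H4 (finset.set0, z).
(* The margin r + 3 h around the drawing keeps blobs and near nodes off row and
   column 0. *)
pose x0 := - (M + r + 3 * h); have lower : x0 <= - M by rewrite /x0; lra.
pose n := (Num.truncn ((M - x0) / h)).+1.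
have upper : M - x0 <= n%:R * h.
  have q0 : 0 <= (M - x0) / h by apply: divr_ge0; [rewrite /x0; lra | exact: ltW].
  have /andP [_ /ltW] := truncn_itv q0.
  by rewrite ler_pdivrMr.
pose blob z (q : 'I_n.+1 * 'I_n.+1) := `[< ball (pos h x0 q) r (p z) >].
pose near E (q : 'I_n.+1 * 'I_n.+1) := `[< exists2 a, A E a & ball (pos h x0 q) (2 * h) a >].
have inside (q : 'I_n.+1 * 'I_n.+1) a c : ball 0 M a -> c <= r + 3 * h ->
    ball (pos h x0 q) c a -> (q.1 != ord0) && (q.2 != ord0).
  case: q => i j /ball_coord [/=]; rewrite !sub0r !normrN !ltr_norml.
  move=> /andP [a1 _] /andP [a2 _] cr /ball_coord [/=]; rewrite !ltr_norml.
  move=> /andP [b1 _] /andP [b2 _]; apply/andP; split; apply/eqP => E.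
    by move: b1; rewrite E mul0r addr0 /x0; lra.
  by move: b2; rewrite E mul0r addr0 /x0; lra.
apply: (@blobs_dual V e n sym_e irr_e blob near).
- by move=> z i j /asboolP /(inside (i, j) _ r (pM z)) H; apply: H; lra.
- move=> E i j Ee /asboolP [a Aa aq].
  by apply: (inside (i, j) a (2 * h) (AM E a Ee Aa)) => //; lra.
- move=> z a b /asboolP za /asboolP zb; apply: ball_box za zb => //.
  by move=> s zs; apply/asboolP.
- move=> z z' a /asboolP za /asboolP z'a; apply/eqP; apply: contraT => ne.
  case: (H1 (z, z') ne) => /=; apply: (@le_ball _ _ _ (r + r)); first by lra.
  exact: ball_triangle (ball_sym za) z'a.
- move=> E z a Ee /asboolP [c Ac ca] /asboolP za; apply: contraT => nz.
  case: (H2 (E, z) Ee nz c Ac) => /=; apply: (@le_ball _ _ _ (r + 2 * h)); first by lra.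
  exact: ball_triangle (ball_sym za) ca.
- move=> E F a Ee Fe EF /asboolP [c Ac ca] /asboolP [c' Ac' c'a].
  have [|z zc] := H3 (E, F) Ee Fe EF c c' Ac Ac'.
    apply: (@le_ball _ _ _ (2 * h + 2 * h)); first by lra.
    exact: ball_triangle (ball_sym ca) c'a.
  exists z; apply/asboolP; apply: (@le_ball _ _ _ (2 * h + r / 2)); first by lra.
  exact: ball_triangle ca (ball_sym zc).
- move=> x y xy; have xyE : edge x y \in edges e by rewrite (mem_edges sym_e).
  exists (round2 h x0 n (p x)), (round2 h x0 n (p y)); split.
  + by apply/asboolP; apply: le_ball (round2P h0 lower upper (pM x)); lra.
  + by apply/asboolP; apply: le_ball (round2P h0 lower upper (pM y)); lra.
  apply: (@arc_chain (A (edge x y)) (p x) (p y) h x0 M) => //; last exact: arcs.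
    by move=> c; apply: AM.
  by move=> q c Ac cq; apply/asboolP; exists c.
Qed.

End Planar.

(** * Equitable choosability *)

Lemma planar_sub (R : realType) (V : finType) (e e' : rel V) :
  subrel e' e -> planar R e -> planar R e'.
Proof.
move=> sub [p [A [pinj arcs ends disj]]]; exists p, A.
have subE E : E \in edges e' -> E \in edges e.
  by case/edgesP => [x [y [xy ->]]]; apply/edgesP; exists x, y; split=> //; apply: sub.
split=> // [x y xy|E z /subE|E F /subE Ee /subE Fe]; first exact: arcs (sub _ _ xy).
  exact: ends.
exact: disj.
Qed.

Theorem theorem2p14 (R : realType) (V : finType) (e : rel V) (k : nat)
  (he : simple_graph e)
  (hplanar : planar R e)
  (hC4 : ~ exists c : seq V, chordal_cycle e 4 c)
  (hC6 : ~ exists c : seq V, chordal_cycle e 6 c)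
  (hk : (maxn 7 (max_degree e) <= k)%N) :
  equitably_choosable e k.
Proof.
case: he => sym_e irr_e; move: hk; rewrite geq_max => /andP [k7 dk].
have duals (e' : rel V) : subrel e' e -> symmetric e' -> dual e'.
  move=> sub sym_e'; apply: (planar_dual (R := R) sym_e').
    by move=> x; apply/negP => /sub; rewrite irr_e.
  exact: planar_sub sub hplanar.
have spe := dual_sparse sym_e irr_e hC4 hC6 duals.
apply: (sparse_choosable (k := k)) => //; first exact: ltn_trans k7.
  by move=> V' e' sym' irr'; apply: exists_core.
by move=> x; apply: leq_trans dk; apply: (leq_bigmax (F := fun x => #|[set y | e x y]%SET|)).
Qed.
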